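(* Let $M\in\mathbb N$, $M\ge 2$. Assume: (1) there exist $M$ fronts $Z_1,\dots,Z_M\in L^\infty(\mathbb R)$ with associated end states $v_{1,\pm},\dots,v_{M,\pm}\in H^k_{\rm per}(0,T)$ (all $\mathbb F^m$-valued) such that $\chi_\pm(Z_j-v_{j,\pm})\in H^k(\mathbb R)$ for $j=1,\dots,M$; (2) $v_{j,+}=v_{j+1,-}$ for $j=1,\dots,M-1$; (3) for each $j=1,\dots,M$, $Z_j$ is a nondegenerate solution of $Au+\mathcal N(u,\cdot)=0$. Then there exist $C>0$ and $N\in\mathbb N$ such that for each $n\in\mathbb N$ with $n\ge N$ there exists an $M$-front solution $u_n$ of $Au+\mathcal N(u,\cdot)=0$ given by $$u_n=a_n+\sum_{j=1}^M\chi_{j,n}\,Z_j(\cdot-jnT)$$ with $a_n\in H^k(\mathbb R)$ satisfying $$\|a_n\|_{H^k}\le C\sum_{j=1}^M\Big(\|\chi_-(Z_j-v_{j,-})\|_{H^k(\mathbb R\setminus[-\frac n2T+1,\frac n2T-1])}+\|\chi_+(Z_j-v_{j,+})\|_{H^k(\mathbb R\setminus[-\frac n2T+1,\frac n2T-1])}\Big).$$ In particular, $\|a_n\|_{H^k}$ converges to $0$ as $n\to\infty$.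
   Context: Let $k,m\in\mathbb N$, $T>0$, $\mathbb F\in\{\mathbb R,\mathbb C\}$. Let $\alpha_1,\dots,\alpha_k\in C(\mathbb R,\mathbb F^{m\times m})$ be $T$-periodic with $\alpha_k(x)$ invertible for every $x\in\mathbb R$, and put $Au=\alpha_k\partial_x^ku+\dots+\alpha_1\partial_xu$. Let $\mathcal N:\mathbb F^m\times\mathbb R\to\mathbb F^m$ be continuous, twice continuously differentiable in its first argument and $T$-periodic in its second argument. The equation $Au+\mathcal N(u,\cdot)=0$ describes stationary solutions of $\partial_tu=Au+\mathcal N(u,x)$ on the real line. For $\underline u\in L^\infty(\mathbb R)$ ($\mathbb F^m$-valued), $\mathcal L(\underline u):D(\mathcal L(\underline u))=H^k(\mathbb R)\subset L^2(\mathbb R)\to L^2(\mathbb R)$ is the operator $\mathcal L(\underline u)\varphi=A\varphi+\partial_u\mathcal N(\underline u,\cdot)\varphi$. The function $\underline u$ is called nondegenerate if $\mathcal L(\underline u)$ is invertible. $H^k_{\rm per}(0,T)$ is the space of $T$-periodic functions on $\mathbb R$ that are locally $H^k$. $\chi_\pm:\mathbb R\to[0,1]$ is a smooth partition of unity such that $\chi_+$ is supported on $(-1,\infty)$ and $\chi_-$ is supported on $(-\infty,1)$. For $n\in\mathbb N$, $\chi_{j,n}:\mathbb R\to[0,1]$, $j=1,\dots,M$, is a smooth partition of unity satisfying $\|\chi_{j,n}\|_{W^{k,\infty}}\le 1$, where $\chi_{1,n}$ is supported on $(-\infty,\frac32nT+1)$, $\chi_{M,n}$ is supported on $((M-\frac12)nT-1,\infty)$,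 and (only in case $M>2$) $\chi_{j,n}$ is supported on $((j-\frac12)nT-1,(j+\frac12)nT+1)$ for $j=2,\dots,M-1$. *)

(* Defs.v *)
From HB Require Import structures.
From mathcomp Require Import all_boot all_order all_algebra.
From mathcomp Require Import complex.
From mathcomp Require Import all_classical all_reals all_analysis.
Set Implicit Arguments.
Unset Strict Implicit.
Unset Printing Implicit Defensive.
Import Order.TTheory GRing.Theory Num.Theory.
Import numFieldNormedType.Exports.
Local Open Scope classical_set_scope.
Local Open Scope ring_scope.

Variant field_kind := RealScalars | ComplexScalars.

(* Seen as a numFieldType, each of R and R[i] is a normed space over itself, so
   differentiability over [scalar_field R s] is complex differentiability when
   [s = ComplexScalars]. *)
Definition scalar_field (R : realType) (s : field_kind) : numFieldType :=
  match s with
  | RealScalars => R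
  | ComplexScalars => R[i]
  end.

Definition re_part (R : realType) (s : field_kind) : scalar_field R s -> R :=
  match s return scalar_field R s -> R with
  | RealScalars => fun z => z
  | ComplexScalars => fun z => complex.Re z
  end.

Definition im_part (R : realType) (s : field_kind) : scalar_field R s -> R :=
  match s return scalar_field R s -> R with
  | RealScalars => fun=> 0
  | ComplexScalars => fun z => complex.Im z
  end.

Definition of_real (R : realType) (s : field_kind) : R -> scalar_field R s :=
  match s return R -> scalar_field R s with
  | RealScalars => fun x => x
  | ComplexScalars => fun x => (x%:C)%C
  end.

Section RealFunctions.
Context (R : realType).
Local Notation mu := (@lebesgue_measure R).
Implicit Types f g phi chi : R -> R.

Definition smooth f := forall (i : nat) (x : R), derivable (derive1n i f) x 1.

Definition test_function phi :=
  smooth phi /\ compact (closure [set x | phi x != 0]).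

Definition weak_derivative_real (i : nat) f g :=
  [/\ locally_integrable setT f, locally_integrable setT g &
      forall phi, test_function phi ->
        \int[mu]_x (f x * derive1n i phi x) = (-1) ^+ i * \int[mu]_x (g x * phi x)].

Definition square_integrable_loc f :=
  measurable_fun setT f /\
  forall K, compact K -> (\int[mu]_(x in K) (f x ^+ 2)%:E < +oo)%E.

Definition supported_on f (A : set R) := [set x | f x != 0] `<=` A.

Definition cutoff f := smooth f /\ forall x, 0 <= f x <= 1.

Definition partition_pm (chip chim : R -> R) :=
  [/\ cutoff chip, cutoff chim, forall x, chip x + chim x = 1,
      supported_on chip `]-1, +oo[ & supported_on chim `]-oo, 1[].

Definition front_window (T : R) (M n j : nat) : set R :=
  [set` if j == 1%N then `]-oo, 3 / 2 * n%:R * T + 1[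
  else if j == M then `](M%:R - 1 / 2) * n%:R * T - 1, +oo[
  else `](j%:R - 1 / 2) * n%:R * T - 1, (j%:R + 1 / 2) * n%:R * T + 1[].

(* The W^{k,oo} bound is written with a constant K that does not depend on j
   and n. With K = 1 and k >= 2 no such partition exists once n * T > 2: a smooth
   transition from 1 to 0 within a window of length 2 has a second derivative
   exceeding 1 somewhere. *)
Definition partition_fronts (k M n : nat) (T K : R) (chi : nat -> R -> R) :=
  [/\ forall j, (1 <= j <= M)%N -> cutoff (chi j),
      forall x, \sum_(1 <= j < M.+1) chi j x = 1,
      forall j, (1 <= j <= M)%N -> supported_on (chi j) (front_window T M n j) &
      forall j i x, (1 <= j <= M)%N -> (i <= k)%N -> `|derive1n i (chi j) x| <= K].

End RealFunctions.

Section VectorFunctions.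
Context (R : realType) (s : field_kind) (m : nat).
Local Notation F := (scalar_field R s).
Local Notation mu := (@lebesgue_measure R).
Implicit Types u v w g phi : R -> 'cV[F]_m.

Definition re_coord u (l : 'I_m) : R -> R := fun x => re_part (u x l 0).
Definition im_coord u (l : 'I_m) : R -> R := fun x => im_part (u x l 0).

Definition sqnorm (z : 'cV[F]_m) : R :=
  \sum_l (re_part (z l 0) ^+ 2 + im_part (z l 0) ^+ 2).

Definition in_Lp (p : \bar R) u := forall l,
  re_coord u l \in Lfun mu p /\ im_coord u l \in Lfun mu p.

Definition in_L2_loc u := forall l,
  square_integrable_loc (re_coord u l) /\ square_integrable_loc (im_coord u l).

Definition weak_derivative (i : nat) u g := forall l,
  weak_derivative_real i (re_coord u l) (re_coord g l) /\
  weak_derivative_real i (im_coord u l) (im_coord g l).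

Definition wderiv (i : nat) u : R -> 'cV[F]_m :=
  xget (fun=> 0) [set g | weak_derivative i u g].

Definition in_Hk (k : nat) u := forall i, (i <= k)%N ->
  exists2 g, weak_derivative i u g & in_Lp 2%:E g.

Definition in_Hk_loc (k : nat) u := forall i, (i <= k)%N ->
  exists2 g, weak_derivative i u g & in_L2_loc g.

Definition in_Hk_per (k : nat) (T : R) u :=
  in_Hk_loc k u /\ (fun x => u (x + T)) = u %[ae mu].

Definition L2_norm (Omega : set R) u : R :=
  Num.sqrt (\int[mu]_(x in Omega) sqnorm (u x)).

Definition Hk_norm (k : nat) (Omega : set R) u : R :=
  Num.sqrt (\sum_(i < k.+1) L2_norm Omega (wderiv i u) ^+ 2).

Definition cutoff_mul (chi : R -> R) u : R -> 'cV[F]_m :=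
  fun x => of_real s (chi x) *: u x.

Section Equation.
Context (k : nat) (alpha : nat -> R -> 'M[F]_m) (N : 'cV[F]_m -> R -> 'cV[F]_m).

Definition A_op u : R -> 'cV[F]_m :=
  fun x => \sum_(1 <= i < k.+1) alpha i x *m wderiv i u x.

Definition is_solution u :=
  in_Hk_loc k u /\ (fun x => A_op u x + N (u x) x) = (fun=> 0) %[ae mu].

Definition L_op u phi : R -> 'cV[F]_m :=
  fun x => A_op phi x + 'd (N^~ x) (u x) (phi x).

(* Invertibility of the unbounded operator L(u) on L^2 with domain H^k: it is
   bijective and its inverse is bounded on L^2. *)
Definition nondegenerate_at u :=
  [/\ forall f, in_Lp 2%:E f ->
        exists2 phi, in_Hk k phi & L_op u phi = f %[ae mu],
      forall phi psi, in_Hk k phi -> in_Hk k psi ->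
        L_op u phi = L_op u psi %[ae mu] -> phi = psi %[ae mu] &
      exists C, forall phi, in_Hk k phi ->
        L2_norm setT phi <= C * L2_norm setT (L_op u phi)].

End Equation.

Definition is_front (k : nat) (T : R) (chip chim : R -> R)
    (Z vp vm : R -> 'cV[F]_m) :=
  [/\ in_Lp +oo%E Z, in_Hk_per k T vp, in_Hk_per k T vm,
      in_Hk k (cutoff_mul chip (Z \- vp)) & in_Hk k (cutoff_mul chim (Z \- vm))].

(* Twice continuous differentiability in the first argument, the first two
   derivatives being jointly continuous; in finite dimension it is enough to
   test the derivatives on fixed directions h, h'. *)
Definition C2_first_argument (N : 'cV[F]_m -> R -> 'cV[F]_m) :=
  [/\ forall (z : 'cV[F]_m) (x : R), differentiable (N^~ x) z,
      forall h : 'cV[F]_m,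
        continuous (fun p : 'cV[F]_m * R => 'd (N^~ p.2) (p.1) h),
      forall (h z : 'cV[F]_m) (x : R),
        differentiable (fun y : 'cV[F]_m => 'd (N^~ x) y h) z &
      forall h h' : 'cV[F]_m, continuous (fun p : 'cV[F]_m * R =>
        'd (fun y : 'cV[F]_m => 'd (N^~ p.2) y h) (p.1) h')].

End VectorFunctions.

Definition multi_front (R : realType) (s : field_kind) (m M n : nat) (T : R)
    (chi : nat -> R -> R) (Z : nat -> R -> 'cV[scalar_field R s]_m) :
    R -> 'cV[scalar_field R s]_m :=
  fun x => \sum_(1 <= j < M.+1)
             cutoff_mul (chi j) (fun y => Z j (y - j%:R * n%:R * T)) x.

(* The complement of [- n T / 2 + 1, n T / 2 - 1]. *)
Definition far_region (R : realType) (T : R) (n : nat) : set R :=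
  ~` `[- (n%:R / 2 * T) + 1, n%:R / 2 * T - 1].

(* Main.v *)
Require Import Defs.
From HB Require Import structures.
From mathcomp Require Import all_boot all_order all_algebra.
From mathcomp Require Import complex.
From mathcomp Require Import all_classical all_reals all_analysis.
From mathcomp Require Import measurable_realfun.
From mathcomp Require Import ring lra.
Set Implicit Arguments.
Unset Strict Implicit.
Unset Printing Implicit Defensive.
Import Order.TTheory GRing.Theory Num.Theory.
Import numFieldNormedType.Exports.
Local Open Scope classical_set_scope.
Local Open Scope ring_scope.

(** In real coordinates a solution is sought as [w + b], where [w] is the superposition of
    the translated fronts.  The line is cut into cells around the fronts.  The operators
    [S_j] inverting the linearizations at the single (translated) fronts are patched to an
    approximate right inverse [f |-> sum_j theta_j S_j (1_j f)], with [1_j] the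
    indicator of the j-th cell and [theta_j] slowly varying cutoffs equal to 1 on it.  With
    [b] written in this form, the equation becomes a fixed point equation for [f] in L2.  The
    map is a contraction on a small ball: commutators with [theta_j] are O(1/n), the
    linearization at [w] is close to the one at the j-th front on the support of [theta_j],
    and the remainder is quadratic by Sobolev's inequality.  The residual of [w] is supported
    near the cell boundaries, where two neighbouring fronts are both close to their common
    periodic end state, which bounds it by the tails in the statement.  Nondegeneracy gives
    H^k bounds for [S_j] by interpolation and the invertibility of the leading coefficient.

    The only mollifiers needed come from the partition of unity of the statement: [chip] is
    a smooth step, and differences of its rescalings are test functions. *)

(** * Smooth functions *)

(** The linearization at [w] itself is never inverted. Because the unknown is the datum [f] of the
    patched inverse, the map to be iterated is a small perturbation of a constant: differences of
    its values are bounded by L2 norms of jets of chosen solutions, so no derivative is lost and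
    completeness of L2 suffices. Translation by a multiple of the period conjugates the
    linearization at a front to the one at its translate; hence the bounds for [S_j], and with them
    all constants of the gluing step, do not depend on [n]. The common end state of two neighbouring
    fronts cancels in their difference before anything is differentiated.

    Norms are kept squared. The triangle inequality then costs a factor 2, which accounts for the
    contraction factor 1/16 and for radii such as 4 and 8 times the residual; square roots return
    only in the last step. As the scalars may be complex, everything is transported to real
    coordinates, where the nonlinearity is expanded along real segments. *)

Section Smooth.
Context {R : realType}.
Implicit Types (f g : R -> R) (i : nat) (x a b : R).

Lemma derive1nSr i f : derive1n i.+1 f = derive1n i (derive1 f).
Proof. by rewrite /derive1n iterSr. Qed.

Lemma smooth_derivable f x : smooth f -> derivable f x 1.
Proof. by move=> /(_ 0%N x). Qed.

Lemma smooth_derive1 f : smooth f -> smooth (derive1 f).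
Proof. by move=> sf i x; rewrite -derive1nSr. Qed.

Lemma smooth_derive1n f i : smooth f -> smooth (derive1n i f).
Proof. by move=> sf; elim: i => [|i IH]; [exact: sf|exact: smooth_derive1 IH]. Qed.

Lemma smooth_continuous f : smooth f -> continuous f.
Proof.
by move=> sf x; apply: differentiable_continuous; apply/derivable1_diffP/(sf 0%N).
Qed.

Lemma derive1nSr_cst i a : derive1n i.+1 (fun=> a : R) = fun=> 0.
Proof.
elim: i => [|i IH]; first by apply/funext => x; rewrite /= derive1_cst.
by rewrite derive1nS IH; apply/funext => x; rewrite derive1_cst.
Qed.

Lemma smooth_cst a : smooth (fun=> a : R).
Proof.
by case=> [|i] x; [apply: derivable_cst|rewrite derive1nSr_cst; apply: derivable_cst].
Qed.

Lemma derive1D f g x : derivable f x 1 -> derivable g x 1 ->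
  derive1 (fun y => f y + g y) x = derive1 f x + derive1 g x.
Proof. by move=> df dg; rewrite !derive1E (deriveD df dg). Qed.

Lemma derive1M f g x : derivable f x 1 -> derivable g x 1 ->
  derive1 (fun y => f y * g y) x = derive1 f x * g x + f x * derive1 g x.
Proof.
move=> df dg; rewrite !derive1E.
have -> : 'D_1 (fun y => f y * g y) x = f x *: 'D_1 g x + g x *: 'D_1 f x.
  exact: (deriveM df dg).
by rewrite addrC; congr (_ + _); rewrite mulrC.
Qed.

Lemma derive1n_add i f g :
  (forall j y, (j < i)%N -> derivable (derive1n j f) y 1) ->
  (forall j y, (j < i)%N -> derivable (derive1n j g) y 1) ->
  derive1n i (fun y => f y + g y) = fun x => derive1n i f x + derive1n i g x.
Proof.
elim: i => [//|i IH] df dg; rewrite derive1nS IH; last 2 first.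
- by move=> j y ji; apply: df; rewrite ltnS ltnW.
- by move=> j y ji; apply: dg; rewrite ltnS ltnW.
by apply/funext => x; rewrite derive1D//; [apply: df|apply: dg].
Qed.

Lemma derive1nD i f g : smooth f -> smooth g ->
  derive1n i (fun y => f y + g y) = fun x => derive1n i f x + derive1n i g x.
Proof. by move=> sf sg; apply: derive1n_add => j y _; [apply: sf|apply: sg]. Qed.

Lemma smoothD f g : smooth f -> smooth g -> smooth (fun x => f x + g x).
Proof.
by move=> sf sg i x; rewrite derive1nD//; apply: derivableD; [apply: sf|apply: sg].
Qed.

Lemma derive1M_smooth f g : smooth f -> smooth g ->
  derive1 (fun y => f y * g y) = fun x => derive1 f x * g x + f x * derive1 g x.
Proof.
by move=> sf sg; apply/funext => x; rewrite derive1M//; apply: smooth_derivable.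
Qed.

(** Induction on the order for all pairs at once: one differentiation leaves two products of smooth
    functions, so no Leibniz formula is needed. The induction is strong because [derive1n_add] asks
    for derivability at all lower orders. *)
Lemma smoothM f g : smooth f -> smooth g -> smooth (fun x => f x * g x).
Proof.
move=> sf sg i; have [n] := ubnP i; elim: n i f g sf sg => // n IH i f g sf sg.
case: i => [_ x|i ilen x]; first by apply: derivableM; apply: smooth_derivable.
rewrite derive1nSr (derive1M_smooth sf sg) derive1n_add => [|j y ji|j y ji].
- apply: derivableD; first exact: (IH i (derive1 f) g (smooth_derive1 sf) sg ilen x).
  exact: (IH i f (derive1 g) sf (smooth_derive1 sg) ilen x).
- exact: (IH j (derive1 f) g (smooth_derive1 sf) sg (ltn_trans ji ilen) y).
- exact: (IH j f (derive1 g) sf (smooth_derive1 sg) (ltn_trans ji ilen) y).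
Qed.

Lemma derive1nZ i a f : smooth f ->
  derive1n i (fun y => a * f y) = fun x => a * derive1n i f x.
Proof.
move=> sf; elim: i => [//|i IH]; rewrite derive1nS IH; apply/funext => x.
rewrite derive1M; [|exact: derivable_cst|exact: sf].
by rewrite derive1_cst mul0r add0r.
Qed.

Lemma smoothZ a f : smooth f -> smooth (fun x => a * f x).
Proof. by apply: smoothM; exact: smooth_cst. Qed.

Lemma derivable_affine f a b x : derivable f (a * x + b) 1 ->
  is_derive x 1 (fun y => f (a * y + b)) (a * derive1 f (a * x + b)).
Proof.
move=> df.
have h : is_derive x 1 (fun y => a * y + b) a.
  have da : derivable (fun y : R => a * y) x 1.
    by apply: derivableM; [exact: derivable_cst|exact: derivable_id].
  apply: DeriveDef; first by apply: derivableD; [exact: da|exact: derivable_cst].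
  rewrite -derive1E (derive1D da (derivable_cst _ _ _)) derive1M; [|exact: derivable_cst|exact: derivable_id].
  by rewrite !derive1_cst derive1_id mul0r add0r addr0 mulr1.
have hf : is_derive (a * x + b) 1 f (derive1 f (a * x + b)).
  by rewrite derive1E; apply: DeriveDef.
have := @is_derive1_comp _ f (fun y => a * y + b) x _ _ hf h.
by rewrite mulrC.
Qed.

Lemma derive1n_affine i f a b : smooth f ->
  derive1n i (fun y => f (a * y + b)) =
  fun x => a ^+ i * derive1n i f (a * x + b).
Proof.
move=> sf; elim: i => [|i IH]; first by apply/funext => x; rewrite expr0 mul1r.
rewrite derive1nS IH; apply/funext => x.
have h := derivable_affine (sf i (a * x + b)).
rewrite derive1M; [|exact: derivable_cst|exact: (@ex_derive _ _ _ _ _ _ _ h)].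
rewrite derive1_cst mul0r add0r derive1E (@derive_val _ _ _ _ _ _ _ h).
by rewrite exprSr mulrA.
Qed.

Lemma smooth_affine f a b : smooth f -> smooth (fun y => f (a * y + b)).
Proof.
move=> sf i x; rewrite derive1n_affine//.
apply: derivableM; first exact: derivable_cst.
exact: (@ex_derive _ _ _ _ _ _ _ (derivable_affine (sf i (a * x + b)))).
Qed.

Lemma derive1n_near i f g x : (\forall y \near x, f y = g y) ->
  \forall y \near x, derive1n i f y = derive1n i g y.
Proof.
move=> fg; elim: i => [//|i IH].
near=> y; rewrite !derive1nS !derive1E; apply: near_eq_derive => //.
near: y; exact: (near_join IH).
Unshelve. all: by end_near. Qed.

Lemma smooth_derive1n_continuous i f : smooth f -> continuous (derive1n i f).
Proof. by move=> sf; apply: smooth_continuous; exact: smooth_derive1n. Qed.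

End Smooth.

(** * Locally integrable functions and translations *)

Section LocallyIntegrable.
Context {R : realType}.
Local Notation mu := (@lebesgue_measure R).
Local Notation locint := (locally_integrable (setT : set R)).
Implicit Types (f g phi chi : R -> R) (i : nat) (x a b r : R).

Definition vanishes_outside r phi := forall x, r < `|x| -> phi x = 0.

Lemma continuous_bounded_ball f r : continuous f ->
  exists2 C : R, 0 < C & forall x, `|x| <= r -> `|f x| <= C.
Proof.
move=> cf; have cK : compact `[- r, r] by exact: segment_compact.
have [M [_ HM]] : bounded_set (f @` `[- r, r]).
  apply: (@compact_bounded R R^o); apply: continuous_compact => //.
  exact/continuous_subspaceT.
exists (`|M| + 1); first by rewrite ltr_wpDl.
move=> x xr; apply: (HM (`|M| + 1)); first by rewrite (le_lt_trans (ler_norm _)) ?ltrDl.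
by exists x => //; rewrite /= in_itv/= -ler_norml.
Qed.

Lemma compact_support_bounded phi : compact (closure [set x | phi x != 0]) ->
  exists2 r, 0 < r & vanishes_outside r phi.
Proof.
move=> /(@compact_bounded R R^o)[M [_ HM]].
exists (`|M| + 1); first by rewrite ltr_wpDl.
move=> x; apply: contraPP => /eqP px; apply/negP; rewrite -leNgt.
apply: (HM (`|M| + 1)); first by rewrite (le_lt_trans (ler_norm _)) ?ltrDl.
exact: subset_closure.
Qed.

Lemma test_functionP phi : test_function phi <->
  smooth phi /\ exists2 r, 0 < r & vanishes_outside r phi.
Proof.
split=> [[sp cp]|[sp [r r0 h]]]; split => //; first exact: compact_support_bounded.
apply: (@subclosed_compact _ _ `[- r, r]); [exact: closed_closure|exact: segment_compact|].
have cl : closed `[- r, r]%classic by exact: itv_closed.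
rewrite closureE => x; apply; split => // y /= hy.
rewrite in_itv/= -ler_norml leNgt; apply: contraNN hy => hy.
by rewrite h.
Qed.

Lemma vanishes_outside_derive1n r phi i : 
  vanishes_outside r phi -> vanishes_outside r (derive1n i phi).
Proof.
move=> h x rx; have nf : \forall y \near x, phi y = 0.
  have op : open [set y : R | r < `|y|].
    by apply: (@open_comp _ _ (fun y : R => `|y|) [set y | r < y]) => // y _; exact: norm_continuous.
  by apply: filterS (open_nbhs_nbhs (conj op rx)) => y; exact: h.
case: i => [|i]; first exact: h.
have := derive1n_near (i.+1) (g := fun=> 0) nf.
by rewrite derive1nSr_cst => /nbhs_singleton.
Qed.

Lemma test_function_derive1n i phi : test_function phi -> test_function (derive1n i phi).
Proof.
move=> /test_functionP[sp [r r0 h]]; apply/test_functionP; split.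
  exact: smooth_derive1n.
by exists r => //; exact: vanishes_outside_derive1n.
Qed.

Lemma test_functionM chi phi : smooth chi -> test_function phi ->
  test_function (fun x => chi x * phi x).
Proof.
move=> sc /test_functionP[sp [r r0 h]]; apply/test_functionP; split; first exact: smoothM.
by exists r => // x rx; rewrite h// mulr0.
Qed.

Lemma test_function_affine a b phi : a != 0 -> test_function phi ->
  test_function (fun x => phi (a * x + b)).
Proof.
move=> a0 /test_functionP[sp [r r0 h]].
apply/test_functionP; split; first exact: smooth_affine.
exists ((r + `|b|) / `|a|); first by rewrite divr_gt0 ?normr_gt0// ltr_pwDl.
move=> x; rewrite ltr_pdivrMr ?normr_gt0// -normrM => H; apply: h.
have := ler_normB (a * x + b) b; rewrite addrK => H2.
by rewrite [x * a]mulrC in H; have := lt_le_trans H H2; lra.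
Qed.

Lemma locint_measurable f : locint f -> measurable_fun setT f.
Proof. by case. Qed.

Lemma locintP f : measurable_fun setT f ->
  (forall r, (\int[mu]_(x in `[(- r)%R, r]) `|f x|%:E < +oo)%E) -> locint f.
Proof.
move=> mf h; split => //; first exact: openT.
move=> K _ cK.
have [M [_ HM]] := @compact_bounded R R^o _ cK.
apply: le_lt_trans (h (`|M| + 1)); apply: ge0_subset_integral => //=.
- exact: compact_measurable.
- apply/measurable_EFinP; apply: measurableT_comp => //; exact: measurable_funTS.
- move=> x Kx; rewrite /= in_itv/= -ler_norml.
  by apply: HM => //; rewrite (le_lt_trans (ler_norm _)) ?ltrDl.
Qed.

Lemma locint_ball f r : locint f -> mu.-integrable `[- r, r] (EFin \o f).
Proof.
move=> [mf _ h]; apply/integrableP; split.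
  by apply/measurable_EFinP; exact: measurable_funTS.
by apply: h => //; exact: segment_compact.
Qed.

Lemma locint_mul_integrable f phi r : locint f -> continuous phi ->
  vanishes_outside r phi -> mu.-integrable setT (EFin \o (fun x => f x * phi x)).
Proof.
move=> lf cphi v.
have [C C0 HC] := continuous_bounded_ball r cphi.
have mphi := continuous_measurable_fun cphi.
have /(integrable_mkcond _ _) H := locint_ball r lf.
have {}H := H (measurable_itv _).
apply: (le_integrable _ _ _ (integrableZl _ C H)) => //=.
  apply/measurable_EFinP; apply: measurable_funM => //; exact: locint_measurable lf.
move=> x _ /=; rewrite abseM/= !patchE; case: ifPn => [|].
  rewrite inE/= in_itv/= -ler_norml => xr.
  have -> : (`|C|%:E * `|f x|%:E = (C * `|f x|)%:E)%E by rewrite EFinM gtr0_norm.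
  by rewrite lee_fin normrM [leRHS]mulrC ler_wpM2l// HC.
rewrite notin_setE/= in_itv/= => /negP; rewrite -ler_norml -ltNge => /v ->.
by rewrite mulr0 normr0 mule_ge0// lee_fin.
Qed.

Lemma locint_test f phi : locint f -> test_function phi ->
  mu.-integrable setT (EFin \o (fun x => f x * phi x)).
Proof.
move=> lf /test_functionP[sp [r r0 h]].
by apply: locint_mul_integrable h => //; exact: smooth_continuous.
Qed.

Lemma le_locint f g : measurable_fun setT f -> locint g ->
  (forall r, exists2 C : R, 0 <= C & forall x, `|x| <= r -> `|f x| <= C * `|g x|) -> locint f.
Proof.
move=> mf lg h; apply: locintP => // r.
have [C C0 HC] := h r.
have : mu.-integrable `[- r, r] (fun x => C%:E * (g x)%:E)%E.
  by apply: integrableZl => //; exact: locint_ball.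
move=> /integrableP[mCg]; apply: le_lt_trans.
apply: ge0_le_integral => //=.
- by apply/measurable_EFinP; apply: measurableT_comp => //; exact: measurable_funTS.
- apply/measurable_EFinP; apply: measurableT_comp => //; apply: measurable_funM => //.
  by apply: measurable_funTS; exact: locint_measurable lg.
- move=> x; rewrite in_itv/= -ler_norml => xr.
  by rewrite lee_fin normrM (ger0_norm C0) HC.
Qed.

Lemma locintM f chi : locint f -> continuous chi -> locint (fun x => chi x * f x).
Proof.
move=> lf cc; apply: (le_locint _ lf).
  by apply: measurable_funM; [exact: continuous_measurable_fun|exact: locint_measurable lf].
move=> r; have [C C0 HC] := continuous_bounded_ball r cc.
by exists C; [exact: ltW|move=> x xr; rewrite normrM ler_wpM2r// HC].
Qed.

Lemma locintZ f a : locint f -> locint (fun x => a * f x).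
Proof. by move=> lf; apply: locintM => // x; exact: cst_continuous. Qed.

Lemma locintD f g : locint f -> locint g -> locint (fun x => f x + g x).
Proof.
move=> lf lg; apply: locintP.
  by apply: measurable_funD; [exact: locint_measurable lf|exact: locint_measurable lg].
move=> r.
suff /integrableP[_] : mu.-integrable `[- r, r] (EFin \o (fun x => f x + g x)) by [].
by apply: (integrableD _ (locint_ball r lf) (locint_ball r lg)).
Qed.

Lemma locintB f g : locint f -> locint g -> locint (fun x => f x - g x).
Proof.
move=> lf lg; have := locintD lf (locintZ (-1) lg).
by under eq_fun do rewrite mulN1r.
Qed.

Lemma locint_cst a : locint (fun=> a).
Proof.
apply: locintP => // r; rewrite integral_cst//= lebesgue_measure_itv/=.
by case: ifP => _; rewrite -?EFinD -?EFinM ?mule0 ltry.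
Qed.

Lemma locint_sum (I : Type) (s : seq I) (F : I -> R -> R) :
  (forall j, locint (F j)) -> locint (fun x => \sum_(j <- s) F j x).
Proof.
move=> h; elim: s => [|j s IH].
  by under eq_fun do rewrite big_nil; exact: locint_cst.
by under eq_fun do rewrite big_cons; exact: locintD.
Qed.

End LocallyIntegrable.

(** * Almost-everywhere statements on the line *)

Section AlmostEverywhere.
Context {R : realType}.
Local Notation mu := (@lebesgue_measure R).
Implicit Types (P Q S : R -> Prop).

Definition aeR P := {ae mu, forall x, P x}.

Let aeF : Filter (almost_everywhere mu).
Proof. exact: (ae_filter_ringOfSetsType [the measure _ _ of mu]). Qed.

Lemma aeR_all P : (forall x, P x) -> aeR P.
Proof. by move=> h; apply: (@filterS _ _ aeF setT) => //; exact: filterT. Qed.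

Lemma aeRS P Q : (forall x, P x -> Q x) -> aeR P -> aeR Q.
Proof. exact: (@filterS _ _ aeF). Qed.

Lemma aeRS2 P Q S : (forall x, P x -> Q x -> S x) -> aeR P -> aeR Q -> aeR S.
Proof. exact: (@filterS2 _ _ aeF). Qed.

Lemma aeRS3 P Q S P' : (forall x, P x -> Q x -> S x -> P' x) ->
  aeR P -> aeR Q -> aeR S -> aeR P'.
Proof. exact: (@filterS3 _ _ aeF). Qed.

Lemma aeR_forall_fin (I : finType) (P : I -> R -> Prop) :
  (forall i, aeR (P i)) -> aeR (fun x => forall i, P i x).
Proof. exact: (@filter_forall _ _ _ _ aeF). Qed.

Lemma aeR_forall_nat (P : nat -> R -> Prop) :
  (forall i, aeR (P i)) -> aeR (fun x => forall i, P i x).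
Proof. exact: (@ae_foralln _ _ _ [the measure _ _ of mu]). Qed.

Lemma aeR_imp (A : Prop) P : (A -> aeR P) -> aeR (fun x => A -> P x).
Proof.
by have [a|na] := pselect A => h;
  [apply: aeRS (h a) => x Px _|apply: aeR_all => x /na].
Qed.

Lemma aeRT (V : Type) (f g : R -> V) : f = g %[ae mu] <-> aeR (fun x => f x = g x).
Proof. by split; apply: aeRS => x // h; exact: h. Qed.

End AlmostEverywhere.

(** * Translation invariance of the integral *)

Section Translation.
Context {R : realType}.
Local Notation mu := (@lebesgue_measure R).
Local Notation locint := (locally_integrable (setT : set R)).
Implicit Types (f g : R -> R) (c : R).

(** Typed on [measurableTypeR R] so that it can be declared a measurable function, which the
    pushforward of the measure requires. *)
Definition shift c : measurableTypeR R -> measurableTypeR R := fun x => x + c.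

Lemma measurable_shift c : measurable_fun setT (shift c).
Proof. by apply: measurable_funD. Qed.

HB.instance Definition _ c := isMeasurableFun.Build _ _ _ _ (shift c) (measurable_shift c).

(** The pushforward agrees with Lebesgue measure on half-open intervals, which determine it. *)
Lemma lebesgue_measure_shift c (A : set (measurableTypeR R)) : measurable A ->
  mu (shift c @^-1` A) = mu A.
Proof.
move=> mA; apply/esym.
apply: (@lebesgue_measure_unique R (pushforward mu (shift c))) => //= _ [[a b]] _ <-.
rewrite /pushforward/=.
have -> : shift c @^-1` `]a, b] = `]a - c, b - c]%classic.
  by apply/seteqP; split => x /=; rewrite /shift !in_itv/= ltrBlDr lerBrDr.
rewrite !lebesgue_measure_itv/= !lte_fin ltrD2r; case: ifP => // _.
by rewrite -!EFinB; congr EFin; ring.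
Qed.

Lemma ge0_integral_shift c (f : measurableTypeR R -> \bar R) : measurable_fun setT f ->
  (forall x, 0 <= f x)%E -> (\int[mu]_x f (shift c x) = \int[mu]_x f x)%E.
Proof.
move=> mf f0.
transitivity (\int[pushforward mu (shift c)]_x f x)%E.
  by rewrite ge0_integral_pushforward.
by apply: eq_measure_integral => A mA _ /=; exact: lebesgue_measure_shift.
Qed.

Lemma integral_shift c (f : measurableTypeR R -> \bar R) : measurable_fun setT f ->
  (\int[mu]_x f (shift c x) = \int[mu]_x f x)%E.
Proof.
move=> mf; rewrite integralE [RHS]integralE; congr (_ - _)%E.
  by rewrite -[RHS](ge0_integral_shift c) ; [|exact: measurable_funepos|by []];
    apply: eq_integral => x _; rewrite !funeposE.
by rewrite -[RHS](ge0_integral_shift c) ; [|exact: measurable_funeneg|by []];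
  apply: eq_integral => x _; rewrite !funenegE.
Qed.

Lemma negligible_shift c (P : R -> Prop) : aeR P -> aeR (fun x => P (x + c)).
Proof.
move=> [A [mA A0 h]]; exists (shift c @^-1` A); split.
- by rewrite -[X in measurable X]setTI; apply: measurable_shift.
- by rewrite lebesgue_measure_shift.
- by move=> x /= nP; apply: h.
Qed.

Lemma measurable_fun_shift c f : measurable_fun setT f ->
  measurable_fun setT (fun x : R => f (x + c)).
Proof. by move=> mf; apply: (measurableT_comp mf (measurable_shift c)). Qed.

Lemma locint_shift c f : locint f -> locint (fun x : R => f (x + c)).
Proof.
move=> lf; have mf := locint_measurable lf.
apply: locintP; first exact: measurable_fun_shift.
move=> r; have := locint_ball (r + `|c|) lf => /integrableP[_].
apply: le_lt_trans; rewrite integral_mkcond [leRHS]integral_mkcond.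
have mr : measurable_fun setT ((fun x : measurableTypeR R => `|(EFin \o f) x|%E) \_ `[- (r + `|c|), r + `|c|]).
  apply/(measurable_restrictT _ _).1 => //; apply: measurableT_comp => //.
  by apply/measurable_EFinP; exact: measurable_funTS.
rewrite -[leRHS](ge0_integral_shift c)//; last by move=> x; apply: erestrict_ge0.
apply: ge0_le_integral => //=.
- by move=> x _; apply: erestrict_ge0.
- apply/(measurable_restrictT _ _).1 => //; apply/measurable_EFinP.
  by apply: measurableT_comp => //; apply: measurable_funTS; exact: measurable_fun_shift.
- exact: (measurableT_comp mr (measurable_shift c)).
- move=> x _; rewrite !patchE; case: ifPn => [|_].
    rewrite inE/= in_itv/= -ler_norml => xr.
    rewrite mem_set//= in_itv/= -ler_norml.
    by rewrite (le_trans (ler_normD _ _))// lerD2r.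
  by case: ifP => _ //; rewrite lee_fin.
Qed.

End Translation.

(** * Mollification by a step function *)

Section WeakDerivative.
Context {R : realType}.
Local Notation mu := (@lebesgue_measure R).
Local Notation locint := (locally_integrable (setT : set R)).
Implicit Types (f g phi chi : R -> R) (i : nat) (a b c x r : R).

Lemma Rintegral_derive1 (F : R -> R) a b : a < b -> smooth F ->
  (forall x, x \notin `[a, b] -> derive1 F x = 0) ->
  \int[mu]_x derive1 F x = F b - F a.
Proof.
move=> ab sF h.
have -> : \int[mu]_x derive1 F x = \int[mu]_(x in `[a, b]) derive1 F x.
  rewrite [RHS]Rintegral_mkcond; apply: eq_Rintegral => x _.
  by rewrite patchE; case: ifPn => //; rewrite notin_setE => /negP; exact: h.
have cF := smooth_continuous sF.
rewrite /Rintegral (@continuous_FTC2 _ _ F) ?fineD//=.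
- apply: continuous_subspaceT ; exact: (@smooth_derive1n_continuous _ 1 _ sF).
- split.
  + by move=> x _; exact: smooth_derivable.
  + by apply: cvg_at_right_filter; exact: cF.
  + by apply: cvg_at_left_filter; exact: cF.
Qed.

(** Primitive of a mollifier: the derivative of a rescaled step is a kernel of mass 1. This kernel
    may change sign, so later estimates rest on its sup bound. *)
Definition step_function (h : R -> R) :=
  [/\ smooth h, forall x, x <= -1 -> h x = 0, forall x, 1 <= x -> h x = 1 &
      forall x, 0 <= h x <= 1].

Section Mollify.
Variables (h : R -> R) (sh : step_function h).

Definition step_at e x : R -> R := fun y => h (e^-1 * y + (- (e^-1 * x))).

Let hsm : smooth h. Proof. by case: sh. Qed.

Lemma smooth_step_at e x : smooth (step_at e x).
Proof. exact: smooth_affine. Qed.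

Lemma derive1n_step_at i e x y :
  derive1n i (step_at e x) y = e^-1 ^+ i * derive1n i h (e^-1 * (y - x)).
Proof. by rewrite /step_at derive1n_affine// mulrBr. Qed.

Lemma step_atE e x y : step_at e x y = h (e^-1 * (y - x)).
Proof. by rewrite /step_at mulrBr. Qed.

Lemma step_at0 e x y : 0 < e -> y <= x - e -> step_at e x y = 0.
Proof.
move=> e0 yx; rewrite step_atE; case: sh => _ h0 _ _; apply: h0.
by rewrite mulrC ler_pdivrMr// mulN1r; lra.
Qed.

Lemma step_at1 e x y : 0 < e -> x + e <= y -> step_at e x y = 1.
Proof.
move=> e0 yx; rewrite step_atE; case: sh => _ _ h1 _; apply: h1.
by rewrite mulrC ler_pdivlMr// mul1r; lra.
Qed.

Lemma step_at_ge0_le1 e x y : 0 <= step_at e x y <= 1.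
Proof. by case: sh => _ _ _; apply. Qed.

Lemma derive1n_step0 i y : 1 < `|y| -> derive1n i.+1 h y = 0.
Proof.
move=> y1; case: sh => _ h0 h1 _.
have [y0|y0] := leP y 0.
  have nf : \forall z \near y, h z = 0.
    rewrite ler0_norm// in y1.
    have : \forall z \near y, z < -1 by apply: lt_nbhsl; rewrite ltrNr.
    by apply: filterS => z z1; apply: h0; exact: ltW.
  have := derive1n_near i.+1 (g := fun=> 0) nf.
  by rewrite derive1nSr_cst => /nbhs_singleton.
have nf : \forall z \near y, h z = 1.
  rewrite gtr0_norm// in y1.
  have : \forall z \near y, 1 < z by apply: lt_nbhsr.
  by apply: filterS => z z1; apply: h1; exact: ltW.
have := derive1n_near i.+1 (g := fun=> 1) nf.
by rewrite derive1nSr_cst => /nbhs_singleton.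
Qed.

Lemma derive1n_step_bounded i : exists2 C : R, 0 < C &
  forall y, `|derive1n i h y| <= C.
Proof.
have [C C0 HC] := continuous_bounded_ball 1 (@smooth_derive1n_continuous _ i _ hsm).
(* The summand 1 serves order 0: outside [[-1, 1]] the step itself is bounded by 1, while its
   derivatives vanish there. *)
exists (C + 1); first exact: addr_gt0.
move=> y; have [y1|y1] := leP `|y| 1.
  by rewrite (le_trans (HC _ y1))// lerDl.
case: i C C0 HC => [|i] C C0 HC; last by rewrite derive1n_step0// normr0 addr_ge0// ltW.
case: sh => _ _ _ /(_ y)/andP[h0 h1] /=.
by rewrite ger0_norm// (le_trans h1)// lerDr ltW.
Qed.

Lemma derive1n_step_at_le i C e x : (forall y, `|derive1n i h y| <= C) -> 0 < e ->
  forall y, `|derive1n i (step_at e x) y| <= e^-1 ^+ i * C.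
Proof.
move=> hC e0 y; have ie0 : 0 <= e^-1 ^+ i by rewrite exprn_ge0// invr_ge0 ltW.
by rewrite derive1n_step_at normrM ger0_norm// ler_wpM2l.
Qed.

Lemma derive1n_step_at0 i e x y : 0 < e -> e < `|y - x| -> derive1n i.+1 (step_at e x) y = 0.
Proof.
move=> e0 yx; rewrite derive1n_step_at derive1n_step0 ?mulr0//.
by rewrite normrM gtr0_norm ?invr_gt0// mulrC ltr_pdivlMr// mul1r.
Qed.

Lemma test_function_step_at i e x : 0 < e -> test_function (derive1n i.+1 (step_at e x)).
Proof.
move=> e0; apply/test_functionP; split.
  by apply: smooth_derive1n; exact: smooth_step_at.
exists (e + `|x|); first by rewrite ltr_pwDl.
move=> y ey; apply: derive1n_step_at0 => //.
have := ler_normD (y - x) x; rewrite subrK => H.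
by have := lt_le_trans ey H; rewrite ltrD2r.
Qed.

Lemma step_atB_le1 e l x y : `|step_at e x y - step_at l x y| <= 1.
Proof.
have /andP[? ?] := step_at_ge0_le1 e x y; have /andP[? ?] := step_at_ge0_le1 l x y.
by rewrite ler_norml; apply/andP; split; lra.
Qed.

Lemma step_atB_eq0 e l x y : 0 < e <= l -> l < `|y - x| ->
  step_at e x y - step_at l x y = 0.
Proof.
move=> /andP[e0 el] ly; have l0 := lt_le_trans e0 el.
have [yx|yx] := leP (y - x) 0.
  by rewrite ler0_norm// in ly; rewrite !step_at0 ?subrr//; lra.
by rewrite gtr0_norm// in ly; rewrite !step_at1 ?subrr//; lra.
Qed.

Lemma test_function_step_atB e l x : 0 < e <= l ->
  test_function (fun y => step_at e x y - step_at l x y).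
Proof.
move=> /andP[e0 el]; have l0 := lt_le_trans e0 el.
apply/test_functionP; split.
  have := smoothD (@smooth_step_at e x) (@smoothZ _ (-1) _ (@smooth_step_at l x)).
  by under eq_fun do rewrite mulN1r.
exists (l + `|x|); first by rewrite ltr_pwDl.
move=> y ey; apply: step_atB_eq0; first by rewrite e0.
have := ler_normD (y - x) x; rewrite subrK => H.
by have := lt_le_trans ey H; rewrite ltrD2r.
Qed.

Lemma Rintegral_step_at e x : 0 < e -> \int[mu]_y derive1 (step_at e x) y = 1.
Proof.
move=> e0; rewrite (@Rintegral_derive1 _ (x - e) (x + e)).
- by rewrite step_at1// step_at0// subr0.
- lra.
- exact: smooth_step_at.
- move=> y; rewrite in_itv/= -ler_distl -ltNge => ye.
  exact: (@derive1n_step_at0 0).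
Qed.

(** As the kernel has mass 1, the error is the integral of [f y - f x] against it. The kernel is at
    most [C / e] and lives on an interval of length of order [e], so the error is controlled by the
    mean oscillation, which tends to 0 at a Lebesgue point. *)
Lemma mollify f x : locint f -> lebesgue_pt f x -> forall d : R, 0 < d ->
  exists2 e0 : R, 0 < e0 & forall e : R, 0 < e < e0 ->
    `|\int[mu]_y (f y * derive1 (step_at e x) y) - f x| <= d.
Proof.
move=> lf lx d d0.
have [C C0 HC] := derive1n_step_bounded 1.
(* The ball of radius [2 * e] has measure [4 * e], and [C / e * (4 * e) * (d / (4 * C)) = d]. *)
have d'0 : 0 < d / (4 * C) by rewrite divr_gt0// mulr_gt0.
have : \forall r \near (0:R)^'+, (davg f x r <= (d / (4 * C))%:E)%E.
  have /fine_cvgP[fin /cvgrPdist_le/(_ _ d'0)] := lx.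
  apply: filterS2 fin => r fr; rewrite /= sub0r normrN => H.
  rewrite -(fineK fr) lee_fin; exact: le_trans (ler_norm _) H.
move=> [e1 /= e10 He1]; exists (e1 / 2); first by rewrite divr_gt0.
move=> e /andP[e0 ee1].
(* Radius [2 * e] makes the open ball contain the closed interval of radius [e] that carries the
   kernel. *)
have {He1} He : (davg f x (2 * e) <= (d / (4 * C))%:E)%E.
  apply: He1 => /=; last by rewrite mulr_gt0.
  by rewrite sub0r normrN gtr0_norm ?mulr_gt0//; lra.
pose rho := derive1 (step_at e x).
have tr : test_function rho by exact: (test_function_step_at 0 x e0).
pose g y := f y - f x.
have lg : locint g by apply: locintB lf (locint_cst _).
have ig := locint_test lg tr.
have ic := locint_test (locint_cst (f x)) tr.
have -> : \int[mu]_y (f y * rho y) - f x = \int[mu]_y (g y * rho y).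
  have -> : \int[mu]_y (f y * rho y) =
            \int[mu]_y ((g y * rho y) + (f x * rho y)).
    by apply: eq_Rintegral => y _; rewrite -mulrDl /g subrK.
  rewrite RintegralD// RintegralZl// ?Rintegral_step_at ?mulr1 ?addrK//.
  by have := locint_test (locint_cst 1) tr; under eq_fun do rewrite mul1r.
apply: (le_trans (le_normr_Rintegral measurableT ig)).
have igfin := integrable_norm ig.
rewrite -lee_fin /Rintegral fineK; last first.
  by apply: integrable_fin_num.
have mg : measurable_fun (ball x (2 * e)) (EFin \o g).
  apply/measurable_EFinP; apply: measurable_funTS; exact: locint_measurable lg.
apply: (@le_trans _ _ (\int[mu]_(y in ball x (2 * e)) ((C / e)%:E * `|(g y)%:E|))%E).
  rewrite [leRHS]integral_mkcond; apply: ge0_le_integral => //=.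
  - by case/integrableP: igfin.
  - apply/(measurable_restrictT _ _).1; first exact: measurable_ball.
    apply: measurable_funeM; apply/measurable_EFinP; apply: measurableT_comp => //.
    exact/measurable_EFinP.
  - move=> y _; rewrite patchE; case: ifPn => [_|].
      rewrite -EFinM lee_fin normrM mulrC ler_wpM2r//.
      rewrite /rho -derive1n1 derive1n_step_at expr1 normrM gtr0_norm ?invr_gt0// mulrC.
      by rewrite ler_pM2r ?invr_gt0.
    rewrite notin_setE/= /ball/= => /negP; rewrite -leNgt distrC => h2.
    rewrite /rho -derive1n1 derive1n_step_at0 ?mulr0 ?normr0//.
    by apply: lt_le_trans h2; lra.
rewrite ge0_integralZl//=; last 3 first.
- exact: measurable_ball.
- by apply/measurable_EFinP; apply: measurableT_comp => //; exact/measurable_EFinP.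
- by rewrite lee_fin divr_ge0 ?ltW.
move: He; rewrite /davg /iavg lebesgue_measure_ball; last by rewrite mulr_ge0 ?ltW.
rewrite inver; case: ifPn => [|_]; first by rewrite mulrn_eq0/= mulf_eq0 pnatr_eq0/= (gt_eqF e0).
rewrite lee_pdivrMl ?mulrn_wgt0 ?mulr_gt0// => H.
apply: (@le_trans _ _ ((C / e)%:E * ((2 * e) *+ 2 * (d / (4 * C)))%:E)%E).
  by apply: lee_wpmul2l; [rewrite lee_fin divr_ge0 ?ltW|].
rewrite -EFinM lee_fin le_eqVlt; apply/orP; left; apply/eqP.
by rewrite -mulr_natl; field; rewrite !gt_eqF.
Qed.

(** The kernels of [mollify] are test functions, so their vanishing integrals approximate the value
    at each Lebesgue point, and almost every point is one. *)
Lemma test_function_eq0 g : locint g ->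
  (forall phi, test_function phi -> \int[mu]_x (g x * phi x) = 0) ->
  aeR (fun x => g x = 0).
Proof.
move=> lg hg; apply: aeRS (lebesgue_differentiation lg) => x lx.
apply/eqP; rewrite -normr_le0; apply/ler_addgt0Pr => d d0; rewrite add0r.
have [e0 e00 /(_ (e0 / 2))] := mollify lg lx d0.
rewrite hg ?sub0r ?normrN; last first.
  by apply: (@test_function_step_at 0); rewrite divr_gt0.
by apply; rewrite divr_gt0//=; lra.
Qed.

End Mollify.
End WeakDerivative.

(** * Weak derivatives on the line *)

Section WeakDerivativeCalculus.
Context {R : realType}.
Local Notation mu := (@lebesgue_measure R).
Local Notation locint := (locally_integrable (setT : set R)).
Local Notation wd := (@weak_derivative_real R 1).
Implicit Types (f g phi chi : R -> R) (i k : nat) (a b c x r l : R).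

Lemma ae_eq_Rintegral f g : measurable_fun setT f -> measurable_fun setT g ->
  aeR (fun x => f x = g x) -> \int[mu]_x f x = \int[mu]_x g x.
Proof.
move=> mf mg fg; rewrite /Rintegral; congr fine; apply: ae_eq_integral => //.
- exact/measurable_EFinP.
- exact/measurable_EFinP.
- by apply: aeRS fg => x /= -> _.
Qed.

Lemma test_function_measurable phi : test_function phi -> measurable_fun setT phi.
Proof. by move=> [/smooth_continuous + _]; exact: continuous_measurable_fun. Qed.

Lemma ae_eq_Rintegral_test f g phi : locint f -> locint g -> test_function phi ->
  aeR (fun x => f x = g x) -> \int[mu]_x (f x * phi x) = \int[mu]_x (g x * phi x).
Proof.
move=> lf lg /test_function_measurable tp fg; apply: ae_eq_Rintegral.
- by apply: measurable_funM => //; exact: locint_measurable lf.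
- by apply: measurable_funM => //; exact: locint_measurable lg.
- by apply: aeRS fg => x ->.
Qed.

Lemma weak_derivative_real_ae i f g f' g' : weak_derivative_real i f g ->
  locint f' -> locint g' -> aeR (fun x => f x = f' x) -> aeR (fun x => g x = g' x) ->
  weak_derivative_real i f' g'.
Proof.
move=> [lf lg h] lf' lg' ff' gg'; split => // phi tp.
rewrite -(ae_eq_Rintegral_test lf lf' _ ff'); last exact: test_function_derive1n.
by rewrite h// (ae_eq_Rintegral_test lg lg').
Qed.

Lemma weak_derivative_real0 f g : locint f -> locint g -> aeR (fun x => f x = g x) ->
  weak_derivative_real 0 f g.
Proof.
by move=> lf lg fg; split=> // phi tp; rewrite expr0 mul1r/=; exact: ae_eq_Rintegral_test.
Qed.

Lemma weak_derivative_realD i f g f' g' : weak_derivative_real i f g ->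
  weak_derivative_real i f' g' ->
  weak_derivative_real i (fun x => f x + f' x) (fun x => g x + g' x).
Proof.
move=> [lf lg h] [lf' lg' h']; split; [exact: locintD|exact: locintD|move=> phi tp].
have tp' := test_function_derive1n i tp.
under eq_Rintegral do rewrite mulrDl.
rewrite RintegralD//; [|exact: locint_test|exact: locint_test].
under [X in _ = _ * X]eq_Rintegral do rewrite mulrDl.
rewrite [X in _ = _ * X]RintegralD//; [|exact: locint_test|exact: locint_test].
by rewrite h// h'// mulrDr.
Qed.

Lemma weak_derivative_realZ i a f g : weak_derivative_real i f g ->
  weak_derivative_real i (fun x => a * f x) (fun x => a * g x).
Proof.
move=> [lf lg h]; split; [exact: locintZ|exact: locintZ|move=> phi tp].
have tp' := test_function_derive1n i tp.
under eq_Rintegral do rewrite -mulrA.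
rewrite RintegralZl//; last exact: locint_test.
under [X in _ = _ * X]eq_Rintegral do rewrite -mulrA.
rewrite [X in _ = _ * X]RintegralZl//; last exact: locint_test.
by rewrite h// mulrCA.
Qed.

Lemma weak_derivative_realB i f g f' g' : weak_derivative_real i f g ->
  weak_derivative_real i f' g' ->
  weak_derivative_real i (fun x => f x - f' x) (fun x => g x - g' x).
Proof.
move=> h /(weak_derivative_realZ (-1)) /(weak_derivative_realD h).
by under eq_fun do rewrite mulN1r; under [X in weak_derivative_real _ _ X]eq_fun do rewrite mulN1r.
Qed.

Lemma weak_derivative_real_cst0 i : weak_derivative_real i (fun=> 0 : R) (fun=> 0 : R).
Proof.
have := weak_derivative_realZ 0.
split; [exact: locint_cst|exact: locint_cst|move=> phi _].
by under eq_Rintegral do rewrite mul0r; under [X in _ = _ * X]eq_Rintegral do rewrite mul0r;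
  rewrite Rintegral_cst//= mul0r mulr0.
Qed.

Lemma weak_derivative_real_sum i (I : Type) (s : seq I) (f g : I -> R -> R) :
  (forall j, weak_derivative_real i (f j) (g j)) ->
  weak_derivative_real i (fun x => \sum_(j <- s) f j x) (fun x => \sum_(j <- s) g j x).
Proof.
move=> h; elim: s => [|j s IH].
  under eq_fun do rewrite big_nil; under [X in weak_derivative_real _ _ X]eq_fun do rewrite big_nil.
  exact: weak_derivative_real_cst0.
under eq_fun do rewrite big_cons; under [X in weak_derivative_real _ _ X]eq_fun do rewrite big_cons.
exact: weak_derivative_realD.
Qed.

Lemma weak_derivative_real_shift i c f g : weak_derivative_real i f g ->
  weak_derivative_real i (fun x => f (x + c)) (fun x => g (x + c)).
Proof.
move=> [lf lg h]; split; [exact: locint_shift|exact: locint_shift|move=> phi tp].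
have sh (u psi : R -> R) : locint u -> test_function psi ->
    \int[mu]_x (u (x + c) * psi x) = \int[mu]_x (u x * psi (1 * x + (- c))).
  move=> lu tpsi; rewrite /Rintegral; congr fine.
  have tpsi' := test_function_affine (- c) (oner_neq0 R) tpsi.
  rewrite -[RHS](integral_shift c).
    by apply: eq_integral => x _; rewrite /shift mul1r addrK.
  apply/measurable_EFinP; apply: measurable_funM; first exact: locint_measurable lu.
  exact: test_function_measurable.
rewrite !sh//; last exact: test_function_derive1n.
rewrite -h; last by apply: test_function_affine => //; exact: oner_neq0.
rewrite derive1n_affine; last by case: tp.
by apply: eq_Rintegral => x _; rewrite expr1n !mul1r.
Qed.

(* The product rule: [(chi phi)' - chi' phi] is [chi phi'], and [chi phi] is a
   test function. *)
Lemma wdM chi f g : smooth chi -> wd f g ->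
  wd (fun x => chi x * f x) (fun x => derive1 chi x * f x + chi x * g x).
Proof.
move=> sc [lf lg h].
have cc := smooth_continuous sc.
have cc' : continuous (derive1 chi) := @smooth_derive1n_continuous _ 1 _ sc.
have sc' := smooth_derive1 sc.
split; first exact: locintM.
  by apply: locintD; exact: locintM.
move=> phi tp.
have tp1 : test_function (derive1 phi) := test_function_derive1n 1 tp.
have tcp := test_functionM sc tp.
have tc1p := test_functionM sc' tp.
have i1 := locint_test lf tc1p.
have i2 := locint_test lf (test_functionM sc tp1).
have i3 := locint_test lg tcp.
have := h _ tcp; rewrite derive1n1 (derive1M_smooth sc (proj1 tp)).
under eq_Rintegral do rewrite mulrDr.
rewrite RintegralD// => H.
rewrite derive1n1; have -> : \int[mu]_x (chi x * f x * derive1 phi x) =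
   \int[mu]_x (f x * (chi x * derive1 phi x)).
  by apply: eq_Rintegral => x _; rewrite mulrA [f x * _]mulrC.
have -> : \int[mu]_x ((derive1 chi x * f x + chi x * g x) * phi x) =
   \int[mu]_x (f x * (derive1 chi x * phi x) + g x * (chi x * phi x)).
  by apply: eq_Rintegral => x _; rewrite mulrDl !mulrA [f x * _]mulrC [g x * _]mulrC.
rewrite RintegralD//; move: H; rewrite expr1 !mulN1r => H.
by rewrite opprD -H addKr.
Qed.

Lemma wd_chain k (u : nat -> R -> R) : locint (u 0) ->
  (forall i, (i < k)%N -> wd (u i) (u i.+1)) ->
  forall i, (i <= k)%N -> weak_derivative_real i (u 0) (u i).
Proof.
move=> l0 h; elim=> [_|i IH ik]; first exact: weak_derivative_real0 (aeR_all _).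
have [_ li hi] := IH (ltnW ik); have [_ li1 hi1] := h _ ik.
split => // phi tp; rewrite derive1nSr hi; last exact: (test_function_derive1n 1).
by rewrite hi1// expr1 mulrA -exprSr.
Qed.

(** The derivative of order [i.+1] of [phi] is the one of order [i] of [derive1 phi], so the same
    integral of [f] is evaluated in two ways. *)
Lemma wd_unchain i f g g' : weak_derivative_real i f g ->
  weak_derivative_real i.+1 f g' -> wd g g'.
Proof.
move=> [lf lg h] [_ lg' h']; split => // phi tp.
have := h' _ tp; rewrite derive1nSr h; last exact: (test_function_derive1n 1).
rewrite exprSr -mulrA => /(congr1 (fun z => (-1) ^+ i * z)).
by rewrite !mulrA -!exprMn mulrNN mulr1 expr1n !mul1r expr1.
Qed.

Section Step.
Variables (h : R -> R) (sh : step_function h).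

Lemma weak_derivative_real_uniq i f g g' : weak_derivative_real i f g ->
  weak_derivative_real i f g' -> aeR (fun x => g x = g' x).
Proof.
move=> [lf lg H] [_ lg' H'].
have : aeR (fun x => g x - g' x = 0).
  apply: (test_function_eq0 sh); first exact: locintB.
  move=> phi tp; under eq_Rintegral do rewrite mulrBl.
  rewrite RintegralB//; [|exact: locint_test|exact: locint_test].
  have := H _ tp; rewrite H'// => /(congr1 (fun z => (-1) ^+ i * z)).
  by rewrite !mulrA -!exprMn mulrNN mulr1 expr1n !mul1r => ->; rewrite subrr.
by apply: aeRS => x /eqP; rewrite subr_eq0 => /eqP.
Qed.

(* Testing the weak derivative against the difference of two rescaled steps
   compares the average of [u_i] at a tiny scale with the one at scale [l]. *)
Lemma weak_derivative_pointwise i l : 0 < l -> exists2 C : R, 0 < C &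
  forall u0 ui ui1, weak_derivative_real i u0 ui -> wd ui ui1 ->
  aeR (fun x => `|ui x| <= C * (\int[mu]_(y in `[x - l, x + l]) `|u0 y|)
                 + \int[mu]_(y in `[x - l, x + l]) `|ui1 y|).
Proof.
move=> l0; have [C C0 HC] := derive1n_step_bounded sh i.+1.
exists (l^-1 ^+ i.+1 * C); first by rewrite mulr_gt0// exprn_gt0// invr_gt0.
move=> u0 ui ui1 [lu0 lui H] [_ lui1 H1].
have intb (u psi : R -> R) x c : locint u -> test_function psi -> 0 <= c ->
    (forall y, `|psi y| <= c) -> (forall y, l < `|y - x| -> psi y = 0) ->
    `|\int[mu]_y (u y * psi y)| <= c * \int[mu]_(y in `[x - l, x + l]) `|u y|.
  move=> lu tpsi c0 hc hv; have iu := locint_test lu tpsi.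
  apply: (le_trans (le_normr_Rintegral measurableT iu)).
  have iux : mu.-integrable `[x - l, x + l] (EFin \o (fun y => `|u y|)).
    have := integrable_norm (locint_ball (`|x| + l) lu).
    apply: integrableS => // y /=; rewrite !in_itv/= => /andP[y1 y2].
    have := ler_norm x; have := ler_normr (- x) x; have : - x <= `|x| by rewrite -normrN ler_norm.
    by move=> *; apply/andP; split; lra.
  rewrite -RintegralZl// [leRHS]Rintegral_mkcond; apply: le_Rintegral => //.
  - exact: integrable_norm iu.
  - have ic : mu.-integrable `[x - l, x + l] (EFin \o (fun y => c * `|u y|)).
      exact: (integrableZl _ c iux).
    have /(integrable_mkcond _ _) ic' := ic.
    apply: eq_integrable (ic' (measurable_itv _)) => // y _.
    by rewrite /= !patchE; case: ifP.
  - move=> y _; rewrite patchE; case: ifPn => [_|].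
      by rewrite normrM mulrC ler_wpM2r.
    rewrite notin_setE/= in_itv/= -ler_distl => /negP; rewrite -ltNge => yl.
    by rewrite hv// mulr0 normr0.
apply: aeRS (lebesgue_differentiation lui) => x lx.
apply/ler_addgt0Pr => d d0.
(* The scale must be below [e0] for [mollify] and at most [l] for the difference of the two steps to
   vanish outside the window. *)
have [e0 e00 /(_ (Num.min (e0 / 2) l)) He] := mollify sh lui lx d0.
set e := Num.min _ _ in He.
have e0' : 0 < e by rewrite lt_min divr_gt0.
have el : e <= l by rewrite ge_min lexx orbT.
have {}He : `|\int[mu]_y (ui y * derive1 (step_at h e x) y) - ui x| <= d.
  by apply: He; rewrite e0'/= gt_min; apply/orP; left; lra.
have tB : test_function (fun y => step_at h e x y - step_at h l x y).
  by apply: test_function_step_atB; rewrite ?e0'.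
have tl := test_function_step_at sh 0 x l0.
have te := test_function_step_at sh 0 x e0'.
have {H1} H1 := H1 _ tB.
(* Testing [ui1] against the difference of steps trades the tiny scale [e] for the fixed scale
   [l]. *)
have E : \int[mu]_y (ui y * derive1 (step_at h e x) y) =
   \int[mu]_y (ui y * derive1 (step_at h l x) y)
   - \int[mu]_y (ui1 y * (step_at h e x y - step_at h l x y)).
  move: H1; rewrite expr1 mulN1r derive1n1.
  have -> : derive1 (fun y => step_at h e x y - step_at h l x y) =
      (fun y => derive1 (step_at h e x) y - derive1 (step_at h l x) y).
    have -> : (fun y => step_at h e x y - step_at h l x y) =
        (fun y => step_at h e x y + - 1 * step_at h l x y).
      by apply/funext => z; rewrite mulN1r.
    apply/funext => y; rewrite derive1D.
    - rewrite -[X in _ + X]/(derive1n 1 _ _) derive1nZ ?mulN1r//; exact: smooth_step_at.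
    - by apply: smooth_derivable; exact: smooth_step_at.
    - by apply: smooth_derivable; apply: smoothZ; exact: smooth_step_at.
  under eq_Rintegral do rewrite mulrBr.
  rewrite RintegralB//; [|exact: (locint_test lui te)|exact: (locint_test lui tl)].
  by move=> <-; rewrite addrC subrK.
(* At the fixed scale all derivatives are moved onto the smooth kernel, which leaves [u0] against
   the derivative of order [i.+1] of the step. *)
have B1 : `|\int[mu]_y (ui y * derive1 (step_at h l x) y)| <=
    l^-1 ^+ i.+1 * C * \int[mu]_(y in `[x - l, x + l]) `|u0 y|.
  have := H _ tl; rewrite /= -[derive1 _]/(derive1n 1 _) -/(derive1n i _) -derive1nSr => /(congr1 (fun z => (-1) ^+ i * z)).
  rewrite mulrA -exprMn mulrNN mulr1 expr1n mul1r => <-.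
  rewrite normrM normrX normrN1 expr1n mul1r; apply: intb.
  - by [].
  - exact: test_function_step_at.
  - by rewrite mulr_ge0 ?exprn_ge0 ?invr_ge0 ?ltW.
  - exact: derive1n_step_at_le.
  - by move=> y ly; apply: (derive1n_step_at0 sh).
have B2 : `|\int[mu]_y (ui1 y * (step_at h e x y - step_at h l x y))| <=
    \int[mu]_(y in `[x - l, x + l]) `|ui1 y|.
  rewrite -[leRHS]mul1r; apply: intb => //.
  - exact: step_atB_le1.
  - by move=> y; apply: step_atB_eq0; rewrite ?e0'.
rewrite E in He.
set I1 := \int[mu]_y (ui y * _) in He B1; set I2 := \int[mu]_y _ in He B2.
have := ler_normB (I1 - I2) (I1 - I2 - ui x).
rewrite opprB addrC subrK => /le_trans; apply.
by apply: lerD => //; apply: (le_trans (ler_normB _ _)); apply: lerD.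
Qed.

End Step.
End WeakDerivativeCalculus.

(** * Square-integrable functions *)

Section SquareIntegrable.
Context {R : realType}.
Local Notation mu := (@lebesgue_measure R).
Local Notation locint := (locally_integrable (setT : set R)).
Local Notation wd := (@weak_derivative_real R 1).
Implicit Types (f g u : R -> R) (a b c x y r l : R).

Definition n2 f : \bar R := (\int[mu]_x ((f x) ^+ 2)%:E)%E.

Definition L2 f := measurable_fun setT f /\ (n2 f < +oo)%E.

Lemma n2_ge0 f : (0 <= n2 f)%E.
Proof. by apply: integral_ge0 => x _; rewrite lee_fin sqr_ge0. Qed.

Lemma measurable_sqr f : measurable_fun setT f -> measurable_fun setT (fun x => (f x ^+ 2)%:E).
Proof. by move=> mf; apply/measurable_EFinP; exact: measurable_funX. Qed.

Lemma le_integral_ae (F G : R -> \bar R) : measurable_fun setT F -> measurable_fun setT G ->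
  (forall x, 0 <= F x)%E -> (forall x, 0 <= G x)%E -> aeR (fun x => F x <= G x)%E ->
  (\int[mu]_x F x <= \int[mu]_x G x)%E.
Proof.
move=> mF mG F0 G0 h; apply: ae_ge0_le_integral => //.
by apply: aeRS h => x /= ? _.
Qed.

Lemma ae_eq_n2 f g : measurable_fun setT f -> measurable_fun setT g ->
  aeR (fun x => f x = g x) -> n2 f = n2 g.
Proof.
move=> mf mg fg; apply/eqP; rewrite eq_le; apply/andP; split;
  apply: le_integral_ae => //; try exact: measurable_sqr;
  try (by move=> x; rewrite lee_fin sqr_ge0); by apply: aeRS fg => x ->.
Qed.

(** The constant [2 ^+ size s], cruder than the one of Cauchy-Schwarz, comes from iterating
    [(a + b) ^+ 2 <= 2 * a ^+ 2 + 2 * b ^+ 2]. *)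
Lemma sqr_sum_le (I : Type) (s : seq I) (F : I -> R) :
  (\sum_(i <- s) F i) ^+ 2 <= 2 ^+ size s * \sum_(i <- s) (F i) ^+ 2.
Proof.
elim: s => [|i s IH]; first by rewrite !big_nil expr0n mulr0.
rewrite !big_cons /= [in leRHS]exprS; set S := \sum_(j <- s) F j in IH *.
set Q := \sum_(j <- s) _ in IH *.
have Q0 : 0 <= Q by apply: sumr_ge0 => j _; exact: sqr_ge0.
have p1 : 1 <= 2 ^+ size s :> R by apply: exprn_ege1; rewrite ler1n.
have F0 := sqr_ge0 (F i).
have H : (F i + S) ^+ 2 <= 2 * F i ^+ 2 + 2 * S ^+ 2.
  rewrite -subr_ge0; have -> : 2 * F i ^+ 2 + 2 * S ^+ 2 - (F i + S) ^+ 2 = (F i - S) ^+ 2 by ring.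
  exact: sqr_ge0.
apply: (le_trans H); rewrite -mulrA mulrDr mulrDr lerD//.
  by rewrite ler_wpM2l// ler_peMl.
by rewrite ler_wpM2l.
Qed.

(** Takes the place of Minkowski's inequality: L2 estimates below are obtained by dominating a
    function pointwise by a finite sum. *)
Lemma n2_dom (I : Type) (s : seq I) (f : R -> R) (g : I -> R -> R) c :
  measurable_fun setT f -> (forall i, measurable_fun setT (g i)) ->
  aeR (fun x => `|f x| <= c * \sum_(i <- s) `|g i x|) ->
  (n2 f <= (c ^+ 2 * 2 ^+ size s)%:E * \sum_(i <- s) n2 (g i))%E.
Proof.
move=> mf mg h.
have mgs : forall i, measurable_fun setT (fun x => (g i x ^+ 2)%:E).
  by move=> i; exact: measurable_sqr.
have g0 : forall i x, (0 <= (g i x ^+ 2)%:E)%E by move=> i x; rewrite lee_fin sqr_ge0.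
have ms : measurable_fun setT (fun x => (\sum_(i <- s) (g i x ^+ 2)%:E)%E).
  by apply: emeasurable_sum.
have s0 : forall x, (0 <= \sum_(i <- s) (g i x ^+ 2)%:E)%E.
  by move=> x; apply: sume_ge0 => i _; exact: g0.
have K0 : 0 <= c ^+ 2 * 2 ^+ size s by rewrite mulr_ge0 ?sqr_ge0// exprn_ge0.
rewrite -(@ge0_integral_sum _ _ _ mu setT measurableT _ (fun i x => (g i x ^+ 2)%:E))//.
rewrite -(@ge0_integralZl _ _ _ mu setT measurableT); [|exact: ms|by move=> x _; exact: s0|by rewrite lee_fin].
apply: le_integral_ae => //.
- exact: measurable_sqr.
- exact: measurable_funeM.
- by move=> x; rewrite lee_fin sqr_ge0.
- by move=> x; apply: mule_ge0; rewrite ?lee_fin.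
apply: aeRS h => x hx; rewrite sumEFin -EFinM lee_fin -real_normK ?num_real//.
apply: (@le_trans _ _ ((c * \sum_(i <- s) `|g i x|) ^+ 2)).
  by rewrite ler_sqr ?nnegrE// (le_trans _ hx).
rewrite exprMn -[leRHS]mulrA; apply: ler_wpM2l; first exact: sqr_ge0.
apply: (le_trans (sqr_sum_le _ _)).
by apply: ler_wpM2l; [exact: exprn_ge0|]; under eq_bigr do rewrite real_normK ?num_real//.
Qed.

Lemma L2_dom (I : Type) (s : seq I) (f : R -> R) (g : I -> R -> R) c :
  measurable_fun setT f -> (forall i, L2 (g i)) ->
  aeR (fun x => `|f x| <= c * \sum_(i <- s) `|g i x|) -> L2 f.
Proof.
move=> mf mg h; split => //; apply: le_lt_trans (n2_dom mf _ h) _.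
  by move=> i; case: (mg i).
apply: lte_mul_pinfty; [by rewrite lee_fin mulr_ge0 ?sqr_ge0 ?exprn_ge0|by []|].
by elim/big_ind : _ => // [x y|i _]; [exact: lte_add_pinfty|case: (mg i)].
Qed.

Lemma L2_measurable f : L2 f -> measurable_fun setT f. Proof. by case. Qed.

Lemma L2_fin f : L2 f -> n2 f \is a fin_num.
Proof. by move=> [_ h]; rewrite ge0_fin_numE// n2_ge0. Qed.

Lemma L2_cst0 : L2 (fun=> 0).
Proof.
split; first exact: measurable_cst.
by rewrite /n2 integral0_eq// => x _; rewrite expr0n.
Qed.

Lemma L2_dom1 f g c : measurable_fun setT f -> L2 g ->
  aeR (fun x => `|f x| <= c * `|g x|) -> L2 f.
Proof.
move=> mf lg h; apply: (@L2_dom unit [:: tt] f (fun=> g) c) => //.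
by apply: aeRS h => x; rewrite big_seq1.
Qed.

Lemma L2D f g : L2 f -> L2 g -> L2 (fun x => f x + g x).
Proof.
move=> lf lg.
refine (@L2_dom bool [:: true; false] (fun x => f x + g x) (fun t : bool => if t then f else g) 1 _ _ _).
- by apply: measurable_funD; exact: L2_measurable.
- by case.
- by apply: aeR_all => x; rewrite big_cons big_seq1 mul1r ler_normD.
Qed.

Lemma L2Z c f : L2 f -> L2 (fun x => c * f x).
Proof.
move=> lf; apply: (@L2_dom1 _ f `|c|) => //.
  by apply: measurable_funM => //; exact: L2_measurable.
by apply: aeR_all => x; rewrite normrM.
Qed.

Lemma L2B f g : L2 f -> L2 g -> L2 (fun x => f x - g x).
Proof.
move=> lf lg; have := L2D lf (L2Z (-1) lg).
by under eq_fun do rewrite mulN1r.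
Qed.

Lemma L2_sum (I : Type) (s : seq I) (F : I -> R -> R) :
  (forall i, L2 (F i)) -> L2 (fun x => \sum_(i <- s) F i x).
Proof.
move=> h; elim: s => [|i s IH].
  by under eq_fun do rewrite big_nil; exact: L2_cst0.
by under eq_fun do rewrite big_cons; exact: L2D.
Qed.

Lemma L2_ae f g : L2 f -> measurable_fun setT g -> aeR (fun x => f x = g x) -> L2 g.
Proof.
move=> lf mg fg; apply: (@L2_dom1 _ f 1) => //.
by apply: aeRS fg => x ->; rewrite mul1r.
Qed.

Lemma n2_shift c f : measurable_fun setT f -> n2 (fun x => f (x + c)) = n2 f.
Proof.
move=> mf; rewrite /n2 -[RHS](ge0_integral_shift c)//; first exact: measurable_sqr.
by move=> x; rewrite lee_fin sqr_ge0.
Qed.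

Lemma L2_shift c f : L2 f -> L2 (fun x => f (x + c)).
Proof.
move=> [mf ff]; split; first exact: measurable_fun_shift.
by rewrite n2_shift.
Qed.

Lemma L2_locint f : L2 f -> locint f.
Proof.
move=> [mf ff]; apply: locintP => // r.
have m1 : measurable_fun setT (fun x => (1 + f x ^+ 2)%:E).
  by apply/measurable_EFinP; apply: measurable_funD => //; exact: measurable_funX.
apply: (@le_lt_trans _ _ (\int[mu]_(x in `[(- r)%R, r]) (1%:E + (f x ^+ 2)%:E)%E)%E).
  apply: ge0_le_integral => //.
  - by apply/measurable_EFinP; apply: measurable_funTS; exact: measurableT_comp.
  - by apply: measurable_funTS.
  - move=> x _; rewrite -EFinD lee_fin -(real_normK (num_real (f x))).
    have := sqr_ge0 (`|f x| - 1); have := normr_ge0 (f x); set z := `|f x|; nra.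
rewrite ge0_integralD//; last 2 first.
- by move=> x _; rewrite lee_fin sqr_ge0.
- by apply: measurable_funTS; exact: measurable_sqr.
apply: lte_add_pinfty.
  rewrite integral_cst//= lebesgue_measure_itv/=.
  by case: ifP => _; rewrite -?EFinD -?EFinM ?mule0 ltry.
apply: le_lt_trans ff; apply: ge0_subset_integral => //.
- exact: measurable_sqr.
- by move=> x _; rewrite lee_fin sqr_ge0.
Qed.

Lemma n2_eq0 f : measurable_fun setT f -> n2 f = 0%E -> aeR (fun x => f x = 0).
Proof.
move=> mf f0.
have : ae_eq mu setT (fun x => (f x ^+ 2)%:E) (cst 0%E).
  apply/ae_eq_integral_abs => //; first exact: measurable_sqr.
  rewrite -[RHS]f0; apply: eq_integral => x _.
  by rewrite gee0_abs// lee_fin sqr_ge0.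
by apply: aeRS => x /(_ I)/= [/eqP]; rewrite sqrf_eq0 => /eqP.
Qed.

Definition loc2 l f x : \bar R := (\int[mu]_(y in `[(x - l)%R, (x + l)%R]) ((f y) ^+ 2)%:E)%E.

Lemma loc2_le_n2 l f x : measurable_fun setT f -> (loc2 l f x <= n2 f)%E.
Proof.
move=> mf; apply: ge0_subset_integral => //; first exact: measurable_sqr.
by move=> y _; rewrite lee_fin sqr_ge0.
Qed.

Lemma loc2_ge0 l f x : (0 <= loc2 l f x)%E.
Proof. by apply: integral_ge0 => y _; rewrite lee_fin sqr_ge0. Qed.

(** Cauchy-Schwarz against the constant 1, derived from the weighted inequality
    [z <= s / 2 + (2 * s)^-1 * z ^+ 2]; the weight [s = A / (2 * l)] is optimal. If the local energy
    is infinite there is nothing to show. *)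
Lemma sqr_Rintegral_le l f x : 0 < l -> locint f ->
  (((\int[mu]_(y in `[x - l, x + l]) `|f y|) ^+ 2)%:E <= (2 * l)%:E * loc2 l f x)%E.
Proof.
move=> l0 lf; set I := `[x - l, x + l].
have iux : mu.-integrable [set` I] (EFin \o (fun y => `|f y|)).
  have := integrable_norm (locint_ball (`|x| + l) lf).
  apply: integrableS => // y /=; rewrite /I !in_itv/= => /andP[y1 y2].
  have h1 := ler_norm x; have h2 : - x <= `|x| by rewrite -normrN ler_norm.
  by clear -h1 h2 y1 y2; apply/andP; split; lra.
have muI : mu [set` I] = (2 * l)%:E.
  rewrite lebesgue_measure_itv/= lte_fin; case: ifPn => [_|]; first by rewrite -EFinD; congr EFin; ring.
  by move=> /negP; case; clear -l0; lra.
set A := \int[mu]_(y in _) _.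
have A0 : 0 <= A by apply: Rintegral_ge0.
have [B0|] := boolP (loc2 l f x \is a fin_num); last first.
  rewrite ge0_fin_numE ?loc2_ge0// -leNgt leye_eq => /eqP ->.
  by rewrite gt0_muley ?leey// lte_fin mulr_gt0.
have key s : 0 < s -> (A%:E <= (s * l)%:E + (2 * s)^-1%:E * loc2 l f x)%E.
  move=> s0.
  have -> : A%:E = (\int[mu]_(y in [set` I]) `|f y|%:E)%E.
    by rewrite /A /Rintegral fineK//; exact: integrable_fin_num.
  apply: (@le_trans _ _ (\int[mu]_(y in [set` I]) ((s / 2)%:E + (2 * s)^-1%:E * (f y ^+ 2)%:E))%E).
    apply: ge0_le_integral => //.
    - by case/integrableP: iux.
    - apply: emeasurable_funD => //; apply: measurable_funeM.
      by apply: measurable_funTS; apply: measurable_sqr; exact: locint_measurable lf.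
    - move=> y _; rewrite -EFinM -EFinD lee_fin -(real_normK (num_real (f y))).
      rewrite -subr_ge0; set z := `|f y|.
      have -> : s / 2 + (2 * s)^-1 * z ^+ 2 - z = (2 * s)^-1 * (z - s) ^+ 2.
        by field; rewrite gt_eqF.
      by rewrite mulr_ge0 ?sqr_ge0// invr_ge0 mulr_ge0// ltW.
  have mf2 : measurable_fun [set` I] (fun y => (f y ^+ 2)%:E).
    by apply: measurable_funTS; apply: measurable_sqr; exact: locint_measurable lf.
  have i0 : (0 <= ((2 * s)^-1)%:E)%E by rewrite lee_fin invr_ge0 mulr_ge0// ltW.
  rewrite ge0_integralD//.
  - rewrite integral_cst// [X in (_ * X)%E]muI -EFinM ge0_integralZl//.
      by rewrite leeD// lee_fin le_eqVlt; apply/orP; left; apply/eqP; field.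
    by move=> y _; rewrite lee_fin sqr_ge0.
  - by move=> y _; rewrite lee_fin divr_ge0// ltW.
  - by move=> y _; rewrite mule_ge0// lee_fin sqr_ge0.
  - exact: measurable_funeM.
rewrite -(fineK B0) in key *; set B := fine _ in key *.
rewrite -EFinM lee_fin.
have [->|An0] := eqVneq A 0.
  by rewrite expr0n mulr_ge0 ?fine_ge0 ?loc2_ge0// mulr_ge0// ltW.
have Ap : 0 < A by rewrite lt_def An0.
have := key (A / (2 * l)); rewrite divr_gt0 ?mulr_gt0// => /(_ erefl).
rewrite -EFinM -EFinD lee_fin.
have -> : A / (2 * l) * l + (2 * (A / (2 * l)))^-1 * B = A / 2 + l * B / A.
  by field; rewrite An0 gt_eqF.
move=> h; have : A * A <= A * (A / 2 + l * B / A) by rewrite ler_wpM2l.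
have -> : A * (A / 2 + l * B / A) = A ^+ 2 / 2 + l * B by field.
by clear; rewrite expr2; lra.
Qed.

(** Tonelli on the strip where [x] and [y] differ by at most [l]: each [y] is counted for the [x] of
    an interval of length [2 * l]. *)
Lemma integral_loc2 l f : 0 < l -> measurable_fun setT f ->
  measurable_fun setT (loc2 l f) /\ (\int[mu]_x loc2 l f x = (2 * l)%:E * n2 f)%E.
Proof.
move=> l0 mf.
pose D : set (measurableTypeR R * measurableTypeR R) := [set p | `|p.1 - p.2| <= l].
have mD : measurable D.
  have mh : measurable_fun setT (fun p : measurableTypeR R * measurableTypeR R => p.1 - p.2).
    by apply: measurable_funB.
  have := mh measurableT `[- l, l]%classic (measurable_itv _); rewrite setTI.
  congr measurable; apply/seteqP; split => p /=; by rewrite in_itv/= -ler_norml.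
pose F (p : measurableTypeR R * measurableTypeR R) : \bar R := ((f p.2 ^+ 2) * \1_D p)%:E.
have mF : measurable_fun setT F.
  apply/measurable_EFinP; apply: measurable_funM => //.
  by apply: measurable_funX; exact: (measurableT_comp mf).
have F0 p : (0 <= F p)%E by rewrite lee_fin mulr_ge0 ?sqr_ge0.
have E : loc2 l f = fun x => (\int[mu]_y F (x, y))%E.
  apply/funext => x; rewrite /loc2 integral_mkcond; apply: eq_integral => y _.
  rewrite patchE /F/= indicE; case: ifPn => [|].
    rewrite inE/= in_itv/= -ler_distl distrC => h.
    by rewrite mem_set// mulr1.
  rewrite notin_setE/= in_itv/= -ler_distl distrC => h.
  by rewrite memNset// mulr0.
split.
  by rewrite E; have := @measurable_fun_fubini_tonelli_F _ _ _ _ R mu F mF F0.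
rewrite E (@fubini_tonelli _ _ _ _ R mu mu F mF F0).
rewrite /n2 -ge0_integralZl//; last 3 first.
- exact: measurable_sqr.
- by move=> x _; rewrite lee_fin sqr_ge0.
- by rewrite lee_fin mulr_ge0// ltW.
apply: eq_integral => y _.
transitivity (\int[mu]_x ((f y ^+ 2)%:E * (\1_(`[y - l, y + l]%classic) x)%:E))%E.
  apply: eq_integral => x _; rewrite /F/= -EFinM; congr (_ * _)%:E.
  rewrite !indicE; congr (_%:R); congr nat_of_bool; apply/idP/idP; rewrite !inE/= in_itv/= -ler_distl//.
rewrite ge0_integralZl//; last 2 first.
- by apply/measurable_EFinP; exact: measurable_indic.
- by rewrite lee_fin sqr_ge0.
rewrite integral_indic// setIT muleC; congr (_ * _)%E.
rewrite [LHS]lebesgue_measure_itv/= lte_fin; case: ifPn => [_|]; first by rewrite -EFinD; congr EFin; ring.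
by move=> /negP; case; clear -l0; lra.
Qed.

End SquareIntegrable.

(** * Sobolev inequalities *)

Section SobolevInequalities.
Context {R : realType}.
Local Notation mu := (@lebesgue_measure R).
Local Notation locint := (locally_integrable (setT : set R)).
Local Notation wd := (@weak_derivative_real R 1).
Implicit Types (f g u v : R -> R) (a b c x y r l e : R).

(** Real-valued, hence 0 when the integral is infinite; [nnE] ties it to [n2] for functions in
    [L2]. *)
Definition nn f : R := \int[mu]_x (f x ^+ 2).

Lemma nn_ge0 f : 0 <= nn f.
Proof. by apply: Rintegral_ge0 => x _; exact: sqr_ge0. Qed.

Lemma nnE f : L2 f -> (nn f)%:E = n2 f.
Proof. by move=> lf; rewrite /nn /Rintegral fineK//; exact: L2_fin. Qed.

Lemma nn_dom (I : Type) (s : seq I) f (g : I -> R -> R) c :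
  measurable_fun setT f -> (forall i, L2 (g i)) ->
  aeR (fun x => `|f x| <= c * \sum_(i <- s) `|g i x|) ->
  nn f <= c ^+ 2 * 2 ^+ size s * \sum_(i <- s) nn (g i).
Proof.
move=> mf lg h; have lf := L2_dom mf lg h.
rewrite -lee_fin nnE// EFinM -sumEFin; under eq_bigr do rewrite nnE//.
by apply: n2_dom => // i; exact: L2_measurable.
Qed.

Lemma nn_ae f g : measurable_fun setT f -> measurable_fun setT g ->
  aeR (fun x => f x = g x) -> nn f = nn g.
Proof. by move=> mf mg fg; rewrite /nn /Rintegral [X in fine X](ae_eq_n2 mf mg fg). Qed.

Lemma nn_shift c f : measurable_fun setT f -> nn (fun x => f (x + c)) = nn f.
Proof. by move=> mf; rewrite /nn /Rintegral [X in fine X](n2_shift c mf). Qed.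

Lemma nn_eq0 f : L2 f -> nn f <= 0 -> aeR (fun x => f x = 0).
Proof.
move=> lf f0; apply: n2_eq0; first exact: L2_measurable.
rewrite -nnE//; congr EFin; apply/eqP; rewrite eq_le f0; exact: nn_ge0.
Qed.

Section Step.
Variables (h : R -> R) (sh : step_function h).

(** Square of [weak_derivative_pointwise], with the local means bounded by Cauchy-Schwarz. The
    values are extended reals because the functions are only locally integrable. *)
Lemma sobolev_loc i l : 0 < l -> exists2 C : R, 0 < C &
  forall u0 ui ui1, weak_derivative_real i u0 ui -> wd ui ui1 ->
  aeR (fun x => ((ui x ^+ 2)%:E <= C%:E * loc2 l u0 x + (4 * l)%:E * loc2 l ui1 x)%E).
Proof.
move=> l0; have [C C0 HC] := weak_derivative_pointwise sh i l0.
exists (4 * l * C ^+ 2); first by rewrite mulr_gt0 ?exprn_gt0// mulr_gt0.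
move=> u0 ui ui1 H H1; apply: aeRS (HC _ _ _ H H1) => x.
have [lu0 _ _] := H; have [_ lu1 _] := H1.
have := sqr_Rintegral_le x l0 lu0; have := sqr_Rintegral_le x l0 lu1.
set A1 := \int[mu]_(y in _) _; set A0 := \int[mu]_(y in _) _ => h1 h0 hx.
apply: (@le_trans _ _ ((2 * C ^+ 2)%:E * (A0 ^+ 2)%:E + 2%:E * (A1 ^+ 2)%:E)%E).
  rewrite -!EFinM -EFinD lee_fin -(real_normK (num_real (ui x))).
  apply: (@le_trans _ _ ((C * A0 + A1) ^+ 2)).
    by rewrite ler_sqr ?nnegrE//; apply: le_trans hx.
  rewrite -subr_ge0.
  have -> : 2 * C ^+ 2 * A0 ^+ 2 + 2 * A1 ^+ 2 - (C * A0 + A1) ^+ 2 = (C * A0 - A1) ^+ 2.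
    by clearbody A0 A1; ring.
  exact: sqr_ge0.
apply: leeD.
  apply: (@le_trans _ _ ((2 * C ^+ 2)%:E * ((2 * l)%:E * loc2 l u0 x))%E).
    by apply: lee_wpmul2l => //; rewrite lee_fin mulr_ge0 ?sqr_ge0.
  rewrite muleA -EFinM le_eqVlt; apply/orP; left; apply/eqP; congr (_%:E * _)%E.
  by clear; ring.
apply: (@le_trans _ _ (2%:E * ((2 * l)%:E * loc2 l ui1 x))%E).
  by apply: lee_wpmul2l.
rewrite muleA -EFinM le_eqVlt; apply/orP; left; apply/eqP; congr (_%:E * _)%E.
by clear; ring.
Qed.

(** Integrating [sobolev_loc] over the line turns local energies into [2 * l] times global ones, so
    a small window makes the coefficient of the highest order small. *)
Lemma interpolation i e : 0 < e -> exists2 C : R, 0 < C &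
  forall u0 ui ui1, weak_derivative_real i u0 ui -> wd ui ui1 ->
  L2 u0 -> L2 ui -> L2 ui1 -> nn ui <= C * nn u0 + e * nn ui1.
Proof.
(* For [l <= 1] the coefficient [4 * l * (2 * l)] is at most [8 * l], hence at most [e]. *)
move=> e0; pose l := Num.min 1 (e / 8).
have l0 : 0 < l by rewrite lt_min ltr01 divr_gt0.
have l1 : l <= 1 by rewrite ge_min lexx.
have le8 : l <= e / 8 by rewrite ge_min lexx orbT.
have [C C0 HC] := sobolev_loc i l0.
exists (C * (2 * l)); first by rewrite !mulr_gt0.
move=> u0 ui ui1 H H1 L0 Li L1; have := HC _ _ _ H H1 => hx.
have [m0 E0] := integral_loc2 l0 (L2_measurable L0).
have [m1 E1] := integral_loc2 l0 (L2_measurable L1).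
apply: (@le_trans _ _ (C * (2 * l) * nn u0 + 4 * l * (2 * l) * nn ui1)); last first.
  rewrite lerD2l ler_wpM2r ?nn_ge0//; clear -l0 l1 le8; nra.
rewrite -lee_fin EFinD (EFinM (C * _)) (EFinM (4 * _ * _)) !nnE// !EFinM -!muleA.
have -> : (2 * (l%:E * n2 u0))%E = ((2 * l)%:E * n2 u0)%E by rewrite EFinM muleA.
have -> : (4 * (l%:E * (2 * (l%:E * n2 ui1))))%E = ((4 * l)%:E * ((2 * l)%:E * n2 ui1))%E.
  by rewrite !EFinM !muleA.
rewrite -E0 -E1 -ge0_integralZl//; last 2 first.
- by move=> x _; exact: loc2_ge0.
- by rewrite lee_fin ltW.
rewrite -ge0_integralZl//; last 2 first.
- by move=> x _; exact: loc2_ge0.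
- by rewrite lee_fin mulr_ge0// ltW.
have p4 : (0 <= (4 * l)%:E)%E by rewrite lee_fin mulr_ge0// ltW.
have pC : (0 <= C%:E)%E by rewrite lee_fin ltW.
rewrite -ge0_integralD//; last 4 first.
- by move=> x _; rewrite mule_ge0// loc2_ge0.
- exact: measurable_funeM.
- by move=> x _; rewrite mule_ge0// loc2_ge0.
- exact: measurable_funeM.
apply: le_integral_ae => //.
- by apply: measurable_sqr; exact: L2_measurable.
- by apply: emeasurable_funD; exact: measurable_funeM.
- by move=> x; rewrite lee_fin sqr_ge0.
- by move=> x; rewrite adde_ge0// mule_ge0// loc2_ge0.
Qed.

Lemma sobolev_sup : exists2 C : R, 0 < C & forall u v, wd u v -> L2 u -> L2 v ->
  aeR (fun x => u x ^+ 2 <= C * (nn u + nn v)).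
Proof.
have [C C0 HC] := sobolev_loc 0 (@ltr01 R).
exists (C + 4); first by rewrite addr_gt0.
move=> u v uv lu lv.
have u0u : weak_derivative_real 0 u u.
  by apply: weak_derivative_real0; [exact: L2_locint|exact: L2_locint|exact: aeR_all].
apply: aeRS (HC _ _ _ u0u uv) => x; rewrite mulr1 => hx; rewrite -lee_fin; apply: (le_trans hx).
apply: (@le_trans _ _ (C%:E * n2 u + 4%:E * n2 v)%E).
  apply: leeD; (apply: lee_wpmul2l; first by rewrite lee_fin// ltW);
    by apply: loc2_le_n2; exact: L2_measurable.
rewrite -!nnE// -!EFinM -EFinD lee_fin.
have := nn_ge0 u; have := nn_ge0 v; move: (nn u) (nn v) => U V; clear -C0; nra.
Qed.

Definition outside r : set R := ~` `[- r, r].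

Lemma measurable_outside r : measurable (outside r : set (measurableTypeR R)).
Proof. by apply: measurableC; exact: measurable_itv. Qed.

(** Monotone convergence along the intervals of integer radius; the tail is the difference of two
    finite integrals. *)
Lemma L2_tail f e : L2 f -> 0 < e -> exists2 r0 : R, 0 < r0 &
  forall r, r0 <= r -> (\int[mu]_(x in outside r) (f x ^+ 2)%:E <= e%:E)%E.
Proof.
move=> lf e0; have mf := measurable_sqr (L2_measurable lf).
pose F (n : nat) : set (measurableTypeR R) := `[- n%:R, n%:R]%classic.
have f0 : forall x, setT x -> (0 <= (f x ^+ 2)%:E)%E by move=> x _; rewrite lee_fin sqr_ge0.
have cv : (\int[mu]_(x in F n) (f x ^+ 2)%:E @[n --> \oo] --> \int[mu]_(x in \bigcup_n F n) (f x ^+ 2)%:E)%E.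
  apply: ge0_nondecreasing_set_cvg_integral => //.
  - by move=> m n mn; apply/subsetPset => x /=; rewrite /F/= !in_itv/= -!ler_norml => /le_trans; apply; rewrite ler_nat.
  - by move=> n; exact: measurable_itv.
  - by move=> n; exact: measurable_funTS.
  - by move=> n x _; exact: f0.
have UF : \bigcup_n F n = setT.
  apply/seteqP; split => // x _; exists (Num.truncn `|x|).+1 => //=.
  by rewrite /F/= in_itv/= -ler_norml ltW// Num.Theory.truncnS_gt.
rewrite UF -/(n2 f) in cv.
have fin := L2_fin lf.
have splitn r : (n2 f = \int[mu]_(x in `[(- r)%R, r]) (f x ^+ 2)%:E + \int[mu]_(x in outside r) (f x ^+ 2)%:E)%E.
  rewrite /n2 -[in LHS](setUv `[- r, r]%classic) ge0_integral_setU//.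
  - exact: measurable_outside.
  - by rewrite setUv.
  - by move=> x _; exact: f0.
  - by apply/disj_setPS => x [].
have [N0 _ HN] : \forall n \near \oo, (n2 f - e%:E < \int[mu]_(x in F n) (f x ^+ 2)%:E)%E.
  have lt : (n2 f - e%:E < n2 f)%E by rewrite lteBlDr// lteDl// ?lte_fin.
  exact: (cv [set y | (n2 f - e%:E < y)%E] (open_ereal_gt' lt)).
exists (N0.+1%:R) => // r rN.
have := HN N0.+1 (leqnSn _); rewrite -/(F _) => hN.
have le1 : (\int[mu]_(x in F N0.+1) (f x ^+ 2)%:E <= \int[mu]_(x in `[(- r)%R, r]) (f x ^+ 2)%:E)%E.
  apply: ge0_subset_integral => //.
  - exact: measurable_itv.
  - exact: measurable_funTS.
  - by move=> x _; exact: f0.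
  - by move=> x; rewrite /F/= !in_itv/= -!ler_norml => /le_trans; apply.
have := lt_le_trans hN le1; rewrite (splitn r).
set A := (\int[mu]_(x in `[(- r)%R, r]) _)%E; set B := (\int[mu]_(x in outside r) _)%E.
have finA : A \is a fin_num.
  rewrite ge0_fin_numE; last by apply: integral_ge0 => x _; exact: f0.
  by apply: le_lt_trans (proj2 lf); apply: ge0_subset_integral.
have finB : B \is a fin_num.
  rewrite ge0_fin_numE; last by apply: integral_ge0 => x _; exact: f0.
  by apply: le_lt_trans (proj2 lf); apply: ge0_subset_integral => //; exact: measurable_outside.
have gen (a b : \bar R) : a \is a fin_num -> b \is a fin_num ->
    (a + b - e%:E < a)%E -> (b <= e%:E)%E.
  by case: a b => [a| |] [b| |]// _ _ /=; rewrite lte_fin lee_fin; clear; lra.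
exact: gen.
Qed.

Lemma sobolev_decay u v e : wd u v -> L2 u -> L2 v -> 0 < e ->
  exists2 r : R, 0 < r & aeR (fun x => r <= `|x| -> `|u x| <= e).
Proof.
move=> uv lu lv e0; have [C C0 HC] := sobolev_loc 0 (@ltr01 R).
(* Two tails below this bound, weighted by [C] and 4, add up to at most [e ^+ 2]. *)
have d0 : 0 < e ^+ 2 / (C + 4) by rewrite divr_gt0 ?exprn_gt0// addr_gt0.
have [r1 r10 h1] := L2_tail lu d0; have [r2 r20 h2] := L2_tail lv d0.
(* Windows of half-width 1 around [x] then avoid both [[-r1, r1]] and [[-r2, r2]]. *)
exists (r1 + r2 + 2); first by rewrite !addr_gt0.
have u0u : weak_derivative_real 0 u u.
  by apply: weak_derivative_real0; [exact: L2_locint|exact: L2_locint|exact: aeR_all].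
apply: aeRS (HC _ _ _ u0u uv) => x hx rx.
have sub r w : L2 w -> r + 1 < `|x| ->
    (loc2 1 w x <= \int[mu]_(x in outside r) (w x ^+ 2)%:E)%E.
  move=> lw rr; apply: ge0_subset_integral => //.
  - exact: measurable_outside.
  - by apply: measurable_funTS; apply: measurable_sqr; exact: L2_measurable.
  - by move=> y _; rewrite lee_fin sqr_ge0.
  - move=> y /=; rewrite in_itv/= -ler_distl => yx; rewrite /outside/= in_itv/= -ler_norml.
    apply/negP; rewrite -ltNge; have := ler_normD (x - y) y; rewrite subrK distrC.
    by move: yx rr; clear; lra.
have l1 := le_trans (sub r1 u lu ltac:(move: rx r20; clear; lra)) (h1 r1 (lexx _)).
have l2 := le_trans (sub r2 v lv ltac:(move: rx r10; clear; lra)) (h2 r2 (lexx _)).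
rewrite -ler_sqr ?nnegrE ?(ltW e0)// real_normK ?num_real//.
rewrite -lee_fin; apply: (le_trans hx).
apply: (@le_trans _ _ (C%:E * (e ^+ 2 / (C + 4))%:E + (4 * 1)%:E * (e ^+ 2 / (C + 4))%:E)%E).
  by apply: leeD; apply: lee_wpmul2l; rewrite // lee_fin ?mulr1 ?(ltW C0).
rewrite -!EFinM -EFinD lee_fin mulr1 -mulrDl mulrC divfK// gt_eqF// addr_gt0//.
Qed.

End Step.
End SobolevInequalities.

(** * Jets of weak derivatives *)

Section Jets.
Context {R : realType}.
Local Notation locint := (locally_integrable (setT : set R)).
Local Notation wd := (@weak_derivative_real R 1).
Implicit Types (u v : nat -> R -> R) (k : nat) (chi : R -> R) (c x : R).

(* [u i] plays the role of the [i]-th weak derivative of [u 0]. *)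
Definition is_jet k u := (forall i, (i <= k)%N -> locint (u i)) /\
  forall i, (i < k)%N -> wd (u i) (u i.+1).

Definition is_hjet k u := (forall i, (i <= k)%N -> L2 (u i)) /\
  forall i, (i < k)%N -> wd (u i) (u i.+1).

Lemma is_hjet_jet k u : is_hjet k u -> is_jet k u.
Proof. by move=> [lu wu]; split => // i ik; exact/L2_locint/lu. Qed.

Lemma is_jet_measurable k u i : is_jet k u -> (i <= k)%N -> measurable_fun setT (u i).
Proof. by move=> [lu _] ik; apply: locint_measurable; exact: lu. Qed.

Lemma is_jet_weak_derivative k u i : is_jet k u -> (i <= k)%N -> weak_derivative_real i (u 0) (u i).
Proof. by move=> [lu wu]; apply: wd_chain => //; exact: lu. Qed.

Lemma is_jetS k u : is_jet k.+1 u -> is_jet k (fun i => u i.+1).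
Proof. by move=> [lu wu]; split => i ik; [apply: lu|apply: wu]. Qed.

Lemma is_jetW k k' u : (k' <= k)%N -> is_jet k u -> is_jet k' u.
Proof.
by move=> kk [lu wu]; split => i ik; [apply: lu|apply: wu]; exact: leq_trans ik kk.
Qed.

Lemma is_jetD k u v : is_jet k u -> is_jet k v -> is_jet k (fun i x => u i x + v i x).
Proof.
move=> [lu wu] [lv wv]; split => i ik; first by apply: locintD; [exact: lu|exact: lv].
by apply: weak_derivative_realD; [exact: wu|exact: wv].
Qed.

Lemma is_jetB k u v : is_jet k u -> is_jet k v -> is_jet k (fun i x => u i x - v i x).
Proof.
move=> [lu wu] [lv wv]; split => i ik; first by apply: locintB; [exact: lu|exact: lv].
by apply: weak_derivative_realB; [exact: wu|exact: wv].
Qed.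

Lemma is_jet_sum k (I : Type) (s : seq I) (u : I -> nat -> R -> R) :
  (forall t, is_jet k (u t)) -> is_jet k (fun i x => \sum_(t <- s) u t i x).
Proof.
move=> h; split => i ik.
  by apply: locint_sum => t; exact: (proj1 (h t)).
by apply: weak_derivative_real_sum => t; exact: (proj2 (h t)).
Qed.

Lemma is_jet_shift k c u : is_jet k u -> is_jet k (fun i x => u i (x + c)).
Proof.
move=> [lu wu]; split => i ik; first exact/locint_shift/lu.
exact/weak_derivative_real_shift/wu.
Qed.

Lemma is_hjetB k u v : is_hjet k u -> is_hjet k v -> is_hjet k (fun i x => u i x - v i x).
Proof.
move=> [lu wu] [lv wv]; split => i ik; first by apply: L2B; [exact: lu|exact: lv].
by apply: weak_derivative_realB; [exact: wu|exact: wv].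
Qed.

Lemma is_hjet_sum k (I : Type) (s : seq I) (u : I -> nat -> R -> R) :
  (forall t, is_hjet k (u t)) -> is_hjet k (fun i x => \sum_(t <- s) u t i x).
Proof.
move=> h; split => i ik.
  by apply: L2_sum => t; exact: (proj1 (h t)).
by apply: weak_derivative_real_sum => t; exact: (proj2 (h t)).
Qed.

Lemma is_hjet_shift k c u : is_hjet k u -> is_hjet k (fun i x => u i (x + c)).
Proof.
move=> [lu wu]; split => i ik; first exact/L2_shift/lu.
exact/weak_derivative_real_shift/wu.
Qed.

(* Leibniz rule without binomial coefficients. *)
Fixpoint jet_mul chi u i : R -> R :=
  if i is i'.+1 then
    fun x => jet_mul (derive1 chi) u i' x + jet_mul chi (fun p => u p.+1) i' x
  else fun x => chi x * u 0 x.

Lemma jet_mul_locint k chi u i : smooth chi -> is_jet k u -> (i <= k)%N ->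
  locint (jet_mul chi u i).
Proof.
elim: i chi u k => [|i IH] chi u k sc ju ik /=.
  by apply: locintM; [exact: (proj1 ju)|exact: smooth_continuous].
case: k ju ik => // k ju ik; apply: locintD.
  exact: (IH _ _ k (smooth_derive1 sc) (is_jetW (leqnSn k) ju) ik).
exact: (IH _ _ k sc (is_jetS ju) ik).
Qed.

Lemma is_jet_mul k chi u : smooth chi -> is_jet k u -> is_jet k (jet_mul chi u).
Proof.
move=> sc ju; split => i ik; first exact: jet_mul_locint ju ik.
elim: i chi u k sc ju ik => [|i IH] chi u k sc ju ik.
  by apply: wdM => //; exact: (proj2 ju).
case: k ju ik => // k ju ik; apply: weak_derivative_realD.
  exact: (IH _ _ k (smooth_derive1 sc) (is_jetW (leqnSn k) ju) ik).
exact: (IH _ _ k sc (is_jetS ju) ik).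
Qed.

Lemma jet_mul_le i chi u x K : (forall q, (q <= i)%N -> `|derive1n q chi x| <= K) ->
  `|jet_mul chi u i x| <= 2 ^+ i * K * \sum_(p < i.+1) `|u p x|.
Proof.
elim: i chi u => [|i IH] chi u hK /=.
  by rewrite big_ord1 expr0 mul1r normrM ler_wpM2r// (hK 0%N).
have K0 : 0 <= K := le_trans (normr_ge0 _) (hK 0%N (leq0n _)).
apply: (le_trans (ler_normD _ _)).
have h1 := IH (derive1 chi) u (fun q qi => ltac:(rewrite -derive1nSr; exact: hK)).
have h2 := IH chi (fun p => u p.+1) (fun q qi => hK q (leqW qi)).
have s1 : \sum_(p < i.+1) `|u p x| <= \sum_(p < i.+2) `|u p x|.
  by rewrite [leRHS]big_ord_recr/= lerDl.
have s2 : \sum_(p < i.+1) `|u p.+1 x| <= \sum_(p < i.+2) `|u p x|.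
  by rewrite [leRHS]big_ord_recl/= lerDr.
rewrite exprS -!mulrA mulrDl mul1r !mulrA.
have p0 : 0 <= 2 ^+ i * K by rewrite mulr_ge0// exprn_ge0.
apply: lerD; [apply: (le_trans h1)|apply: (le_trans h2)]; exact: ler_wpM2l.
Qed.

(** Every term other than [chi x * u i x] carries a derivative of [chi] of positive order and a
    derivative of [u] of order below [i]. Slowly varying cutoffs therefore commute with the operator
    up to small errors. *)
Lemma jet_mul_comm_le i chi u x K : 0 <= K ->
  (forall q, (0 < q <= i)%N -> `|derive1n q chi x| <= K) ->
  `|jet_mul chi u i x - chi x * u i x| <= 2 ^+ i * K * \sum_(p < i) `|u p x|.
Proof.
move=> K0; elim: i chi u => [|i IH] chi u hK /=.
  by rewrite subrr normr0 big_ord0 mulr0.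
rewrite -addrA; apply: (le_trans (ler_normD _ _)).
have h1 : `|jet_mul (derive1 chi) u i x| <= 2 ^+ i * K * \sum_(p < i.+1) `|u p x|.
  by apply: jet_mul_le => q qi; rewrite -derive1nSr; exact: hK.
have h2 : `|jet_mul chi (fun p => u p.+1) i x - chi x * u i.+1 x| <=
    2 ^+ i * K * \sum_(p < i) `|u p.+1 x|.
  by apply: (IH chi (fun p => u p.+1)) => q /andP[q0 qi]; apply: hK; rewrite q0 leqW.
have s2 : \sum_(p < i) `|u p.+1 x| <= \sum_(p < i.+1) `|u p x|.
  by rewrite [leRHS]big_ord_recl/= lerDr.
have p0 : 0 <= 2 ^+ i * K by rewrite mulr_ge0// exprn_ge0.
have -> : 2 ^+ i.+1 * K * \sum_(p < i.+1) `|u p x| =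
  2 ^+ i * K * (\sum_(p < i.+1) `|u p x|) + 2 ^+ i * K * (\sum_(p < i.+1) `|u p x|).
  by rewrite exprS -!mulrA mulr_natl mulr2n.
by apply: lerD => //; apply: (le_trans h2); exact: ler_wpM2l.
Qed.

Lemma jet_mul_const i chi u x :
  (forall q, (0 < q <= i)%N -> derive1n q chi x = 0) ->
  jet_mul chi u i x = chi x * u i x.
Proof.
move=> h; apply/eqP; rewrite -subr_eq0 -normr_le0.
apply: (le_trans (@jet_mul_comm_le i chi u x 0 (lexx _) _)).
  by move=> q qi; rewrite h// normr0.
by rewrite mulr0 mul0r.
Qed.

Lemma jet_mulB i chi u v x :
  jet_mul chi (fun p y => u p y - v p y) i x = jet_mul chi u i x - jet_mul chi v i x.
Proof.
elim: i chi u v => [|i IH] chi u v /=; first by rewrite mulrBr.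
by rewrite (IH _ u v) (IH _ (fun p => u p.+1)) opprD addrACA.
Qed.

Lemma smooth_sum (I : Type) (s : seq I) (chi : I -> R -> R) :
  (forall t, smooth (chi t)) -> smooth (fun x => \sum_(t <- s) chi t x).
Proof.
move=> h; elim: s => [|t s IH].
  by under eq_fun do rewrite big_nil; exact: smooth_cst.
by under eq_fun do rewrite big_cons; exact: (smoothD (h t) IH).
Qed.

Lemma jet_mul_sum (I : Type) (s : seq I) (chi : I -> R -> R) u i x :
  (forall t, smooth (chi t)) ->
  \sum_(t <- s) jet_mul (chi t) u i x = jet_mul (fun y => \sum_(t <- s) chi t y) u i x.
Proof.
elim: i chi u => [|i IH] chi u sc /=; first by rewrite mulr_suml.
rewrite big_split/= (IH _ (fun p => u p.+1))// (IH (fun t => derive1 (chi t))); last first.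
  by move=> t; exact: smooth_derive1.
congr (jet_mul _ _ _ _ + _); apply/funext => y.
elim: s {IH} => [|t s IHs]; first by under [in RHS]eq_fun do rewrite big_nil; rewrite big_nil derive1_cst.
under [in RHS]eq_fun do rewrite big_cons.
rewrite derive1D ?big_cons ?IHs//; apply: smooth_derivable => //; exact: smooth_sum.
Qed.

Lemma jet_mul_partition (I : Type) (s : seq I) (chi : I -> R -> R) u i x :
  (forall t, smooth (chi t)) -> (forall y, \sum_(t <- s) chi t y = 1) ->
  \sum_(t <- s) jet_mul (chi t) u i x = u i x.
Proof.
move=> sc h1; rewrite jet_mul_sum//.
have -> : (fun y => \sum_(t <- s) chi t y) = fun=> 1 by apply/funext.
rewrite jet_mul_const ?mul1r//; case=> // q _; by rewrite derive1nSr_cst.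
Qed.

Lemma is_hjet_mul k chi u K : smooth chi ->
  (forall q x, (q <= k)%N -> `|derive1n q chi x| <= K) ->
  is_hjet k u -> is_hjet k (jet_mul chi u).
Proof.
move=> sc hK hu; have ju := is_jet_mul sc (is_hjet_jet hu).
split; last exact: (proj2 ju); move=> i ik.
pose g (p : 'I_i.+1) := u p.
apply: (@L2_dom _ _ (index_enum 'I_i.+1) _ g (2 ^+ i * K)).
- exact: is_jet_measurable ju ik.
- by move=> p; apply: (proj1 hu); apply: leq_trans ik; rewrite -ltnS.
- by apply: aeR_all => x; apply: jet_mul_le => q qi; apply: hK; exact: leq_trans ik.
Qed.

Section Step.
Variables (h : R -> R) (sh : step_function h).

Lemma is_jet_uniq k u v : is_jet k u -> is_jet k v -> aeR (fun x => u 0 x = v 0 x) ->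
  forall i, (i <= k)%N -> aeR (fun x => u i x = v i x).
Proof.
move=> ju jv uv i ik; apply: (weak_derivative_real_uniq sh).
  exact: is_jet_weak_derivative ju ik.
have dv := is_jet_weak_derivative jv ik.
apply: (weak_derivative_real_ae dv); first exact: (proj1 ju).
- by case: dv.
- by apply: aeRS uv => x ->.
- exact: aeR_all.
Qed.

(** Descending induction from order [k]: the last step is interpolated with [e], all others with 1,
    so the coefficient [e] of the top order is never multiplied. The finitely many constants are
    then added. *)
Lemma jet_interpolation k e : 0 < e -> exists2 C : R, 0 < C &
  forall i u, (i < k)%N -> is_hjet k u -> nn (u i) <= C * nn (u 0) + e * nn (u k).
Proof.
move=> e0.
have one i : exists2 C : R, 0 < C &
    forall u, (i < k)%N -> is_hjet k u -> nn (u i) <= C * nn (u 0) + e * nn (u k).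
  have [ki|] := leqP k i; first by exists 1 => // u; rewrite ltnNge ki.
  have [d] := ubnP (k - i); elim: d i => // d IH i dk ik.
  have step e' : 0 < e' -> exists2 C : R, 0 < C &
     forall u, is_hjet k u -> nn (u i) <= C * nn (u 0) + e' * nn (u i.+1).
    move=> e'0; have [C C0 HC] := interpolation sh i e'0.
    exists C => // u hu; apply: HC.
    - exact: is_jet_weak_derivative (is_hjet_jet hu) (ltnW ik).
    - exact: (proj2 hu).
    - exact: (proj1 hu).
    - by apply: (proj1 hu); exact: ltnW.
    - exact: (proj1 hu).
  have [ki|ki] := eqVneq i.+1 k.
    by have [C C0 HC] := step _ e0; exists C => // u _ hu; rewrite -[in nn (u k)]ki; exact: HC.
  have ik1 : (i.+1 < k)%N by rewrite ltn_neqAle ki.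
  have [||C1 C10 HC1] := IH i.+1 => //.
    by rewrite ltnS in dk; apply: leq_trans dk; rewrite subnS prednK// subn_gt0.
  have [C2 C20 HC2] := step 1 ltr01.
  exists (C2 + C1); first exact: addr_gt0.
  move=> u _ hu; apply: (le_trans (HC2 u hu)).
  by rewrite mul1r mulrDl -addrA lerD2l HC1.
have all m : exists2 C : R, 0 < C &
    forall i u, (i < m)%N -> (i < k)%N -> is_hjet k u -> nn (u i) <= C * nn (u 0) + e * nn (u k).
  elim: m => [|m [C C0 HC]]; first by exists 1.
  have [C' C'0 HC'] := one m; exists (C + C'); first exact: addr_gt0.
  move=> i u; rewrite ltnS leq_eqVlt => /orP[/eqP ->|im] ik hu.
    by apply: (le_trans (HC' _ ik hu)); rewrite lerD2r ler_wpM2r ?nn_ge0// lerDr ltW.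
  by apply: (le_trans (HC _ _ im ik hu)); rewrite lerD2r ler_wpM2r ?nn_ge0// lerDl ltW.
have [C C0 HC] := all k; exists C => // i u ik; exact: HC.
Qed.

End Step.
End Jets.

(** * A fixed point theorem in L2 *)

Section Completeness.
Context {R : realType}.
Local Notation mu := (@lebesgue_measure R).
Implicit Types (f g : R -> R) (x : R).

Lemma nnD_le f g : L2 f -> L2 g -> nn (fun x => f x + g x) <= 2 * nn f + 2 * nn g.
Proof.
move=> lf lg; rewrite -lee_fin nnE; last exact: L2D.
rewrite EFinD !EFinM !nnE// /n2.
rewrite -!ge0_integralZl//; try (by move=> x _; rewrite lee_fin sqr_ge0);
  try (by apply: measurable_sqr; exact: L2_measurable).
rewrite -ge0_integralD//; try (by move=> x _; rewrite mule_ge0// lee_fin sqr_ge0);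
  try (by apply: measurable_funeM; apply: measurable_sqr; exact: L2_measurable).
apply: ge0_le_integral => //.
- by move=> x _; rewrite lee_fin sqr_ge0.
- by apply: measurable_sqr; apply: measurable_funD; exact: L2_measurable.
- apply: emeasurable_funD; apply: measurable_funeM; apply: measurable_sqr; exact: L2_measurable.
- move=> x _; rewrite -!EFinM -EFinD lee_fin -subr_ge0.
  have -> : 2 * f x ^+ 2 + 2 * g x ^+ 2 - (f x + g x) ^+ 2 = (f x - g x) ^+ 2 by ring.
  exact: sqr_ge0.
Qed.

(** As [z <= 1 + z ^+ 2] for [z = 2 ^+ q * |d q|], the terms are bounded by the geometric sequence
    [(1 + G) * 2^-1 ^+ q]. *)
Lemma cvg_of_summable_weighted (d : nat -> R) (G : R) :
  (forall q, 4 ^+ q * d q ^+ 2 <= G) -> cvgn (series d).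
Proof.
move=> hG; apply: normed_cvg.
have G0 : 0 <= G by apply: le_trans (hG 0%N); rewrite mulr_ge0 ?sqr_ge0.
apply: (@series_le_cvg _ _ (geometric (1 + G) (2^-1))) => //.
- by move=> n /=.
- by move=> n /=; rewrite mulr_ge0 ?addr_ge0// exprn_ge0// invr_ge0.
- move=> n /=; have p2 : 0 < 2 ^+ n :> R by rewrite exprn_gt0.
  rewrite exprVn ler_pdivlMr// mulrC.
  apply: (@le_trans _ _ (1 + 4 ^+ n * d n ^+ 2)); last by rewrite lerD2l.
  have -> : 4 ^+ n * d n ^+ 2 = (2 ^+ n * `|d n|) ^+ 2.
    by rewrite [RHS]exprMn real_normK ?num_real// exprAC -[X in _ = X ^+ n * _]natrX.
  rewrite -subr_ge0; set z := _ * `|_|.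
  have z0 : 0 <= z by rewrite mulr_ge0// ltW.
  by move: z z0 => z z0; clear -z0; nra.
- by apply: is_cvg_geometric_series; rewrite ger0_norm ?invr_ge0// invf_lt1// ltr1n.
Qed.

(** The decay [16^-1 ^+ q] leaves room for the weight [4 ^+ q]: the weighted sum of squares has
    finite integral, hence is finite almost everywhere and forces pointwise convergence. Fatou's
    lemma then bounds the remainders. *)
Lemma L2_series (d : nat -> R -> R) (delta : R) : 0 <= delta ->
  (forall q, L2 (d q)) -> (forall q, nn (d q) <= delta * 16^-1 ^+ q) ->
  exists2 f, L2 f & forall p, nn (fun x => f x - \sum_(q < p) d q x) <= 4 * delta * 16^-1 ^+ p.
Proof.
move=> delta0 ld hd.
pose S p x := \sum_(q < p) d q x.
have lS p : L2 (S p) by apply: L2_sum.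
(* The factor 4 closes the induction, since [2 * (4 / 16) + 2 <= 4]. *)
have hS s : forall p, nn (fun x => S (p + s)%N x - S p x) <= 4 * delta * 16^-1 ^+ p.
  elim: s => [|s IH] p.
    rewrite /nn (_ : (fun x => _) = fun=> 0).
      by rewrite Rintegral_cst// mul0r mulr_ge0// ?mulr_ge0// exprn_ge0// invr_ge0.
    by apply/funext => x; rewrite addn0 subrr expr0n.
  have -> : (fun x => S (p + s.+1)%N x - S p x) =
            (fun x => (S (p.+1 + s)%N x - S p.+1 x) + d p x).
    by apply/funext => x; rewrite addnS addSn /S [in RHS](big_ord_recr p)/=; ring.
  apply: (le_trans (nnD_le (L2B (lS _) (lS _)) (ld p))).
  apply: (@le_trans _ _ (2 * (4 * delta * 16^-1 ^+ p.+1) + 2 * (delta * 16^-1 ^+ p))).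
    by apply: lerD; rewrite ler_wpM2l.
  have : 0 <= delta * 16^-1 ^+ p by rewrite mulr_ge0// exprn_ge0// invr_ge0.
  rewrite exprS; set z := 16^-1 ^+ p; clearbody z; clear; lra.
pose gq q x := ((4 ^+ q * d q x ^+ 2)%:E : \bar R).
have gq0 q x : (0 <= gq q x)%E by rewrite lee_fin mulr_ge0 ?sqr_ge0// exprn_ge0.
have mgq q : measurable_fun setT (gq q).
  apply/measurable_EFinP; apply: measurable_funM => //; apply: measurable_funX.
  exact: L2_measurable.
pose G x := (\sum_(0 <= q <oo) gq q x)%E.
have mG : measurable_fun setT G by exact: ge0_emeasurable_sum.
have G0 x : (0 <= G x)%E by apply: nneseries_ge0 => *.
have intG : (\int[mu]_x G x < +oo)%E.
  rewrite integral_nneseries//.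
  apply: (@le_lt_trans _ _ (delta * (1 - 4^-1)^-1)%:E); last exact: ltry.
  apply: lime_le; first by apply: is_cvg_nneseries => n _ _; exact: integral_ge0.
  apply: nearW => n.
  apply: (@le_trans _ _ (\sum_(0 <= q < n) (delta * 4^-1 ^+ q)%:E)%E).
    apply: lee_sum => q _.
    rewrite (_ : (\int[mu]_x gq q x)%E = ((4 ^+ q)%:E * n2 (d q))%E).
      rewrite -nnE// -EFinM lee_fin.
      apply: (@le_trans _ _ (4 ^+ q * (delta * 16^-1 ^+ q))).
        by apply: ler_wpM2l => //; rewrite exprn_ge0.
      rewrite mulrCA -exprMn.
      by have -> : (4 * 16^-1 : R) = 4^-1 by field.
    rewrite /n2 -ge0_integralZl//.
    - by apply: measurable_sqr; exact: L2_measurable.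
    - by move=> x _; rewrite lee_fin sqr_ge0.
  rewrite sumEFin lee_fin.
  by apply: (@geometric_le_lim R n delta 4^-1) => //; rewrite ?invr_gt0// ger0_norm ?invr_ge0// invf_lt1// ltr1n.
pose A : set (measurableTypeR R) := [set x | G x \is a fin_num].
have mA : measurable A.
  by have := emeasurable_fin_num measurableT mG; rewrite setTI.
have aeA : aeR A.
  have : mu.-integrable setT G.
    by apply/integrableP; split => //; under eq_integral do rewrite gee0_abs//.
  by move=> /integrable_ae -/(_ measurableT); apply: aeRS => x; exact.
(* Multiplication by the indicator of the good set makes the partial sums converge at every point,
   so the limit is measurable. *)
pose h p x := \1_A x * S p x.
have hc x : cvgn (h ^~ x).
  rewrite /h indicE; have [xA|xA] := boolP (x \in A); last first.
    by under eq_fun do rewrite mul0r; exact: is_cvg_cst.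
  under eq_fun do rewrite mul1r.
  have -> : (fun p => S p x) = series (d ^~ x).
    by apply/funext => p; rewrite /series/= big_mkord.
  rewrite inE in xA; apply: (@cvg_of_summable_weighted _ (fine (G x))) => q.
  rewrite -lee_fin fineK//.
  apply: le_trans (nneseries_lim_ge q.+1 _) => [|//].
  by rewrite big_nat_recr//= leeDr// sume_ge0.
pose f : R -> R := fun x => limn (h ^~ x).
have mh p : measurable_fun setT (h p).
  by apply: measurable_funM => //; exact: L2_measurable.
have mf : measurable_fun setT f by apply: (measurable_fun_cvg mh) => x _; exact: hc.
have hSae p : aeR (fun x => h p x = S p x).
  by apply: aeRS aeA => x xA; rewrite /h indicE mem_set// mul1r.
have bound p : (n2 (fun x => (f x - h p x)%R) <= (4 * delta * 16^-1 ^+ p)%:E)%E.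
  pose F s x := (((h (p + s)%N x - h p x) ^+ 2)%:E : \bar R).
  have mF s : measurable_fun setT (F s) by apply: measurable_sqr; exact: measurable_funB.
  have F0 s x : setT x -> (0 <= F s x)%E by move=> _; rewrite lee_fin sqr_ge0.
  have limF x : limn_einf (F ^~ x) = ((f x - h p x) ^+ 2)%:E.
    have cF : F ^~ x @ \oo --> ((f x - h p x) ^+ 2)%:E.
      apply: cvg_EFin; first exact: nearW.
      apply: cvgM; apply: cvgB => //; try exact: cvg_cst;
        by under eq_fun do rewrite addnC; have := hc x; rewrite -(cvg_shiftn p).
    by rewrite is_cvg_limn_einfE; [exact/cvg_lim|apply/cvg_ex; eexists; exact: cF].
  have := fatou mu measurableT mF F0.
  under eq_integral do rewrite limF; move=> /le_trans; apply.
  apply: (@le_trans _ _ (limn_einf (fun=> (4 * delta * 16^-1 ^+ p)%:E))).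
    rewrite !limn_einf_lim; apply: lee_lim; [exact: is_cvg_einfs|exact: is_cvg_einfs|].
    apply: nearW => n; apply: le_ereal_inf_tmp => _ [s /= ns <-].
    apply: (@le_trans _ _ (\int[mu]_x F s x)%E); first by apply: ereal_inf_lbound; exists s.
    rewrite (_ : (\int[mu]_x F s x)%E = n2 (fun x => S (p + s)%N x - S p x)).
      by rewrite -nnE ?lee_fin; [exact: hS|exact: L2B].
    apply: ae_eq_n2; [exact: measurable_funB| |].
      by apply: measurable_funB; exact: L2_measurable.
    by apply: aeRS2 (hSae (p + s)%N) (hSae p) => x -> ->.
  by rewrite is_cvg_limn_einfE; [rewrite lim_cst|exact: is_cvg_cst].
have lf : L2 f.
  split => //; have := bound 0%N.
  have -> : (fun x => f x - h 0%N x) = f.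
    by apply/funext => x; rewrite /h /S big_ord0 mulr0 subr0.
  by move=> /le_lt_trans; apply; exact: ltry.
exists f => // p.
rewrite (@nn_ae _ _ (fun x => f x - h p x)).
- rewrite -lee_fin nnE//; split; first exact: measurable_funB.
  by apply: le_lt_trans (bound p) _; exact: ltry.
- by apply: measurable_funB => //; exact: (L2_measurable (lS p)).
- exact: measurable_funB.
- by apply: aeRS (hSae p) => x ->.
Qed.

End Completeness.

(** * Contractions of vector-valued L2 *)

Section VectorL2.
Context {R : realType} {J : finType}.
Implicit Types (f g : J -> R -> R).

Definition VL2 f := forall j, L2 (f j).

Definition NN f : R := \sum_j nn (f j).

Lemma NN_ge0 f : 0 <= NN f.
Proof. by apply: sumr_ge0 => j _; exact: nn_ge0. Qed.

Lemma nn_le_NN f j : nn (f j) <= NN f.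
Proof. by rewrite /NN (bigD1 j)//= lerDl sumr_ge0// => l _; exact: nn_ge0. Qed.

Lemma NND_le f g : VL2 f -> VL2 g ->
  NN (fun j x => f j x + g j x) <= 2 * NN f + 2 * NN g.
Proof.
by move=> lf lg; rewrite /NN !mulr_sumr -big_split/=; apply: ler_sum => j _; exact: nnD_le.
Qed.

Lemma NN_eq0 f : VL2 f -> NN f <= 0 -> forall j, aeR (fun x => f j x = 0).
Proof. by move=> lf f0 j; apply: nn_eq0 => //; exact: le_trans (nn_le_NN f j) f0. Qed.

Lemma NN_subC f g : NN (fun j x => f j x - g j x) = NN (fun j x => g j x - f j x).
Proof.
apply: eq_bigr => j _; rewrite /nn; apply: eq_Rintegral => x _.
by rewrite -sqrrN opprB.
Qed.

Lemma VL2B f g : VL2 f -> VL2 g -> VL2 (fun j x => f j x - g j x).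
Proof. by move=> lf lg j; exact: L2B. Qed.

Lemma NN_sub_trans f g h0 : VL2 f -> VL2 g -> VL2 h0 ->
  NN (fun j x => f j x - h0 j x) <=
  2 * NN (fun j x => f j x - g j x) + 2 * NN (fun j x => g j x - h0 j x).
Proof.
move=> lf lg lh; have := NND_le (VL2B lf lg) (VL2B lg lh).
by under [X in NN X <= _ -> _]eq_fun do under eq_fun do rewrite addrA subrK.
Qed.

(** Iteration from 0. All norms are squared: the iterates stay in the ball of radius [4 * delta]
    because [2 * (4 / 16) + 2 <= 4], and passing to the limit doubles the radius, whence
    [8 * delta <= rho]. *)
Lemma contraction_fixpoint (Phi : (J -> R -> R) -> J -> R -> R) (delta rho : R) :
  (forall f, VL2 f -> NN f <= rho -> VL2 (Phi f)) -> 0 <= delta -> 8 * delta <= rho ->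
  (forall f g, VL2 f -> VL2 g -> NN f <= rho -> NN g <= rho ->
     NN (fun j x => Phi f j x - Phi g j x) <= 16^-1 * NN (fun j x => f j x - g j x)) ->
  NN (Phi (fun _ _ => 0)) <= delta ->
  exists f, [/\ VL2 f, NN f <= 8 * delta &
    forall j, aeR (fun x => Phi f j x = f j x)].
Proof.
move=> Phi_L2 delta0 delta_rho Phi_contr Phi0.
pose F p := iter p Phi (fun _ _ => 0).
have l0 : VL2 (fun _ _ => 0) by move=> j; exact: L2_cst0.
have NN0 : NN (fun _ _ => 0) = 0.
  by rewrite /NN big1// => j _; rewrite /nn; under eq_Rintegral do rewrite expr0n; rewrite Rintegral_cst// mul0r.
have rho0 : 0 <= rho by apply: le_trans delta_rho; rewrite mulr_ge0.
have delta4 : 4 * delta <= rho by move: delta_rho delta0; clear; lra.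
have lFball p : VL2 (F p) /\ NN (F p) <= 4 * delta.
  elim: p => [|p [lF IH]]; first by split => //; rewrite NN0 mulr_ge0.
  have lF1 : VL2 (F p.+1) := Phi_L2 _ lF (le_trans IH delta4).
  have l1 : VL2 (F 1%N) := Phi_L2 _ l0 (eq_ind_r (fun z => z <= rho) rho0 NN0).
  split => //.
  have h1 : NN (fun j x => F p.+1 j x - F 1%N j x) <= 16^-1 * NN (F p).
    have := Phi_contr _ _ lF l0 (le_trans IH delta4) (eq_ind_r (fun z => z <= rho) rho0 NN0).
    by under [X in _ <= _ * NN X -> _]eq_fun do under eq_fun do rewrite subr0.
  have h2 := NND_le (VL2B lF1 l1) l1.
  have E : NN (fun j x => F p.+1 j x - F 1%N j x + F 1%N j x) = NN (F p.+1).
    by congr NN; apply/funext => j; apply/funext => x; rewrite subrK.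
  rewrite E in h2; apply: (le_trans h2).
  move: h1 IH Phi0 delta0; rewrite -[Phi _]/(F 1%N).
  move: (NN (fun j x => F p.+1 j x - F 1%N j x)) (NN (F p)) (NN (F 1%N)) => a b c.
  by clear; lra.
have lF p : VL2 (F p) := proj1 (lFball p).
have ball p : NN (F p) <= 4 * delta := proj2 (lFball p).
pose d p j x := F p.+1 j x - F p j x.
have hd p : NN (d p) <= delta * 16^-1 ^+ p.
  elim: p => [|p IH].
    rewrite expr0 mulr1 /d; under [X in NN X]eq_fun do under eq_fun do rewrite subr0.
    exact: Phi0.
  rewrite exprS mulrCA.
  have := Phi_contr _ _ (lF p.+1) (lF p) (le_trans (ball _) delta4) (le_trans (ball _) delta4).
  by move=> /le_trans; apply; rewrite ler_wpM2l.
have lim j : exists f : R -> R, L2 f /\ forall p,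
    nn (fun x => f x - F p j x) <= 4 * delta * 16^-1 ^+ p.
  have [|||f lf hf] := @L2_series _ (fun p => d p j) delta => //.
  - by move=> q; apply: L2B; exact: lF.
  - by move=> q; apply: le_trans (hd q); exact: nn_le_NN.
  exists f; split => // p.
  have -> : (fun x => f x - F p j x) = (fun x => f x - \sum_(q < p) d q j x).
    apply/funext => x; congr (_ - _); elim: p => [|p IH]; first by rewrite big_ord0.
    by rewrite big_ord_recr/= -IH /d addrC subrK.
  exact: hf.
pose f j := sval (cid (lim j)).
have lf : VL2 f by move=> j; rewrite /f; case: cid => ? [].
have [C C0 cf] : exists2 C, 0 <= C & forall p, NN (fun j x => f j x - F p j x) <= C * 16^-1 ^+ p.
  exists (\sum_(j : J) 4 * delta).
    by apply: sumr_ge0 => j _; rewrite mulr_ge0.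
  move=> p; rewrite mulr_suml; apply: ler_sum => j _.
  exact: (proj2 (svalP (cid (lim j)))).
have small e : 0 < e -> exists p, C * 16^-1 ^+ p <= e.
  move=> e0; have : geometric C (16^-1) @ \oo --> (0 : R).
    by apply: cvg_geometric; rewrite ger0_norm ?invr_ge0// invf_lt1// ltr1n.
  move=> /cvgrPdist_le/(_ e e0)[p _ /(_ p (leqnn _))] /=.
  by rewrite sub0r normrN => h; exists p; apply: le_trans (ler_norm _) h.
have f4 : NN f <= 8 * delta.
  apply/ler_addgt0Pr => e e0; have [p hp] := small (e / 2) (divr_gt0 e0 (ltr0n _ 2)).
  have h2 := NND_le (VL2B lf (lF p)) (lF p).
  have E : NN (fun j x => f j x - F p j x + F p j x) = NN f.
    by congr NN; apply/funext => j; apply/funext => x; rewrite subrK.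
  rewrite E in h2; apply: (le_trans h2).
  move: (le_trans (cf p) hp) (ball p); move: (NN (F p)) (NN _) => a b; clear; lra.
exists f; split => // j.
suff : aeR (fun x => Phi f j x - f j x = 0) by apply: aeRS => x /eqP; rewrite subr_eq0 => /eqP.
(* The defect of [f] is compared with [F p.+1]: it is close to [Phi f] by contraction and close to
   [f] by convergence. *)
refine (@NN_eq0 (fun j x => Phi f j x - f j x) (VL2B (Phi_L2 _ lf (le_trans f4 delta_rho)) lf) _ j).
apply/ler_addgt0Pr => e e0; rewrite add0r.
have [p hp] := small (e / 4) (divr_gt0 e0 (ltr0n _ 4)).
apply: (le_trans (NN_sub_trans (Phi_L2 _ lf (le_trans f4 delta_rho)) (lF p.+1) lf)).
have h1 := Phi_contr _ _ lf (lF p) (le_trans f4 delta_rho) (le_trans (ball p) delta4).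
rewrite -[Phi (F p)]/(F p.+1) in h1.
have h2 := le_trans (cf p) hp.
have h3 : NN (fun j x => F p.+1 j x - f j x) <= e / 4.
  rewrite NN_subC; apply: (le_trans (cf _)); apply: le_trans hp.
  by apply: ler_wpM2l => //; rewrite exprS ler_piMl ?exprn_ge0 ?invr_ge0// invf_le1// ler1n.
move: h1 h2 h3 e0; move: (NN _) (NN _) (NN _) => a b c; clear; lra.
Qed.

End VectorL2.

(** * The a priori estimate *)

Lemma measurable_sum_mem (R : realType) (I : eqType) (s : seq I) (F : I -> R -> R) :
  (forall i, i \in s -> measurable_fun setT (F i)) ->
  measurable_fun setT (fun x => \sum_(i <- s) F i x).
Proof.
elim: s => [|i s IH] hF.
  by under eq_fun do rewrite big_nil; exact: measurable_cst.
under eq_fun do rewrite big_cons; apply: measurable_funD.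
  by apply: hF; rewrite mem_head.
by apply: IH => j js; apply: hF; rewrite in_cons js orbT.
Qed.

Lemma ler_sum_card (R : realType) (I : finType) (F : I -> R) c :
  (forall i, F i <= c) -> \sum_i F i <= #|I|%:R * c.
Proof. by move=> h; rewrite mulr_natl -sumr_const; apply: ler_sum => i _. Qed.

Section APriori.
Context {R : realType} {J : finType}.
Implicit Types (u v : J -> nat -> R -> R) (g : J -> R -> R) (a : nat -> R -> J -> J -> R)
  (k : nat) (B x : R).

Definition HH k u : R := \sum_j \sum_(i < k.+1) nn (u j i).

Definition Aop k a u j x : R := \sum_(1 <= i < k.+1) \sum_l a i x j l * u l i x.

Definition coefs_bounded k a B := forall i x j l, (1 <= i <= k)%N -> `|a i x j l| <= B.

(** Uniform invertibility of the leading coefficient matrix, written as an estimate so that no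
    inverse matrix appears. *)
Definition elliptic k a B := forall x (z : J -> R) j,
  `|z j| <= B * \sum_l `|\sum_l' a k x l l' * z l'|.

Lemma NN_le_HH k u i : (i <= k)%N -> NN (fun j => u j i) <= HH k u.
Proof.
move=> ik; apply: ler_sum => j _; have ik' : (i < k.+1)%N by [].
by rewrite (bigD1 (Ordinal ik'))//= lerDl sumr_ge0// => l _; exact: nn_ge0.
Qed.

Lemma nn_le_HH k u i j : (i <= k)%N -> nn (u j i) <= HH k u.
Proof. by move=> ik; apply: le_trans (NN_le_HH u ik); exact: (nn_le_NN (fun j => u j i)). Qed.

Lemma HH_eq0 k u i j : (forall j, is_hjet k (u j)) -> HH k u <= 0 -> (i <= k)%N ->
  aeR (fun x => u j i x = 0).
Proof.
move=> hu h0 ik; apply: nn_eq0; first exact: (proj1 (hu j)).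
by apply: le_trans h0; exact: nn_le_HH.
Qed.

Definition VHjet k u := forall j, is_hjet k (u j).

(** The equation is solved for the top derivative, which is bounded by [g] and the lower orders;
    interpolation returns a small multiple of the top order, and this is absorbed. The slack
    [B * \sum_l |u l 0|] admits a bounded potential of order zero. *)
Lemma a_priori (h : R -> R) (sh : step_function h) k B : (0 < k)%N -> 0 <= B ->
  exists2 C : R, 0 < C & forall a, coefs_bounded k a B -> elliptic k a B ->
  forall u g, VHjet k u -> VL2 g ->
  aeR (fun x => forall j, `|Aop k a u j x - g j x| <= B * \sum_l `|u l 0%N x|) ->
  HH k u <= C * (NN g + NN (fun j => u j 0%N)).
Proof.
case: k => // k _ B0.
pose cJ : R := #|J|%:R; have cJ0 : 0 <= cJ by rewrite ler0n.
pose I : finType := (J + 'I_k.+1 * J)%type.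
pose c := B * (1 + cJ * B).
pose K := c ^+ 2 * 2 ^+ size (index_enum I).
have K0 : 0 <= K by rewrite mulr_ge0 ?sqr_ge0// exprn_ge0.
(* The summand 1 keeps [K'] positive even if [K] or the number of components is 0. *)
pose K' := cJ * K + 1; have K'0 : 0 < K' by rewrite ltr_wpDl// mulr_ge0.
(* With this choice [K' * (k.+1%:R * e * X) = X / 2], the half that is absorbed on the left. *)
pose e := (2 * K' * k.+1%:R)^-1.
have e0 : 0 < e by rewrite invr_gt0 !mulr_gt0// ltr0n.
have [C C0 HC] := jet_interpolation sh k.+1 e0.
pose X1 := 2 * K' * (1 + k.+1%:R * C).
have k0 : 0 < k.+1%:R :> R by rewrite ltr0n.
have X10 : 0 < X1 by apply: mulr_gt0; [exact: mulr_gt0|apply: addr_gt0 => //; exact: mulr_gt0].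
exists (X1 + k.+1%:R * C + k.+1%:R * e * X1).
  by apply: addr_gt0; [apply: addr_gt0 => //; exact: mulr_gt0|do 2![apply: mulr_gt0 => //]].
move=> a ab ell u g hu lg Hg.
pose gs (t : I) : R -> R := match t with inl l => g l | inr p => u p.2 p.1 end.
have lgs t : L2 (gs t).
  case: t => [l|[i l]] /=; first exact: lg.
  by apply: (proj1 (hu l)); rewrite ltnW.
have top j : nn (u j k.+1) <= K * (NN g + \sum_l \sum_(i < k.+1) nn (u l i)).
  have -> : NN g + \sum_l \sum_(i < k.+1) nn (u l i) = \sum_(t <- index_enum I) nn (gs t).
    by rewrite big_sumType/= exchange_big pair_big.
  apply: nn_dom => //; first by apply: L2_measurable; exact: (proj1 (hu j)).
  apply: aeRS Hg => x hx.
  have s0 (t : I) : 0 <= `|gs t x| by [].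
  have -> : \sum_(t <- index_enum I) `|gs t x| =
      \sum_l `|g l x| + \sum_l \sum_(i < k.+1) `|u l i x|.
    by rewrite big_sumType/=; congr (_ + _); rewrite exchange_big pair_big.
  set Gx := \sum_l `|g l x|; set Ux := \sum_l \sum_(i < k.+1) `|u l i x|.
  have Gx0 : 0 <= Gx by apply: sumr_ge0.
  have Ux0 : 0 <= Ux by do 2!(apply: sumr_ge0 => ? _).
  apply: (le_trans (ell x (fun l => u l k.+1 x) j)).
  have bl l : `|\sum_l' a k.+1 x l l' * u l' k.+1 x| <= `|g l x| + B * Ux.
    have hl := hx l; rewrite /Aop big_nat_recr//= in hl.
    set T := \sum_l' a k.+1 x l l' * u l' k.+1 x in hl *.
    set S := \sum_(1 <= i < k.+1) _ in hl.
    have hS : `|S| <= \sum_(1 <= i < k.+1) \sum_l' B * `|u l' i x|.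
      apply: (le_trans (ler_norm_sum _ _ _)); rewrite big_nat [leRHS]big_nat.
      apply: ler_sum => i /andP[i1 ik]; apply: (le_trans (ler_norm_sum _ _ _)).
      apply: ler_sum => l' _; rewrite normrM ler_wpM2r// ab// i1/=.
      exact: ltnW.
    have -> : B * Ux = B * (\sum_l' `|u l' 0%N x|) + \sum_(1 <= i < k.+1) \sum_l' B * `|u l' i x|.
      rewrite /Ux exchange_big /= -(big_mkord xpredT (fun i => \sum_l' `|u l' i x|)) big_ltn//.
      rewrite mulrDr; congr (_ + _); rewrite mulr_sumr; apply: eq_bigr => i _.
      by rewrite mulr_sumr.
    have -> : T = (S + T - g l x) + g l x - S by ring.
    apply: (le_trans (ler_normB _ _)).
    apply: (@le_trans _ _ (`|S + T - g l x| + `|g l x| + `|S|)).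
      by rewrite lerD2r ler_normD.
    move: hl hS; set z := `|S + T - g l x|; set y := `|g l x|; set w := `|S|.
    set p := B * _; set q := \sum_(1 <= i < k.+1) _.
    by clearbody z y w p q; clear; lra.
  apply: (@le_trans _ _ (B * \sum_l (`|g l x| + B * Ux))).
    by apply: ler_wpM2l => //; apply: ler_sum => l _; exact: bl.
  rewrite big_split/= sumr_const -/Gx /c -mulrA; apply: ler_wpM2l => //.
  rewrite -mulr_natl -/cJ mulrA mulrDl mul1r mulrDr.
  have : 0 <= cJ * B * Gx by rewrite mulr_ge0// mulr_ge0.
  move: Ux0; move: (cJ * B * Gx) (cJ * B * Ux); move: (Gx) (Ux) => r t p q.
  by clear; lra.
pose U0 := NN (fun j => u j 0%N).
pose X := \sum_j nn (u j k.+1).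
have X0 : 0 <= X by apply: sumr_ge0 => j _; exact: nn_ge0.
have U00 : 0 <= U0 by exact: NN_ge0.
have G0 : 0 <= NN g by exact: NN_ge0.
have low : \sum_l \sum_(i < k.+1) nn (u l i) <= k.+1%:R * C * U0 + k.+1%:R * e * X.
  rewrite /U0 /X /NN !mulr_sumr -big_split/=; apply: ler_sum => l _.
  apply: (@le_trans _ _ (\sum_(i < k.+1) (C * nn (u l 0%N) + e * nn (u l k.+1)))).
    by apply: ler_sum => i _; apply: HC.
  by rewrite sumr_const card_ord -[leLHS]mulr_natl mulrDr !mulrA.
have XK : X <= K' * (NN g + k.+1%:R * C * U0 + k.+1%:R * e * X).
  apply: (@le_trans _ _ (\sum_(j : J) K * (NN g + \sum_l \sum_(i < k.+1) nn (u l i)))).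
    by apply: ler_sum => j _; exact: top.
  rewrite sumr_const -[leLHS]mulr_natl -/cJ mulrA.
  apply: (@le_trans _ _ (K' * (NN g + \sum_l \sum_(i < k.+1) nn (u l i)))).
    apply: ler_wpM2r; last by rewrite lerDl.
    by rewrite addr_ge0//; do 2![apply: sumr_ge0 => ? _]; exact: nn_ge0.
  by rewrite ler_pM2l// -addrA lerD2l.
have X2 : X <= X1 * (NN g + U0).
  have ek : K' * (k.+1%:R * e * X) = X / 2.
    have gen (p q r : R) : p != 0 -> q != 0 -> p * (q * (2 * p * q)^-1 * r) = r / 2.
      by move=> p0 q0; field; rewrite ?p0 ?q0.
    by apply: gen; rewrite gt_eqF.
  have : X / 2 <= K' * (NN g + k.+1%:R * C * U0).
    by move: XK; rewrite [K' * (_ + k.+1%:R * e * X)]mulrDr ek; set y := K' * _; clearbody y; clear; lra.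
  have kC : 0 <= k.+1%:R * C by rewrite mulr_ge0// ltW.
  have : K' * (NN g + k.+1%:R * C * U0) <= K' * ((1 + k.+1%:R * C) * (NN g + U0)).
    rewrite ler_pM2l// mulrDl mul1r mulrDr.
    have : 0 <= k.+1%:R * C * NN g by rewrite mulr_ge0.
    move: U00; move: (k.+1%:R * C * NN g) (k.+1%:R * C * U0); move: (NN g) (U0) => r t p q.
    by clear; lra.
  have -> : X1 * (NN g + U0) = 2 * (K' * ((1 + k.+1%:R * C) * (NN g + U0))) by rewrite /X1 !mulrA.
  move: (K' * ((1 + _) * _)) (K' * (NN g + _)); move: (X) => r p q.
  by clear; lra.
have -> : HH k.+1 u = \sum_l \sum_(i < k.+1) nn (u l i) + X.
  by rewrite /HH /X -big_split/=; apply: eq_bigr => j _; rewrite big_ord_recr.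
rewrite mulrDl mulrDl.
have kC : 0 <= k.+1%:R * C by rewrite mulr_ge0// ltW.
have h1 : k.+1%:R * C * U0 <= k.+1%:R * C * (NN g + U0) by rewrite ler_wpM2l// lerDr.
have h2 : k.+1%:R * e * X <= k.+1%:R * e * (X1 * (NN g + U0)).
  by rewrite ler_wpM2l// mulr_ge0// ltW.
rewrite -[k.+1%:R * e * X1 * _]mulrA.
move: low X2 h1 h2; move: (\sum_l _) (X1 * _) (_ * U0) (_ * X) (_ * C * (_ + _)) (_ * (X1 * _)) => p q r t w z.
by clear; lra.
Qed.

End APriori.

(** * Gluing approximate inverses *)

Lemma le_sqr_addr1 (R : realFieldType) (c : R) : 0 <= c -> c <= (c + 1) ^+ 2.
Proof. by move=> c0; nra. Qed.

(** Here [t] is the common bound for the cutoff derivatives and the potential mismatch, and [s] is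
    the sup bound of the correction; each hypothesis confines its share to a third of [e]. *)
Lemma contraction_budget (R : realFieldType) (c t e p n s : R) : 0 <= s -> 0 <= e ->
  t * (3 * (c + 1)) <= e -> s * (3 * (p * (n + n) + 1)) <= e ->
  c * t + t + p * (n * s + n * s) <= e.
Proof. by move=> s0 e0 h1 h2; nra. Qed.

Section GluingData.
Context {R : realType} {J Q : finType} (h : R -> R) (sh : step_function h).
Context (k : nat) (a : nat -> R -> J -> J -> R) (B Lam rho CS : R).
Context (N : (J -> R) -> R -> J -> R) (DN : (J -> R) -> R -> J -> J -> R).
Hypotheses (k0 : (0 < k)%N) (B0 : 0 <= B) (Lam0 : 0 <= Lam) (CS0 : 0 <= CS).
Hypothesis ma : forall i j l, (1 <= i <= k)%N -> measurable_fun setT (fun x => a i x j l).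
Hypothesis ab : coefs_bounded k a B.
Hypothesis mN : forall U : J -> R -> R, (forall j, measurable_fun setT (U j)) ->
  forall j, measurable_fun setT (fun x => N (fun l => U l x) x j).
Hypothesis taylor : forall (z p q : J -> R) x j, (forall j, `|z j| <= rho) ->
  (forall j, `|p j| <= 1) -> (forall j, `|q j| <= 1) ->
  `|N (fun l => z l + p l) x j - N (fun l => z l + q l) x j
     - \sum_l DN z x j l * (p l - q l)| <=
  Lam * (\sum_l `|p l| + \sum_l `|q l|) * \sum_l `|p l - q l|.

Definition Lop (V : R -> J -> J -> R) (u : J -> nat -> R -> R) j x : R :=
  Aop k a u j x + \sum_l V x j l * u l 0%N x.

Definition Fop (u : J -> nat -> R -> R) j x : R :=
  Aop k a u j x + N (fun l => u l 0%N x) x j.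

Section Configuration.

(* One gluing configuration: [V q] are the limiting potentials, [ind] is a
   partition of unity (not smooth), [theta q] equals 1 on the support of [ind q],
   and [w] is the approximate solution. *)
Context (V : Q -> R -> J -> J -> R) (ind theta : Q -> R -> R)
  (w : J -> nat -> R -> R) (kappa eps : R).
Hypotheses (kappa0 : 0 <= kappa) (kappa1 : kappa <= 1) (eps0 : 0 <= eps).
Hypothesis solvable : forall q f, VL2 f -> exists2 phi, VHjet k phi &
  forall j, aeR (fun x => Lop (V q) phi j x = f j x).
Hypothesis stable : forall q phi f, VHjet k phi -> VL2 f ->
  (forall j, aeR (fun x => Lop (V q) phi j x = f j x)) -> HH k phi <= CS * NN f.
Hypothesis mind : forall q, measurable_fun setT (ind q).
Hypothesis ind01 : forall q x, 0 <= ind q x <= 1.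
Hypothesis ind1 : forall x, \sum_q ind q x = 1.
Hypothesis sth : forall q, smooth (theta q).
Hypothesis th1 : forall q x, `|theta q x| <= 1.
Hypothesis thk : forall q i x, (0 < i <= k)%N -> `|derive1n i (theta q) x| <= kappa.
Hypothesis thind : forall q x, theta q x * ind q x = ind q x.
Hypothesis jw : forall j, is_jet k (w j).
Hypothesis wrho : aeR (fun x => forall j, `|w j 0%N x| <= rho).
Hypothesis Fw : VL2 (Fop w).
Hypothesis potential : aeR (fun x => forall q j l,
  `|theta q x * (V q x j l - DN (fun l => w l 0%N x) x j l)| <= eps).

Lemma AopB u v j x : Aop k a (fun l i y => u l i y - v l i y) j x =
  Aop k a u j x - Aop k a v j x.
Proof.
rewrite /Aop -sumrB; apply: eq_bigr => i _; rewrite -sumrB; apply: eq_bigr => l _.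
by rewrite mulrBr.
Qed.

Lemma AopD u v j x : Aop k a (fun l i y => u l i y + v l i y) j x =
  Aop k a u j x + Aop k a v j x.
Proof.
rewrite /Aop -big_split; apply: eq_bigr => i _; rewrite -big_split; apply: eq_bigr => l _.
by rewrite /= mulrDr.
Qed.

Lemma measurable_Aop u : (forall j, is_jet k (u j)) -> forall j, measurable_fun setT (Aop k a u j).
Proof.
move=> ju j; apply: measurable_sum_mem => i; rewrite mem_index_iota ltnS => ik.
apply: measurable_sum_mem => l _; apply: measurable_funM; first exact: ma.
by apply: is_jet_measurable (ju l) _; case/andP: ik.
Qed.

Lemma measurable_Fop u : (forall j, is_jet k (u j)) -> forall j, measurable_fun setT (Fop u j).
Proof.
move=> ju j; apply: measurable_funD; first exact: measurable_Aop.
by apply: mN => l; exact: is_jet_measurable (ju l) _.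
Qed.

(** A choice of solutions, without linearity. The difference of two chosen solutions solves the
    equation for the difference of the data, and [stable] bounds it. *)
Definition S q f : J -> nat -> R -> R := xget (fun _ _ _ => 0)
  [set phi | VHjet k phi /\ forall j, aeR (fun x => Lop (V q) phi j x = f j x)].

Lemma SP q f : VL2 f -> VHjet k (S q f) /\ forall j, aeR (fun x => Lop (V q) (S q f) j x = f j x).
Proof.
move=> lf; rewrite /S; case: xgetP => [phi _ //|hn].
by have [phi h1 h2] := solvable q lf; case: (hn phi).
Qed.

Definition cut q (f : J -> R -> R) : J -> R -> R := fun j x => ind q x * f j x.

Lemma cut_L2 q f : VL2 f -> VL2 (cut q f) /\ NN (cut q f) <= NN f.
Proof.
move=> lf.
have mc j : measurable_fun setT (cut q f j).
  by apply: measurable_funM => //; exact: L2_measurable.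
have hc j : aeR (fun x => `|cut q f j x| <= 1 * `|f j x|).
  apply: aeR_all => x; rewrite normrM; apply: ler_wpM2r => //.
  by have /andP[i0 i1] := ind01 q x; rewrite ger0_norm.
have lc : VL2 (cut q f) by move=> j; apply: L2_dom1 (hc j).
split => //; apply: ler_sum => j _; rewrite -lee_fin !nnE//.
apply: ge0_le_integral => //.
- by move=> x _; rewrite lee_fin sqr_ge0.
- exact: measurable_sqr.
- by apply: measurable_sqr; exact: L2_measurable.
- move=> x _; rewrite lee_fin -[leLHS]real_normK ?num_real// -[leRHS]real_normK ?num_real//.
  rewrite ler_sqr ?nnegrE// normrM ler_piMl//.
  by have /andP[i0 i1] := ind01 q x; rewrite ger0_norm.
Qed.

Definition patch (phi : Q -> J -> nat -> R -> R) : J -> nat -> R -> R :=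
  fun j i x => \sum_q jet_mul (theta q) (phi q j) i x.

Lemma theta_bound q i x : (i <= k)%N -> `|derive1n i (theta q) x| <= 1.
Proof.
case: i => [|i] ik; first exact: th1.
by apply: le_trans kappa1; exact: thk.
Qed.

Lemma patch_VHjet phi : (forall q, VHjet k (phi q)) -> VHjet k (patch phi).
Proof.
move=> hphi j; apply: is_hjet_sum => q; apply: (is_hjet_mul (K := 1)) => //.
  by move=> i x ik; exact: theta_bound.
exact: hphi.
Qed.

(** Lists all jet components of all local solutions, so that [nn_dom] applies with a single finite
    sum. *)
Definition idx : finType := (Q * J * 'I_k.+1)%type.

Definition jets (phi : Q -> J -> nat -> R -> R) (t : idx) : R -> R := phi t.1.1 t.1.2 t.2.

Lemma jets_L2 phi : (forall q, VHjet k (phi q)) -> forall t, L2 (jets phi t).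
Proof. by move=> hphi t; apply: (proj1 (hphi t.1.1 t.1.2)); rewrite -ltnS. Qed.

Lemma sum_jets (F : (R -> R) -> R) phi :
  \sum_(t : idx) F (jets phi t) = \sum_q \sum_j \sum_(i < k.+1) F (phi q j i).
Proof.
rewrite [RHS](eq_bigr (fun q => \sum_(p : J * 'I_k.+1) F (phi q p.1 p.2))); last first.
  by move=> q _; rewrite pair_big.
rewrite pair_big /=.
rewrite (reindex (fun p : Q * (J * 'I_k.+1) => (p.1, p.2.1, p.2.2)))/=; last first.
  by exists (fun t => (t.1.1, (t.1.2, t.2))) => [[? []]|[[]]].
by apply: eq_bigr => -[q [j i]].
Qed.

Lemma sum_nn_jets phi : \sum_(t : idx) nn (jets phi t) = \sum_q HH k (phi q).
Proof. exact: (sum_jets nn). Qed.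

Lemma patch_le phi j i x : (i <= k)%N ->
  `|patch phi j i x| <= 2 ^+ k * \sum_(t : idx) `|jets phi t x|.
Proof.
move=> ik; rewrite (sum_jets (fun u => `|u x|)) mulr_sumr.
apply: (le_trans (ler_norm_sum _ _ _)); apply: ler_sum => q _.
apply: (@le_trans _ _ (2 ^+ i * 1 * \sum_(p < i.+1) `|phi q j p x|)).
  by apply: jet_mul_le => p pi; apply: theta_bound; exact: leq_trans ik.
rewrite mulr1; apply: (@le_trans _ _ (2 ^+ k * \sum_(p < i.+1) `|phi q j p x|)).
  by rewrite ler_wpM2r ?sumr_ge0// ler_eXn2l// ltr1n.
rewrite ler_wpM2l ?exprn_ge0// (bigD1 j)//=.
apply: ler_wpDr; first by do 2![apply: sumr_ge0 => ? _].
rewrite -!(big_mkord xpredT (fun p => `|phi q j p x|)) (@big_cat_nat _ _ _ i.+1 0 k.+1)//=.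
by rewrite lerDl sumr_ge0.
Qed.

Lemma patch_NN phi i : (forall q, VHjet k (phi q)) -> (i <= k)%N ->
  NN (fun j => patch phi j i) <=
  #|J|%:R * ((2 ^+ k) ^+ 2 * 2 ^+ size (index_enum idx)) * \sum_q HH k (phi q).
Proof.
move=> hphi ik; rewrite -sum_nn_jets -mulrA.
apply: ler_sum_card => j; apply: nn_dom.
- exact: (L2_measurable (proj1 (patch_VHjet hphi j) i ik)).
- exact: jets_L2.
- by apply: aeR_all => x; exact: patch_le.
Qed.

Definition patch_const : R :=
  k.+1%:R * (#|J|%:R * ((2 ^+ k) ^+ 2 * 2 ^+ size (index_enum idx))).

Lemma patch_const_ge0 : 0 <= patch_const.
Proof. by rewrite !mulr_ge0// ?sqr_ge0// exprn_ge0. Qed.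

Lemma patch_HH phi : (forall q, VHjet k (phi q)) ->
  HH k (patch phi) <= patch_const * \sum_q HH k (phi q).
Proof.
move=> hphi; rewrite /HH exchange_big/= /patch_const -mulrA.
rewrite -[X in X%:R * _]card_ord.
by apply: ler_sum_card => i; apply: patch_NN => //; rewrite -ltnS.
Qed.

Definition corr f := patch (fun q => S q (cut q f)).

Lemma VHjet_S q f : VL2 f -> VHjet k (S q (cut q f)).
Proof. by move=> /(cut_L2 q)[lc _]; exact: (proj1 (SP q lc)). Qed.

Lemma corr_VHjet f : VL2 f -> VHjet k (corr f).
Proof. by move=> lf; apply: patch_VHjet => q; exact: VHjet_S. Qed.

Lemma corr_HH f : VL2 f -> HH k (corr f) <= patch_const * (#|Q|%:R * CS) * NN f.
Proof.
move=> lf; apply: (le_trans (patch_HH _)); first by move=> q; exact: VHjet_S.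
rewrite -[leRHS]mulrA ler_wpM2l ?patch_const_ge0// -mulrA.
apply: ler_sum_card => q; have [lc nc] := cut_L2 q lf; have [hS eS] := SP q lc.
by apply: (le_trans (stable hS lc eS)); exact: ler_wpM2l.
Qed.

Definition diffS f g q l i y := S q (cut q f) l i y - S q (cut q g) l i y.

Lemma VHjet_diffS f g q : VL2 f -> VL2 g -> VHjet k (diffS f g q).
Proof. by move=> lf lg j; apply: is_hjetB; exact: VHjet_S. Qed.

Lemma LopB W u v j x : Lop W (fun l i y => u l i y - v l i y) j x = Lop W u j x - Lop W v j x.
Proof.
rewrite /Lop AopB; have -> : \sum_l W x j l * (u l 0%N x - v l 0%N x) =
    \sum_l W x j l * u l 0%N x - \sum_l W x j l * v l 0%N x.
  by rewrite -sumrB; apply: eq_bigr => l _; rewrite mulrBr.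
by rewrite opprD addrACA.
Qed.

Lemma Lop_diffS f g q : VL2 f -> VL2 g -> forall j,
  aeR (fun x => Lop (V q) (diffS f g q) j x = ind q x * (f j x - g j x)).
Proof.
move=> lf lg j.
have [_ eS] := SP q (proj1 (cut_L2 q lf)); have [_ eS'] := SP q (proj1 (cut_L2 q lg)).
by apply: aeRS2 (eS j) (eS' j) => x e1 e2; rewrite LopB e1 e2 /cut mulrBr.
Qed.

Lemma diffS_HH f g q : VL2 f -> VL2 g ->
  HH k (diffS f g q) <= CS * NN (fun j x => f j x - g j x).
Proof.
move=> lf lg; have lfg := VL2B lf lg; have [lc nc] := cut_L2 q lfg.
have := stable (VHjet_diffS q lf lg) lc (Lop_diffS q lf lg).
by move=> /le_trans; apply; exact: ler_wpM2l.
Qed.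

(** Its fixed points are the [f] for which [w + corr f] solves the equation. *)
Definition Phi f j x := f j x - Fop (fun l i y => w l i y + corr f l i y) j x.

Lemma corrB f g l i x : corr f l i x - corr g l i x = patch (diffS f g) l i x.
Proof. by rewrite /corr /patch -sumrB; apply: eq_bigr => q _; rewrite jet_mulB. Qed.

Definition comm q (phi : J -> nat -> R -> R) j x : R :=
  \sum_(1 <= i < k.+1) \sum_l a i x j l * (jet_mul (theta q) (phi l) i x - theta q x * phi l i x).

Lemma Aop_patch phi j x : Aop k a (patch phi) j x =
  \sum_q (theta q x * Aop k a (phi q) j x + comm q (phi q) j x).
Proof.
transitivity (\sum_q Aop k a (fun l => jet_mul (theta q) (phi q l)) j x).
  rewrite /Aop [RHS]exchange_big; apply: eq_bigr => i _.
  rewrite [RHS]exchange_big; apply: eq_bigr => l _.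
  by rewrite /patch mulr_sumr.
apply: eq_bigr => q _; rewrite /Aop /comm mulr_sumr -big_split; apply: eq_bigr => i _.
rewrite mulr_sumr -big_split; apply: eq_bigr => l _ /=.
by rewrite mulrCA -mulrDr addrC subrK.
Qed.

Lemma comm_le q phi j x : `|comm q phi j x| <=
  B * (k%:R * 2 ^+ k) * kappa * \sum_l \sum_(i < k.+1) `|phi l i x|.
Proof.
set H := \sum_l _.
have H0 : 0 <= H by do 2![apply: sumr_ge0 => ? _].
apply: (le_trans (ler_norm_sum _ _ _)).
apply: (@le_trans _ _ (\sum_(1 <= i < k.+1) B * 2 ^+ k * kappa * H)); last first.
  rewrite sumr_const_nat subn1/= -[leLHS]mulr_natl.
  by rewrite le_eqVlt; apply/orP; left; apply/eqP; move: k%:R (2 ^+ k) => p r; clear; ring.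
rewrite big_nat [leRHS]big_nat; apply: ler_sum => i /andP[i1 ik]; rewrite ltnS in ik.
apply: (le_trans (ler_norm_sum _ _ _)); rewrite mulr_sumr; apply: ler_sum => l _.
rewrite normrM -!mulrA; apply: ler_pM => //; first by apply: ab; rewrite i1.
apply: (@le_trans _ _ (2 ^+ i * kappa * \sum_(p < i) `|phi l p x|)).
  apply: jet_mul_comm_le => // p /andP[p0 pi]; apply: thk; rewrite p0/=.
  exact: leq_trans ik.
rewrite -mulrA; apply: ler_pM => //.
- by apply: mulr_ge0 => //; exact: sumr_ge0.
- by rewrite ler_eXn2l// ltr1n.
apply: ler_wpM2l => //.
rewrite -!(big_mkord xpredT (fun p => `|phi l p x|)) (@big_cat_nat _ _ _ i 0 k.+1)//=.
  by rewrite lerDl sumr_ge0.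
exact: leqW.
Qed.

Section Contraction.
Variables (f g : J -> R -> R) (s : R).
Hypotheses (lf : VL2 f) (lg : VL2 g) (s0 : 0 <= s) (s1 : s <= 1).
Hypotheses (fs : aeR (fun x => forall l, `|corr f l 0%N x| <= s))
  (gs : aeR (fun x => forall l, `|corr g l 0%N x| <= s)).

(** The three sources of error: commutators with the cutoffs, mismatch of the potentials, and the
    quadratic remainder of the nonlinearity. *)
Definition contr_const : R := B * (k%:R * 2 ^+ k) * kappa + eps + Lam * (#|J|%:R * s + #|J|%:R * s).

(** With [d] the local differences, [f - g] is the sum of [theta q] times the local operator applied
    to [d q]. Subtracting the change of [Fop], the leading parts cancel up to commutators, the
    linear parts up to the potential mismatch, and the Taylor remainder is left. *)
Lemma contr_pointwise : aeR (fun x => forall j, `|Phi f j x - Phi g j x| <=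
  contr_const * \sum_(t : idx) `|jets (diffS f g) t x|).
Proof.
have hL : aeR (fun x => forall q j,
    Lop (V q) (diffS f g q) j x = ind q x * (f j x - g j x)).
  by apply: aeR_forall_fin => q; apply: aeR_forall_fin => j; exact: Lop_diffS.
have hb : aeR (fun x => (forall l, `|corr f l 0%N x| <= s) /\ (forall l, `|corr g l 0%N x| <= s)).
  by apply: aeRS2 fs gs.
apply: aeRS3 hL hb (aeRS2 (fun x p q => conj p q) wrho potential) => x eL [hf hg] [hw hV] j.
rewrite (sum_jets (fun u => `|u x|)); set d := diffS f g.
pose z l := w l 0%N x; pose p l := corr f l 0%N x; pose q l := corr g l 0%N x.
pose rem := N (fun l => z l + p l) x j - N (fun l => z l + q l) x j
     - \sum_l DN z x j l * (p l - q l).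
have pq l : p l - q l = \sum_t theta t x * d t l 0%N x by rewrite /p /q corrB.
have E : Phi f j x - Phi g j x =
    \sum_t \sum_l (theta t x * (V t x j l - DN z x j l)) * d t l 0%N x
    - \sum_t comm t (d t) j x - rem.
  (* The identity [theta * ind = ind] replaces the sharp cut-off of the data by the smooth one in
     front of the local operators. *)
  have e1 : f j x - g j x = \sum_t theta t x * (Aop k a (d t) j x + \sum_l V t x j l * d t l 0%N x).
    rewrite -[LHS]mul1r -(ind1 x) mulr_suml; apply: eq_bigr => t _.
    by rewrite -thind -mulrA -eL.
  have e2 : Aop k a (corr f) j x - Aop k a (corr g) j x = Aop k a (patch d) j x.
    by rewrite -AopB /Aop; apply: eq_bigr => i _; apply: eq_bigr => l _; rewrite corrB.
  rewrite /Phi /Fop !AopD.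
  rewrite -/(p _) -/(q _).
  have e3 : \sum_l DN z x j l * (p l - q l) = \sum_t \sum_l theta t x * DN z x j l * d t l 0%N x.
    rewrite exchange_big; apply: eq_bigr => l _; rewrite pq mulr_sumr; apply: eq_bigr => t _.
    by rewrite mulrA [DN _ _ _ _ * _]mulrC.
  have e4 : \sum_t \sum_l (theta t x * (V t x j l - DN z x j l)) * d t l 0%N x =
      \sum_t theta t x * \sum_l V t x j l * d t l 0%N x - \sum_l DN z x j l * (p l - q l).
    rewrite e3 -sumrB; apply: eq_bigr => t _; rewrite mulr_sumr -sumrB; apply: eq_bigr => l _.
    by rewrite [theta t x * (_ - _)]mulrBr [LHS]mulrBl !mulrA.
  have e5 : \sum_t comm t (d t) j x = Aop k a (patch d) j x - \sum_t theta t x * Aop k a (d t) j x.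
    by rewrite Aop_patch big_split/= [RHS]addrC addKr.
  have e6 : f j x - g j x = \sum_t theta t x * Aop k a (d t) j x +
      \sum_t theta t x * \sum_l V t x j l * d t l 0%N x.
    by rewrite e1 -big_split; apply: eq_bigr => t _; rewrite mulrDr.
  rewrite e4 e5 /rem -e2.
  have -> : f j x = g j x + (\sum_t theta t x * Aop k a (d t) j x +
      \sum_t theta t x * \sum_l V t x j l * d t l 0%N x) by rewrite -e6 addrC subrK.
  rewrite -[N (fun l => w l 0%N x + corr f l 0%N x) x j]/(N (fun l => z l + p l) x j).
  rewrite -[N (fun l => w l 0%N x + corr g l 0%N x) x j]/(N (fun l => z l + q l) x j).
  move: (\sum_t theta t x * Aop k a (d t) j x) (\sum_t theta t x * \sum_l _) => y1 y2.
  move: (N _ _ _) (N _ _ _) => y3 y4.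
  move: (Aop _ _ _ _ _) (Aop _ _ _ _ _) (Aop _ _ _ _ _) (\sum_l _) (g j x) => y5 y6 y7 y8 y9.
  by clear; ring.
set H := \sum_q0 _.
have H0 : 0 <= H by do 3![apply: sumr_ge0 => ? _].
have b1 : `|\sum_t \sum_l (theta t x * (V t x j l - DN z x j l)) * d t l 0%N x| <= eps * H.
  apply: (le_trans (ler_norm_sum _ _ _)); rewrite mulr_sumr; apply: ler_sum => t _.
  apply: (le_trans (ler_norm_sum _ _ _)); rewrite mulr_sumr; apply: ler_sum => l _.
  rewrite normrM; apply: ler_pM; [by []|by []|exact: (hV t j l)|].
  by rewrite (bigD1 ord0)//= lerDl sumr_ge0.
have b2 : `|\sum_t comm t (d t) j x| <= B * (k%:R * 2 ^+ k) * kappa * H.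
  apply: (le_trans (ler_norm_sum _ _ _)); rewrite mulr_sumr; apply: ler_sum => t _.
  exact: comm_le.
have b3 : `|rem| <= Lam * (#|J|%:R * s + #|J|%:R * s) * H.
  apply: (le_trans (taylor x j hw (fun l => le_trans (hf l) s1) (fun l => le_trans (hg l) s1))).
  apply: ler_pM.
  - by rewrite mulr_ge0// addr_ge0// sumr_ge0.
  - exact: sumr_ge0.
  - by rewrite ler_wpM2l// lerD//; exact: ler_sum_card.
  rewrite /H exchange_big; apply: ler_sum => l _; rewrite pq.
  apply: (le_trans (ler_norm_sum _ _ _)); apply: ler_sum => t _.
  rewrite normrM; apply: (@le_trans _ _ `|d t l 0%N x|); first by rewrite ler_piMl.
  by rewrite (bigD1 ord0)//= lerDl sumr_ge0.
rewrite E /contr_const; apply: (le_trans (ler_normB _ _)).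
apply: (@le_trans _ _ (eps * H + B * (k%:R * 2 ^+ k) * kappa * H + `|rem|)).
  by rewrite lerD2r; apply: (le_trans (ler_normB _ _)); exact: lerD.
rewrite mulrDl mulrDl [_ * H + eps * H]addrC; exact: lerD.
Qed.

End Contraction.

Definition corr_const : R := patch_const * (#|Q|%:R * CS).

Definition lip_const : R := #|J|%:R * (2 ^+ size (index_enum idx) * (#|Q|%:R * CS)).

Lemma Aop_eq0 u v j x : (forall l i, (i <= k)%N -> v l i x = 0) ->
  Aop k a (fun l i y => u l i y + v l i y) j x = Aop k a u j x.
Proof.
move=> v0; rewrite AopD -[RHS]addr0; congr (_ + _).
rewrite /Aop big_nat big1// => i /andP[_ ik]; apply: big1 => l _.
by rewrite v0 ?mulr0.
Qed.

Let zero : J -> R -> R := fun _ _ => 0.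

Let VL2_zero : VL2 zero. Proof. by move=> j; exact: L2_cst0. Qed.

Let NN_zero : NN zero = 0.
Proof.
rewrite /NN big1// => j _; rewrite /nn; under eq_Rintegral do rewrite expr0n.
by rewrite Rintegral_cst// mul0r.
Qed.

(** Since [S] is only a choice, [corr zero] need not vanish identically; [stable] makes it vanish
    almost everywhere. *)
Lemma Phi_zero j : aeR (fun x => Phi zero j x = - Fop w j x).
Proof.
have h0 : HH k (corr zero) <= 0.
  by apply: (le_trans (corr_HH VL2_zero)); rewrite NN_zero mulr0.
have : aeR (fun x => forall l i, (i <= k)%N -> corr zero l i x = 0).
  apply: aeR_forall_fin => l; apply: aeR_forall_nat => i; apply: aeR_imp => ik.
  exact: HH_eq0 (corr_VHjet VL2_zero) h0 ik.
apply: aeRS => x hx; rewrite /Phi sub0r /Fop Aop_eq0//; congr (- (_ + N _ _ _)).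
by apply/funext => l; rewrite hx ?addr0.
Qed.

Lemma measurable_Phi f j : VL2 f -> measurable_fun setT (Phi f j).
Proof.
move=> lf; apply: measurable_funB; first exact: L2_measurable.
apply: measurable_Fop => l; apply: is_jetD => //.
by apply: is_hjet_jet; exact: corr_VHjet.
Qed.

Lemma L2_Phi_zero : VL2 (Phi zero).
Proof.
move=> j; apply: (L2_ae (f := fun x => - Fop w j x)); last 2 first.
- exact: measurable_Phi.
- by apply: aeRS (Phi_zero j) => x ->.
by have := L2Z (-1) (Fw j); under eq_fun do rewrite mulN1r.
Qed.

Lemma NN_Phi_zero : NN (Phi zero) = NN (Fop w).
Proof.
apply: eq_bigr => j _; rewrite (@nn_ae _ _ (fun x => - Fop w j x)).
- by rewrite /nn; apply: eq_Rintegral => x _; rewrite sqrrN.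
- exact: measurable_Phi.
- by apply: measurableT_comp => //; exact: measurable_Fop.
- exact: Phi_zero.
Qed.

(** The Taylor estimate needs a pointwise bound on the correction. Sobolev's inequality draws it
    from orders 0 and 1, each bounded by [HH], which explains the factor 2. *)
Lemma corr_sup Csob f r s : 0 <= s -> 0 <= Csob ->
  (forall u v, weak_derivative_real 1 u v -> L2 u -> L2 v ->
    aeR (fun x => u x ^+ 2 <= Csob * (nn u + nn v))) ->
  Csob * (2 * (corr_const * r)) <= s ^+ 2 -> VL2 f -> NN f <= r ->
  aeR (fun x => forall l, `|corr f l 0%N x| <= s).
Proof.
move=> s0 C0 hsob hs lf fr; apply: aeR_forall_fin => l.
have [lc wc] := corr_VHjet lf l.
apply: aeRS (hsob _ _ (wc 0%N k0) (lc 0%N isT) (lc 1%N k0)) => x hx.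
rewrite -ler_sqr ?nnegrE// real_normK ?num_real//; apply: (le_trans hx).
apply: le_trans hs; apply: ler_wpM2l => //.
have hH : HH k (corr f) <= corr_const * r.
  apply: (le_trans (corr_HH lf)); rewrite ler_wpM2l// mulr_ge0 ?patch_const_ge0//.
  exact: mulr_ge0.
by rewrite mulr_natl mulr2n; apply: lerD; apply: le_trans hH; apply: nn_le_HH.
Qed.

Lemma glue_solution Csob r s eta : 0 <= s -> s <= 1 -> 0 <= Csob ->
  (forall u v, weak_derivative_real 1 u v -> L2 u -> L2 v ->
    aeR (fun x => u x ^+ 2 <= Csob * (nn u + nn v))) ->
  Csob * (2 * (corr_const * r)) <= s ^+ 2 ->
  contr_const s <= eta -> eta ^+ 2 * lip_const <= 16^-1 ->
  8 * NN (Fop w) <= r ->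
  exists b, [/\ VHjet k b, HH k b <= corr_const * (8 * NN (Fop w)) &
    forall j, aeR (fun x => Fop (fun l i y => w l i y + b l i y) j x = 0)].
Proof.
move=> s0 s1 C0 hsob hs heta hlip hr.
have sup f (lf : VL2 f) (fr : NN f <= r) := corr_sup s0 C0 hsob hs lf fr.
have r0 : 0 <= r by apply: le_trans hr; rewrite mulr_ge0// NN_ge0.
have dom f g : VL2 f -> VL2 g -> NN f <= r -> NN g <= r -> forall j,
    aeR (fun x => `|Phi f j x - Phi g j x| <= eta * \sum_(t : idx) `|jets (diffS f g) t x|).
  move=> lf lg fr gr j; have H := contr_pointwise lf lg s1 (sup f lf fr) (sup g lg gr).
  apply: aeRS H => x /(_ j) /le_trans; apply; apply: ler_wpM2r => //; exact: sumr_ge0.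
have mPB f g j : VL2 f -> VL2 g -> measurable_fun setT (fun x => Phi f j x - Phi g j x).
  by move=> lf lg; apply: measurable_funB; exact: measurable_Phi.
have lJ f g : VL2 f -> VL2 g -> forall t, L2 (jets (diffS f g) t).
  by move=> lf lg; apply: jets_L2 => q; exact: VHjet_diffS.
(* [Phi f] lies in L2 as a perturbation of [Phi zero], which is minus the residual of [w] almost
   everywhere. *)
have Phi_L2 f : VL2 f -> NN f <= r -> VL2 (Phi f).
  move=> lf fr j; have z0 : NN zero <= r by rewrite NN_zero.
  have := L2D (L2_dom (mPB _ _ j lf VL2_zero) (lJ _ _ lf VL2_zero) (dom _ _ lf VL2_zero fr z0 j))
    (L2_Phi_zero j).
  by under eq_fun do rewrite subrK.
have [||||f [lf f8 ff]] := @contraction_fixpoint R J Phi (NN (Fop w)) r Phi_L2.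
- exact: NN_ge0.
- exact: hr.
- move=> f g lf lg fr gr.
  apply: (@le_trans _ _ (#|J|%:R * (eta ^+ 2 * 2 ^+ size (index_enum idx) *
      \sum_q HH k (diffS f g q)))).
    rewrite -sum_nn_jets; apply: ler_sum_card => j.
    by apply: nn_dom; [exact: mPB|exact: lJ|exact: dom].
  have hq : \sum_q HH k (diffS f g q) <= #|Q|%:R * (CS * NN (fun j x => f j x - g j x)).
    by apply: ler_sum_card => q; exact: diffS_HH.
  apply: (@le_trans _ _ (eta ^+ 2 * lip_const * NN (fun j x => f j x - g j x))).
    have -> : eta ^+ 2 * lip_const * NN (fun j x => f j x - g j x) =
      #|J|%:R * (eta ^+ 2 * 2 ^+ size (index_enum idx) *
        (#|Q|%:R * (CS * NN (fun j x => f j x - g j x)))).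
      rewrite /lip_const; move: (NN _) (_ %:R) (_%:R) (2 ^+ _) => p q t u.
      by clear; ring.
    apply: ler_wpM2l => //; apply: ler_wpM2l => //.
    by rewrite mulr_ge0 ?sqr_ge0// exprn_ge0.
  by apply: ler_wpM2r => //; exact: NN_ge0.
- by rewrite NN_Phi_zero.
exists (corr f); split; first exact: corr_VHjet.
  apply: (le_trans (corr_HH lf)); apply: ler_wpM2l => //.
  by rewrite mulr_ge0 ?patch_const_ge0// mulr_ge0.
move=> j; apply: aeRS (ff j) => x; rewrite /Phi => /eqP.
by rewrite subr_eq addrC -subr_eq subrr eq_sym => /eqP.
Qed.

End Configuration.

(** The constants are fixed before the configuration and hence are uniform in it. They are chosen
    backwards: [eta] for the contraction, then the sup bound [s], then the radius [r], then
    [kappa]. *)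
Lemma gluing : exists2 kappa : R, 0 < kappa & exists2 C : R, 0 < C &
  forall (V : Q -> R -> J -> J -> R) (ind theta : Q -> R -> R) (w : J -> nat -> R -> R),
  (forall q f, VL2 f -> exists2 phi, VHjet k phi &
    forall j, aeR (fun x => Lop (V q) phi j x = f j x)) ->
  (forall q phi f, VHjet k phi -> VL2 f ->
    (forall j, aeR (fun x => Lop (V q) phi j x = f j x)) -> HH k phi <= CS * NN f) ->
  (forall q, measurable_fun setT (ind q)) -> (forall q x, 0 <= ind q x <= 1) ->
  (forall x, \sum_q ind q x = 1) ->
  (forall q, smooth (theta q)) -> (forall q x, `|theta q x| <= 1) ->
  (forall q i x, (0 < i <= k)%N -> `|derive1n i (theta q) x| <= kappa) ->
  (forall q x, theta q x * ind q x = ind q x) ->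
  (forall j, is_jet k (w j)) -> aeR (fun x => forall j, `|w j 0%N x| <= rho) ->
  VL2 (Fop w) -> NN (Fop w) <= kappa ->
  aeR (fun x => forall q j l,
    `|theta q x * (V q x j l - DN (fun l => w l 0%N x) x j l)| <= kappa) ->
  exists b, [/\ VHjet k b, HH k b <= C * NN (Fop w) &
    forall j, aeR (fun x => Fop (fun l i y => w l i y + b l i y) j x = 0)].
Proof.
have [Csob Csob0 hsob] := sobolev_sup sh.
pose C3 := lip_const; pose C4 := corr_const.
have C30 : 0 <= C3 by rewrite /C3 /lip_const !mulr_ge0// exprn_ge0.
have C40 : 0 <= C4 by rewrite /C4 /corr_const !mulr_ge0// ?patch_const_ge0// sqr_ge0.
(* Then [eta ^+ 2 * C3 = C3 / (16 * (C3 + 1) ^+ 2)], which is at most 1/16. *)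
pose eta := (4 * (C3 + 1))^-1.
have eta0 : 0 < eta by rewrite invr_gt0 mulr_gt0// ltr_wpDl.
have eta16 : eta ^+ 2 * C3 <= 16^-1.
  have d0 : 0 < 16 * (C3 + 1) ^+ 2 by rewrite mulr_gt0// exprn_gt0// ltr_wpDl.
  have -> : eta ^+ 2 * C3 = C3 / (16 * (C3 + 1) ^+ 2).
    by rewrite /eta exprVn mulrC exprMn -natrX.
  rewrite ler_pdivrMr// mulrA mulVf// mul1r.
  exact: le_sqr_addr1.
pose c5 := 3 * (Lam * (#|J|%:R + #|J|%:R) + 1).
have c50 : 0 < c5 by rewrite mulr_gt0// ltr_wpDl// mulr_ge0// addr_ge0.
pose s := Num.min 1 (eta / c5).
have s0 : 0 < s by rewrite lt_min ltr01 divr_gt0.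
have s1 : s <= 1 by rewrite ge_min lexx.
have sc : s * c5 <= eta by rewrite -ler_pdivlMr// ge_min lexx orbT.
(* The largest ball for which [corr_sup] returns the sup bound [s], with [C4 + 1] to avoid division
   by 0. *)
pose r := s ^+ 2 / (Csob * (2 * (C4 + 1))).
have d0 : 0 < Csob * (2 * (C4 + 1)) by rewrite !mulr_gt0// ltr_wpDl.
have r0 : 0 < r by rewrite divr_gt0// exprn_gt0.
have hs : Csob * (2 * (C4 * r)) <= s ^+ 2.
  have -> : s ^+ 2 = Csob * (2 * ((C4 + 1) * r)).
    by rewrite [in RHS](mulrA 2) [in RHS]mulrA mulrC divfK// gt_eqF.
  by rewrite ler_pM2l// ler_pM2l// ler_pM2r// lerDl.
pose c1 := B * (k%:R * 2 ^+ k).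
have c10 : 0 <= c1 by rewrite /c1 !mulr_ge0// exprn_ge0.
(* [r / 8] keeps 8 times the residual inside the ball of radius [r]; the last entry is the budget
   for commutators and potentials. *)
pose kappa := Num.min (Num.min 1 (r / 8)) (eta / (3 * (c1 + 1))).
have e31 : 0 < 3 * (c1 + 1) by rewrite mulr_gt0// ltr_wpDl.
have kappa0 : 0 < kappa.
  by rewrite !lt_min ltr01 (divr_gt0 eta0 e31) andbT (divr_gt0 r0).
have kappa1 : kappa <= 1 by rewrite !ge_min lexx.
have kappar : 8 * kappa <= r.
  by rewrite mulrC -ler_pdivlMr// !ge_min lexx ?orbT.
have kappae : kappa * (3 * (c1 + 1)) <= eta by rewrite -ler_pdivlMr// !ge_min lexx ?orbT.
exists kappa => //; exists (C4 * 8 + 1); first by rewrite ltr_wpDl// mulr_ge0.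
move=> V ind theta w hsolv hstab hmi hi01 hi1 hst hth1 hthk hthi hjw hwr hFw hNF hpot.
have hcc : contr_const kappa kappa s <= eta.
  by rewrite /contr_const -/c1; apply: contraction_budget => //; exact: ltW.
have h8 : 8 * NN (Fop w) <= r by apply: le_trans kappar; rewrite ler_pM2l.
have [b [hb1 hb2 hb3]] := glue_solution (ltW kappa0) kappa1 hsolv hstab hmi hi01 hi1 hst hth1
  hthk hthi hjw hwr hFw hpot (ltW s0) s1 (ltW Csob0) hsob hs hcc eta16 h8.
exists b; split => //; apply: (le_trans hb2).
by rewrite mulrA ler_wpM2r ?NN_ge0// lerDl.
Qed.

End GluingData.

(** * Residual of the superposed fronts *)

Section Fronts.
Context {R : realType} (h : R -> R) (sh : step_function h) (h' : R -> R).
Context (k M : nat) (ell K : R) (chi : nat -> R -> R).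
Context (Z Pp Pm : nat -> nat -> R -> R) (vp vm : nat -> R -> R).
Hypotheses (sh' : smooth h') (h'1 : forall x, x <= -1 -> h' x = 1).
Hypotheses (ell4 : 4 < ell) (K0 : 0 <= K).

Definition pos (j : nat) : R := j%:R * ell.
(** Left end of the cell of the front [j], halfway between [pos j.-1] and [pos j]; the right end is
    [lb j.+1]. *)
Definition lb (j : nat) : R := (j%:R - 1 / 2) * ell.

(** The cell widened by [d]; the first and the last one are unbounded to the left and to the
    right. *)
Definition cell (d : R) (j : nat) (x : R) :=
  ((j != 1)%N -> lb j - d <= x) /\ (j != M -> x <= lb j.+1 + d).

Hypothesis schi : forall j, (1 <= j <= M)%N -> smooth (chi j).
Hypothesis chi1 : forall x, \sum_(j < M) chi j.+1 x = 1.
Hypothesis chiK : forall j i x, (1 <= j <= M)%N -> (i <= k)%N -> `|derive1n i (chi j) x| <= K.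
Hypothesis window : forall j x, (1 <= j <= M)%N -> chi j x != 0 ->
  ((j != 1)%N -> lb j - 1 < x) /\ (j != M -> x < lb j.+1 + 1).
Hypothesis jZ : forall j, (1 <= j <= M)%N -> is_jet k (Z j).
Hypothesis jPp : forall j, (1 <= j <= M)%N -> is_jet k (Pp j).
Hypothesis jPm : forall j, (1 <= j <= M)%N -> is_jet k (Pm j).
Hypothesis Pp0 : forall j, (1 <= j <= M)%N -> aeR (fun x => Pp j 0%N x = h x * (Z j 0%N x - vp j x)).
Hypothesis Pm0 : forall j, (1 <= j <= M)%N -> aeR (fun x => Pm j 0%N x = h' x * (Z j 0%N x - vm j x)).
Hypothesis vpm : forall j, (1 <= j < M)%N -> aeR (fun x => vp j x = vm j.+1 (x - ell)).

Definition front (j p : nat) (x : R) : R := Z j p (x - pos j).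

Definition fronts (p : nat) (x : R) : R :=
  \sum_(j < M) jet_mul (chi j.+1) (front j.+1) p x.

Lemma front_jet j : (1 <= j <= M)%N -> is_jet k (front j).
Proof. by move=> hj; apply: is_jet_shift; exact: jZ. Qed.

Lemma ord_front (j : 'I_M) : (1 <= j.+1 <= M)%N.
Proof. by rewrite /= ltn_ord. Qed.

Lemma fronts_jet : is_jet k fronts.
Proof.
apply: is_jet_sum => j; apply: is_jet_mul; first exact: schi (ord_front j).
exact: front_jet (ord_front j).
Qed.

Lemma pos_succ j : pos j.+1 = pos j + ell.
Proof. by rewrite /pos -natr1 mulrDl mul1r. Qed.

Lemma lbE j : lb j = pos j - ell / 2.
Proof. by rewrite /lb /pos mulrBl mulrAC mul1r. Qed.

Lemma smooth_translate f c : smooth f -> smooth (fun y : R => f (y - c)).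
Proof.
move=> sf; have := @smooth_affine R f 1 (- c) sf.
by under eq_fun do rewrite mul1r.
Qed.

Lemma derive1n_translate_const f c i (x b : R) :
  (\forall y \near x, f (y - c) = b) -> derive1n i.+1 (fun y : R => f (y - c)) x = 0.
Proof.
move=> H; have := derive1n_near i.+1 (g := fun=> b) H.
by rewrite derive1nSr_cst => /nbhs_singleton.
Qed.

(** Multiplied by both cutoffs, the identity for the values holds almost everywhere on the whole
    line, because the end states cancel. Uniqueness of weak derivatives carries it to all orders,
    and between the fronts the cutoffs are locally 1 and drop out. *)
Lemma middle_jets j : (1 <= j < M)%N -> aeR (fun x => forall p, (p <= k)%N ->
  pos j + 1 < x -> x < pos j.+1 - 1 ->
  front j.+1 p x - front j p x = Pm j.+1 p (x - pos j.+1) - Pp j p (x - pos j)).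
Proof.
move=> /andP[j1 jM].
have hj : (1 <= j <= M)%N by rewrite j1 ltnW.
have hj' : (1 <= j.+1 <= M)%N by [].
have sh1 : smooth h by case: sh.
have h1 : forall x, 1 <= x -> h x = 1 by case: sh.
pose c1 x := h (x - pos j); pose c2 x := h' (x - pos j.+1).
have sc1 : smooth c1 by exact: smooth_translate.
have sc2 : smooth c2 by exact: smooth_translate.
pose D p x := front j.+1 p x - front j p x.
pose Sm p x := Pm j.+1 p (x - pos j.+1); pose Sp p x := Pp j p (x - pos j).
have jD : is_jet k D by apply: is_jetB; exact: front_jet.
have jSm : is_jet k Sm by apply: is_jet_shift; exact: jPm.
have jSp : is_jet k Sp by apply: is_jet_shift; exact: jPp.
pose A := jet_mul c1 (jet_mul c2 D).
pose B p x := jet_mul c1 Sm p x - jet_mul c2 Sp p x.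
have jA : is_jet k A by do 2!apply: is_jet_mul => //.
have jB : is_jet k B by apply: is_jetB; exact: is_jet_mul.
have AB : aeR (fun x => A 0%N x = B 0%N x).
  apply: aeRS3 (negligible_shift (- pos j.+1) (Pm0 hj')) (negligible_shift (- pos j) (Pp0 hj))
    (negligible_shift (- pos j) (vpm (j := j) _)); last by rewrite j1.
  move=> x e1 e2 e3; rewrite /A /B /= /Sm /Sp e1 e2 e3 /D /front /c1 /c2.
  have -> : x - pos j - ell = x - pos j.+1 by rewrite pos_succ opprD addrA.
  move: (h _) (h' _) (Z _ _ _) (Z _ _ _) (vm _ _) => y1 y2 y3 y4 y5.
  by clear; ring.
apply: aeRS (aeR_forall_nat (fun p => aeR_imp (is_jet_uniq sh jA jB AB (i := p)))).
move=> x hx p pk x1 x2.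
have n1 q : derive1n q.+1 c1 x = 0.
  apply: (@derive1n_translate_const h _ _ _ 1).
  have : \forall y \near x, pos j + 1 < y by apply: lt_nbhsr.
  by apply: filterS => y y1; apply: h1; rewrite lerBrDl ltW.
have n2 q : derive1n q.+1 c2 x = 0.
  apply: (@derive1n_translate_const h' _ _ _ 1).
  have : \forall y \near x, y < pos j.+1 - 1 by apply: lt_nbhsl.
  by apply: filterS => y y1; apply: h'1; rewrite lerBlDl ltW.
have v1 : c1 x = 1 by apply: h1; rewrite lerBrDl ltW.
have v2 : c2 x = 1 by apply: h'1; rewrite lerBlDl ltW.
have := hx p pk; rewrite /A /B.
do 3!(rewrite jet_mul_const; last by case).
by rewrite jet_mul_const ?v1 ?v2 ?mul1r//; case.
Qed.

Definition far (d y : R) : R := (ell / 2 - 1 - d < `|y|)%R%:R.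

Definition tails (d : R) (t q : nat) (x : R) : R :=
  far d (x - pos t) * (`|Pp t q (x - pos t)| + `|Pm t q (x - pos t)|).

Lemma tails_ge0 d t q x : 0 <= tails d t q x.
Proof. by rewrite mulr_ge0// addr_ge0. Qed.

Lemma derive1n_off j i x : (1 <= j <= M)%N ->
  ((j != 1)%N && (x < lb j - 1)) || ((j != M) && (lb j.+1 + 1 < x)) ->
  derive1n i (chi j) x = 0.
Proof.
move=> hj off.
have : \forall y \near x, chi j y = 0.
  case/orP: off => /andP[j1 xb].
    have : \forall y \near x, y < lb j - 1 by apply: lt_nbhsl.
    apply: filterS => y yb; apply/eqP/negPn/negP => /(window hj)[/(_ j1) + _].
    by move=> /(lt_trans yb); rewrite ltxx.
  have : \forall y \near x, lb j.+1 + 1 < y by apply: lt_nbhsr.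
  apply: filterS => y yb; apply/eqP/negPn/negP => /(window hj)[_ /(_ j1)].
  by move=> /(lt_trans yb); rewrite ltxx.
move=> /(derive1n_near i (g := fun=> 0)) /nbhs_singleton ->.
by case: i => // i; rewrite derive1nSr_cst.
Qed.

Lemma aeR_neq (c : R) : aeR (fun x => x != c).
Proof.
exists [set c]; split => //; first exact: lebesgue_measure_set1.
by move=> x /= /negP/negPn/eqP.
Qed.

Lemma tails_pair d j p x : (1 <= j < M)%N -> ell / 2 - 1 - d < `|x - pos j| ->
  ell / 2 - 1 - d < `|x - pos j.+1| ->
  front j.+1 p x - front j p x = Pm j.+1 p (x - pos j.+1) - Pp j p (x - pos j) ->
  `|front j.+1 p x - front j p x| <= 2 * \sum_(t < M) tails d t.+1 p x.
Proof.
move=> /andP[j1 jM] f1 f2 ->; apply: (le_trans (ler_normB _ _)).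
rewrite mulr_natl mulr2n; apply: lerD.
  rewrite (bigD1 (Ordinal jM))//= ler_wpDr ?sumr_ge0//; first by move=> *; exact: tails_ge0.
  by rewrite /tails /far f2 mul1r lerDr.
have jM' : (j.-1 < M)%N by apply: leq_ltn_trans jM; exact: leq_pred.
rewrite (bigD1 (Ordinal jM'))//= ler_wpDr ?sumr_ge0//; first by move=> *; exact: tails_ge0.
by rewrite prednK// /tails /far f1 mul1r lerDl.
Qed.

Lemma natr_gap (i j : nat) : (i.+1 < j)%N -> lb i.+1 + ell <= lb j.
Proof.
move=> ij; rewrite /lb -[X in _ + X]mul1r -mulrDl ler_wpM2r ?(le_trans _ (ltW ell4))//.
by rewrite addrAC lerD2r natr1 ler_nat.
Qed.

(** On the widened cell of the front [j] only the cutoffs of [j] and its neighbours are active, and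
    the neighbours are active only where both fronts are near their common end state. *)
Lemma fronts_close d : 0 <= d -> d <= ell / 4 ->
  aeR (fun x => forall j p, (1 <= j <= M)%N -> (p <= k)%N -> cell d j x ->
    `|fronts p x - front j p x| <=
      M%:R * (2 ^+ k * K * (2 * \sum_(q < p.+1) \sum_(t < M) tails d t.+1 q x))).
Proof.
move=> d0 dl.
have mid : aeR (fun x => forall j, (1 <= j < M)%N -> forall p, (p <= k)%N ->
    pos j + 1 < x -> x < pos j.+1 - 1 ->
    front j.+1 p x - front j p x = Pm j.+1 p (x - pos j.+1) - Pp j p (x - pos j)).
  by apply: aeR_forall_nat => j; apply: aeR_imp; exact: middle_jets.
(* Being inside and being outside a window are both expressed by strict inequalities; the border
   points in between form a null set. *)
have bd : aeR (fun x => forall j, x != lb j - 1 /\ x != lb j.+1 + 1).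
  apply: aeR_forall_nat => j.
  by apply: aeRS2 (aeR_neq (lb j - 1)) (aeR_neq (lb j.+1 + 1)) => x.
apply: aeRS2 mid bd => x mid bd j p hj pk [cl cr].
(* The cutoffs sum to 1, so [front j] can be subtracted inside the sum and only differences of
   fronts remain. *)
have -> : fronts p x - front j p x =
    \sum_(i < M) jet_mul (chi i.+1) (fun q y => front i.+1 q y - front j q y) p x.
  under [RHS]eq_bigr do rewrite jet_mulB.
  rewrite sumrB jet_mul_partition; [by []| |exact: chi1].
  by move=> i; exact: schi (ord_front i).
apply: (le_trans (ler_norm_sum _ _ _)).
have -> : (M%:R : R) = #|'I_M|%:R by rewrite card_ord.
apply: ler_sum_card => i; set S := \sum_(q < p.+1) _.
have S0 : 0 <= S by do 2![apply: sumr_ge0 => ? _]; exact: tails_ge0.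
have R0 : 0 <= 2 ^+ k * K * (2 * S) by rewrite !mulr_ge0// exprn_ge0.
have hi := ord_front i; move: (i.+1) hi => {}i hi.
pose off := ((i != 1)%N && (x < lb i - 1)) || ((i != M) && (lb i.+1 + 1 < x)).
have [hoff|hon] := boolP off.
  rewrite jet_mul_const; last by move=> q _; exact: derive1n_off.
  by have := derive1n_off 0 hi hoff; rewrite /= => ->; rewrite mul0r normr0.
have onl : (i != 1)%N -> lb i - 1 < x.
  move: hon; rewrite negb_or => /andP[+ _] i1; rewrite i1/= -leNgt.
  by rewrite le_eqVlt eq_sym (negbTE (proj1 (bd i))).
have onr : i != M -> x < lb i.+1 + 1.
  move: hon; rewrite negb_or => /andP[_ +] iM; rewrite iM/= -leNgt.
  by rewrite le_eqVlt (negbTE (proj2 (bd i))).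
apply: (@le_trans _ _ (2 ^+ p * K * \sum_(q < p.+1) `|front i q x - front j q x|)).
  by apply: jet_mul_le => q qp; apply: chiK => //; exact: leq_trans pk.
apply: ler_pM; first by rewrite mulr_ge0// exprn_ge0.
- exact: sumr_ge0.
- by rewrite ler_wpM2r// ler_eXn2l// ltr1n.
rewrite /S mulr_sumr; apply: ler_sum => q _.
have qk : (q <= k)%N by apply: leq_trans pk; rewrite -ltnS.
have T0 : 0 <= 2 * \sum_(t < M) tails d t.+1 q x.
  by rewrite mulr_ge0// sumr_ge0// => *; exact: tails_ge0.
have [i1 iM] := andP hi; have [j1 jM] := andP hj.
have [ij|ji|->] := ltngtP i j; last by rewrite subrr normr0.
- have iM' : i != M by rewrite neq_ltn (leq_trans ij jM).
  have j1' : (j != 1)%N by rewrite neq_ltn (leq_ltn_trans i1 ij) orbT.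
  have hr := onr iM'; have hl := cl j1'.
  (* A front that is not adjacent would put a full length [ell] between its window and the widened
     cell, more than the margins [d + 1] allow. *)
  have eij : j = i.+1.
    apply/eqP; rewrite eqn_leq ij andbT leqNgt; apply/negP => /natr_gap g.
    by move: g hr hl dl ell4; lra.
  move: hr hl; rewrite eij !lbE pos_succ => hr hl.
  have hiM : (1 <= i < M)%N by rewrite i1 (leq_trans ij jM).
  rewrite distrC; apply: tails_pair => //.
  + apply: (lt_le_trans _ (ler_norm _)).
    by move: hr hl dl ell4; lra.
  + rewrite -normrN; apply: (lt_le_trans _ (ler_norm _)); rewrite pos_succ.
    by move: hr hl dl d0 ell4; lra.
  + apply: mid => //; rewrite ?pos_succ; move: hr hl dl d0 ell4; lra.
- have iM' : j != M by rewrite neq_ltn (leq_trans ji iM).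
  have j1' : (i != 1)%N by rewrite neq_ltn (leq_ltn_trans j1 ji) orbT.
  have hl := onl j1'; have hr := cr iM'.
  have eij : i = j.+1.
    apply/eqP; rewrite eqn_leq ji andbT leqNgt; apply/negP => /natr_gap g.
    by move: g hr hl dl ell4; lra.
  move: hr hl; rewrite eij !lbE pos_succ => hr hl.
  have hiM : (1 <= j < M)%N by rewrite j1 (leq_trans ji iM).
  apply: tails_pair => //.
  + apply: (lt_le_trans _ (ler_norm _)).
    by move: hr hl dl d0 ell4; lra.
  + rewrite -normrN; apply: (lt_le_trans _ (ler_norm _)); rewrite pos_succ.
    by move: hr hl dl d0 ell4; lra.
  + apply: mid => //; rewrite ?pos_succ; move: hr hl dl d0 ell4; lra.
Qed.

End Fronts.

(** * The correction of the superposed fronts *)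

Section Tail.
Context {R : realType}.
Local Notation mu := (@lebesgue_measure R).
Implicit Types (f : R -> R) (r : R).

Definition tail r f : R := \int[mu]_(x in outside r) (f x ^+ 2).

Definition cut_off r f : R -> R := fun y => (r < `|y|)%R%:R * f y.

Lemma cut_offE r f : cut_off r f = f \_ (outside r).
Proof.
apply/funext => x; rewrite /cut_off patchE; case: ifPn.
  by rewrite inE /outside /= in_itv/= -ler_norml => /negP; rewrite -ltNge => ->; rewrite mul1r.
rewrite notin_setE /outside /= => /contrapT; rewrite in_itv/= -ler_norml leNgt => /negbTE ->.
by rewrite mul0r.
Qed.

Lemma cut_off_L2 r f : L2 f -> L2 (cut_off r f).
Proof.
move=> lf; apply: (L2_dom1 (g := f) (c := 1)) => //.
  rewrite cut_offE; apply/(measurable_restrictT _ _).1.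
    exact: measurable_outside.
  by apply: measurable_funTS; exact: L2_measurable.
apply: aeR_all => x; rewrite /cut_off normrM ler_wpM2r// ger0_norm//.
by case: (_ < _).
Qed.

Lemma nn_cut_off r f : nn (cut_off r f) = tail r f.
Proof.
rewrite /nn /tail [RHS]Rintegral_mkcond cut_offE; apply: eq_Rintegral => x _.
by rewrite !patchE; case: ifP => // _; rewrite expr0n.
Qed.

Lemma tail_ge0 r f : 0 <= tail r f.
Proof. by rewrite -nn_cut_off nn_ge0. Qed.

Lemma tail_small f e : L2 f -> 0 < e -> exists2 r0 : R, 0 < r0 &
  forall r, r0 <= r -> tail r f <= e.
Proof.
move=> lf e0; have [r0 r00 H] := L2_tail lf e0; exists r0 => // r /H.
rewrite /tail /Rintegral; move: (integral _ _ _) => [x||]//=.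
by move=> _; exact: ltW.
Qed.

Lemma common_radius (I : finType) (P : I -> R -> Prop) :
  (forall i, exists2 r0 : R, 0 < r0 & forall r, r0 <= r -> P i r) ->
  exists2 r0 : R, 0 < r0 & forall r, r0 <= r -> forall i, P i r.
Proof.
move=> /fin_all_exists2[r0 r00 H]; exists (1 + \sum_i r0 i).
  by rewrite ltr_pwDl// sumr_ge0// => i _; exact: ltW.
move=> r rr i; apply: H; apply: le_trans rr; rewrite (bigD1 i)//=.
by rewrite addrCA lerDl addr_ge0// sumr_ge0// => *; exact: ltW.
Qed.

End Tail.

Lemma mul_div_addr1_le (R : realFieldType) (c e : R) : 0 <= c -> 0 <= e -> c * (e / (c + 1)) <= e.
Proof.
move=> c0 e0; rewrite mulrCA ler_piMr// ler_pdivrMr ?mul1r ?lerDl//.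
by rewrite ltr_wpDl.
Qed.

Section Correction.
Context {R : realType} {J : finType} (h : R -> R) (sh : step_function h) (h' : R -> R).
Context (k M : nat) (T K : R) (a : nat -> R -> J -> J -> R) (B Lam rho CS : R).
Context (N : (J -> R) -> R -> J -> R) (DN : (J -> R) -> R -> J -> J -> R).
Context (Z Pp Pm : nat -> J -> nat -> R -> R) (vp vm : nat -> J -> R -> R)
  (chi : nat -> nat -> R -> R).
Hypotheses (k0 : (0 < k)%N) (B0 : 0 <= B) (Lam0 : 0 <= Lam) (CS0 : 0 <= CS) (T0 : 0 < T)
  (K0 : 0 <= K) (M0 : (0 < M)%N).
Hypotheses (sh' : smooth h') (h'1 : forall x, x <= -1 -> h' x = 1).
Hypothesis ma : forall i j l, (1 <= i <= k)%N -> measurable_fun setT (fun x => a i x j l).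
Hypothesis ab : coefs_bounded k a B.
Hypothesis mN : forall U : J -> R -> R, (forall j, measurable_fun setT (U j)) ->
  forall j, measurable_fun setT (fun x => N (fun l => U l x) x j).
Hypothesis taylor : forall (z p q : J -> R) x j, (forall j, `|z j| <= rho) ->
  (forall j, `|p j| <= 1) -> (forall j, `|q j| <= 1) ->
  `|N (fun l => z l + p l) x j - N (fun l => z l + q l) x j
     - \sum_l DN z x j l * (p l - q l)| <=
  Lam * (\sum_l `|p l| + \sum_l `|q l|) * \sum_l `|p l - q l|.
Hypothesis Nlip : forall (z z' : J -> R) x j, (forall j, `|z j| <= rho) ->
  (forall j, `|z' j| <= rho) -> `|N z x j - N z' x j| <= Lam * \sum_l `|z l - z' l|.
Hypothesis DNlip : forall (z z' : J -> R) x i j, (forall j, `|z j| <= rho) ->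
  (forall j, `|z' j| <= rho) -> `|DN z x i j - DN z' x i j| <= Lam * \sum_l `|z l - z' l|.
Hypothesis aper : forall i x, (1 <= i <= k)%N -> a i (x + T) = a i x.
Hypothesis Nper : forall z x, N z (x + T) = N z x.
Hypothesis DNper : forall z x, DN z (x + T) = DN z x.
Hypothesis schi : forall n j, (0 < n)%N -> (1 <= j <= M)%N -> smooth (chi n j).
Hypothesis chi01 : forall n j x, (0 < n)%N -> (1 <= j <= M)%N -> 0 <= chi n j x.
Hypothesis chi1 : forall n x, (0 < n)%N -> \sum_(j < M) chi n j.+1 x = 1.
Hypothesis chiK : forall n j i x, (0 < n)%N -> (1 <= j <= M)%N -> (i <= k)%N ->
  `|derive1n i (chi n j) x| <= K.
Hypothesis window : forall n j x, (0 < n)%N -> (1 <= j <= M)%N -> chi n j x != 0 ->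
  ((j != 1)%N -> lb (n%:R * T) j - 1 < x) /\ (j != M -> x < lb (n%:R * T) j.+1 + 1).
Hypothesis jZ : forall j, (1 <= j <= M)%N -> forall l, is_jet k (Z j l).
Hypothesis Zrho : forall j, (1 <= j <= M)%N -> aeR (fun x => forall l, `|Z j l 0%N x| <= rho).
Hypothesis Zsol : forall j, (1 <= j <= M)%N -> aeR (fun x => forall l, Fop k a N (Z j) l x = 0).
Hypothesis hPp : forall j, (1 <= j <= M)%N -> VHjet k (Pp j).
Hypothesis hPm : forall j, (1 <= j <= M)%N -> VHjet k (Pm j).
Hypothesis Pp0 : forall j, (1 <= j <= M)%N -> forall l,
  aeR (fun x => Pp j l 0%N x = h x * (Z j l 0%N x - vp j l x)).
Hypothesis Pm0 : forall j, (1 <= j <= M)%N -> forall l,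
  aeR (fun x => Pm j l 0%N x = h' x * (Z j l 0%N x - vm j l x)).
Hypothesis vpm : forall j, (1 <= j < M)%N -> forall l, aeR (fun x => vp j l x = vm j.+1 l x).
Hypothesis vper : forall j, (1 <= j <= M)%N -> forall l, aeR (fun x => vm j l (x + T) = vm j l x).
Hypothesis solvable : forall j f, (1 <= j <= M)%N -> VL2 f -> exists2 phi, VHjet k phi &
  forall l, aeR (fun x => Lop k a (fun y => DN (fun l => Z j l 0%N y) y) phi l x = f l x).
Hypothesis stable : forall j phi f, (1 <= j <= M)%N -> VHjet k phi -> VL2 f ->
  (forall l, aeR (fun x => Lop k a (fun y => DN (fun l => Z j l 0%N y) y) phi l x = f l x)) ->
  HH k phi <= CS * NN f.

Lemma vm_periodic j n l : (1 <= j <= M)%N ->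
  aeR (fun x => vm j l (x - n%:R * T) = vm j l x).
Proof.
move=> hj; elim: n => [|n IH].
  by apply: aeR_all => x; rewrite mul0r subr0.
have := negligible_shift (- (n.+1%:R * T)) (vper hj l).
apply: aeRS2 IH => x <- <-; congr (vm j l _).
by rewrite -natr1 mulrDl mul1r opprD -addrA addrNK.
Qed.

Lemma vp_vm j n l : (1 <= j < M)%N -> aeR (fun x => vp j l x = vm j.+1 l (x - n%:R * T)).
Proof.
move=> hj; have hj' : (1 <= j.+1 <= M)%N by case/andP: hj.
by apply: aeRS2 (vpm hj l) (vm_periodic n l hj') => x -> ->.
Qed.

Lemma posE n j : pos (n%:R * T) j = T *+ (j * n).
Proof. by rewrite /pos mulrA -natrM mulr_natl. Qed.

Lemma per_shift (W : Type) (f : R -> W) : (forall x, f (x + T) = f x) ->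
  forall n x, f (x + T *+ n) = f x.
Proof. by move=> pf; elim=> [|n IH] x; rewrite ?mulr0n ?addr0// mulrSr addrA pf. Qed.

Lemma Aop_shift n u l x :
  Aop k a (fun j i y => u j i (y + T *+ n)) l x = Aop k a u l (x + T *+ n).
Proof.
apply: eq_big_nat => i; rewrite ltnS => ik; apply: eq_bigr => j _.
by rewrite (per_shift (fun y => aper y ik)).
Qed.

(** * Estimates at a fixed separation of the fronts *)

Section Width.
Variable n : nat.
Let ell := n%:R * T.
Hypotheses (n0 : (0 < n)%N) (ell4 : 4 < ell).

Definition fr j l : nat -> R -> R := front ell (fun i => Z i l) j.
Definition ws l : nat -> R -> R := fronts M ell (chi n) (fun i => Z i l).

Lemma ws_jet l : is_jet k (ws l).
Proof.
apply: fronts_jet => j hj; first exact: schi.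
exact: jZ.
Qed.

Lemma fr_rho j : (1 <= j <= M)%N -> aeR (fun x => forall l, `|fr j l 0%N x| <= rho).
Proof. by move=> hj; exact: negligible_shift (Zrho hj). Qed.

Lemma all_fr_rho : aeR (fun x => forall j, (1 <= j <= M)%N -> forall l, `|fr j l 0%N x| <= rho).
Proof. by apply: aeR_forall_nat => j; apply: aeR_imp; exact: fr_rho. Qed.

(** Almost every value of the superposition is a convex combination of front values, so the bound
    [rho] is inherited. *)
Lemma ws_rho : aeR (fun x => forall l, `|ws l 0%N x| <= rho).
Proof.
apply: aeRS all_fr_rho => x hx l; rewrite /ws /fronts/=.
apply: (le_trans (ler_norm_sum _ _ _)).
rewrite -[leRHS]mul1r -(chi1 x n0) mulr_suml; apply: ler_sum => j _.
have hj := ord_front j.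
rewrite normrM ger0_norm; last exact: chi01.
by rewrite ler_wpM2l ?chi01//; exact: hx.
Qed.

Lemma fr_sol j : (1 <= j <= M)%N -> aeR (fun x => forall l, Fop k a N (fr j) l x = 0).
Proof.
move=> hj; apply: aeRS (negligible_shift (- pos ell j) (Zsol hj)) => x hx l.
rewrite -(hx l) /Fop; congr (_ + _).
  have := Aop_shift (j * n) (fun l i y => fr j l i y) l (x - pos ell j).
  rewrite -posE subrK => <-.
  by apply: eq_bigr => i _; apply: eq_bigr => t _; rewrite /fr /front addrK.
have Ez z : N z x = N z (x - pos ell j).
  by rewrite -(per_shift (Nper z) (j * n) (x - pos ell j)) -posE subrK.
by rewrite Ez.
Qed.

Definition Vn j : R -> J -> J -> R := fun x => DN (fun l => fr j l 0%N x) x.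

Lemma Lop_Vn j phi l x : Lop k a (Vn j) phi l (x + pos ell j) =
  Lop k a (fun y => DN (fun l => Z j l 0%N y) y) (fun j' i y => phi j' i (y + pos ell j)) l x.
Proof.
rewrite /Lop posE -Aop_shift; congr (_ + _); apply: eq_bigr => t _.
rewrite /Vn (per_shift (DNper _)); congr (DN _ _ _ _ * _).
by apply/funext => l'; rewrite /fr /front posE addrK.
Qed.

Lemma shift_VL2 f c : VL2 f -> VL2 (fun (l : J) (x : R) => f l (x + c)).
Proof. by move=> lf l; exact: L2_shift. Qed.

Lemma NN_shift f c : VL2 f -> NN (fun (l : J) (x : R) => f l (x + c)) = NN f.
Proof. by move=> lf; apply: eq_bigr => l _; rewrite nn_shift//; exact: L2_measurable. Qed.

Lemma HH_shift phi c : VHjet k phi -> HH k (fun (l : J) i (x : R) => phi l i (x + c)) = HH k phi.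
Proof.
move=> hp; apply: eq_bigr => l _; apply: eq_bigr => i _; rewrite nn_shift//.
by apply: L2_measurable; apply: (proj1 (hp l)); rewrite -ltnS.
Qed.

Lemma Vn_solvable j f : (1 <= j <= M)%N -> VL2 f -> exists2 phi, VHjet k phi &
  forall l, aeR (fun x => Lop k a (Vn j) phi l x = f l x).
Proof.
move=> hj lf; have [phi hp ep] := solvable hj (shift_VL2 (pos ell j) lf).
exists (fun l i x => phi l i (x - pos ell j)); first by move=> l; exact: is_hjet_shift.
move=> l; have := negligible_shift (- pos ell j) (ep l); apply: aeRS => x.
rewrite subrK => <-; rewrite -[X in Lop _ _ _ _ _ X = _](subrK (pos ell j)) Lop_Vn.
by congr (Lop _ _ _ _ _ _); do 3!apply/funext => ?; rewrite addrK.
Qed.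

(** The position of the front is a multiple of the period, so translation leaves the coefficients
    and the norms unchanged and [CS] does not depend on [n]. *)
Lemma Vn_stable j phi f : (1 <= j <= M)%N -> VHjet k phi -> VL2 f ->
  (forall l, aeR (fun x => Lop k a (Vn j) phi l x = f l x)) -> HH k phi <= CS * NN f.
Proof.
move=> hj hp lf e; rewrite -(NN_shift (pos ell j) lf) -(HH_shift (pos ell j) hp).
apply: (stable hj); first by move=> l; exact: is_hjet_shift.
  exact: shift_VL2.
move=> l; apply: aeRS (negligible_shift (pos ell j) (e l)) => x <-.
by rewrite Lop_Vn.
Qed.

Lemma close d : 0 <= d -> d <= ell / 4 ->
  aeR (fun x => forall l j p, (1 <= j <= M)%N -> (p <= k)%N -> cell M ell d j x ->
    `|ws l p x - fr j l p x| <=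
      M%:R * (2 ^+ k * K * (2 * \sum_(q < p.+1) \sum_(t < M)
        tails ell (fun i => Pp i l) (fun i => Pm i l) d t.+1 q x))).
Proof.
move=> d0 dl; apply: aeR_forall_fin => l.
apply: (@fronts_close _ _ sh h' k M ell K (chi n) (fun i => Z i l) (fun i => Pp i l)
  (fun i => Pm i l) (fun i => vp i l) (fun i => vm i l)).
- exact: sh'.
- exact: h'1.
- exact: ell4.
- exact: K0.
- by move=> j; exact: schi.
- by move=> x; exact: chi1.
- by move=> j i x; exact: chiK.
- by move=> j x; exact: window.
- by move=> j hj; exact: jZ.
- by move=> j hj; apply: is_hjet_jet; exact: hPp.
- by move=> j hj; apply: is_hjet_jet; exact: hPm.
- by move=> j hj; exact: Pp0.
- by move=> j hj; exact: Pm0.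
- by move=> j hj; exact: vp_vm.
- exact: d0.
- exact: dl.
Qed.

(* [ind q] is the indicator of the cell of the front [q.+1], written as a difference so
   that the sum over [q] telescopes. *)
Definition past (j : nat) (x : R) : R := ((j == 0)%N || ((j < M)%N && (lb ell j.+1 <= x)))%:R.

Definition ind (q : 'I_M) (x : R) : R := past q x - past q.+1 x.

Lemma past_anti (j : nat) x : past j.+1 x <= past j x.
Proof.
rewrite /past ler_nat; case: j => [|j] /=; first by case: (_ && _).
case: (ltnP j.+2 M) => //= jM; rewrite (ltnW jM)/=.
case: (leP (lb ell j.+3) x) => //= xl; rewrite (le_trans _ xl)//.
rewrite /lb ler_wpM2r ?(le_trans _ (ltW ell4))// lerD2r ler_nat; exact: leqW.
Qed.

Lemma ind01 q x : 0 <= ind q x <= 1.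
Proof.
rewrite subr_ge0 past_anti/= lerBlDr; apply: ler_wpDr; first exact: ler0n.
by rewrite /past; case: (_ || _).
Qed.

Lemma sum_ind x : \sum_q ind q x = 1.
Proof.
rewrite -(big_mkord xpredT (fun q => past q x - past q.+1 x)).
under eq_bigr do rewrite -opprB.
by rewrite sumrN telescope_sumr// opprB /past/= ltnn/= gtn_eqF// subr0.
Qed.

Lemma measurable_past j : measurable_fun setT (past j).
Proof.
rewrite /past; case: (j == 0)%N => /=; first exact: measurable_cst.
case: (j < M)%N => /=; last exact: measurable_cst.
have -> : (fun x => (lb ell j.+1 <= x)%R%:R) = \1_(`[lb ell j.+1, +oo[%classic : set R) :> (R -> R).
  apply/funext => x; rewrite indicE; case: leP => xl.
    by rewrite mem_set//= in_itv/= xl.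
  by rewrite memNset//= in_itv/= andbT leNgt xl.
by apply: measurable_indic; exact: measurable_itv.
Qed.

Lemma ind_cell q x : ind q x != 0 -> cell M ell 0 q.+1 x.
Proof.
rewrite /ind /past /cell eqSS subr0 addr0 /= => H; split.
  move=> q0; move: H; rewrite (negbTE q0) ltn_ord/=; case: (leP (lb _ _) x) => // xl.
  have := past_anti q x; rewrite /past (negbTE q0) ltn_ord/= leNgt.
  rewrite (leNgt (lb ell q.+1)) xl/= ; case: (_ && _) => //=; first by rewrite ltr01.
  by rewrite subrr eqxx.
move=> qM; have qM' : (q.+1 < M)%N by rewrite ltn_neqAle qM ltn_ord.
move: H; rewrite qM'/=; case: (leP (lb _ q.+2) x) => [xl|/ltW//].
have := past_anti q x; rewrite /past qM'/= xl; case: (_ || _) => /=; first by rewrite subrr eqxx.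
by rewrite ler10.
Qed.

(** Half-width of the transitions of [theta]. They are centred at distance [e] outside the cell, so
    they start at its border and are complete at distance [2 * e = ell / 4]. *)
Let e := ell / 8.

Let e_gt0 : 0 < e. Proof. by rewrite divr_gt0// (lt_trans _ ell4). Qed.

(* [theta q] is 1 on the cell of the front [q.+1] and vanishes outside its enlargement
   by [ell / 4]; its derivatives are O(1/ell). *)
Definition theta (q : 'I_M) : R -> R := fun x =>
  (if (q == 0 :> nat)%N then 1 else step_at h e (lb ell q.+1 - e) x) +
  -1 * (if q.+1 == M then 0 else step_at h e (lb ell q.+2 + e) x).

Let up (q : 'I_M) : R -> R := fun x => if (q == 0 :> nat)%N then 1 else step_at h e (lb ell q.+1 - e) x.
Let down (q : 'I_M) : R -> R := fun x => if q.+1 == M then 0 else step_at h e (lb ell q.+2 + e) x.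

Let sup q : smooth (up q).
Proof. by rewrite /up; case: eqP => _; [exact: smooth_cst|exact: smooth_step_at]. Qed.

Let sdown q : smooth (down q).
Proof. by rewrite /down; case: eqP => _; [exact: smooth_cst|exact: smooth_step_at]. Qed.

Lemma smooth_theta q : smooth (theta q).
Proof. by apply: smoothD; [exact: sup|apply: smoothZ; exact: sdown]. Qed.

Lemma theta_le1 q x : `|theta q x| <= 1.
Proof.
have u : 0 <= up q x <= 1 by rewrite /up; case: eqP => _; rewrite ?ler01 ?lexx// step_at_ge0_le1.
have v : 0 <= down q x <= 1 by rewrite /down; case: eqP => _; rewrite ?ler01 ?lexx// step_at_ge0_le1.
rewrite /theta -/(up q x) -/(down q x) mulN1r ler_norml.
move: u v; move: (up q x) (down q x) => y z /andP[? ?] /andP[? ?].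
by apply/andP; split; lra.
Qed.

(** For [ell >= 8] the scale [e] is at least 1, so higher powers of [e^-1] are below the first; the
    two transitions contribute [8 * C / ell] each. *)
Lemma theta_derive1n q i x C : (forall y, `|derive1n i.+1 h y| <= C) -> 0 <= C -> 8 <= ell ->
  `|derive1n i.+1 (theta q) x| <= 16 * C / ell.
Proof.
move=> hC C0 ell8; rewrite /theta derive1nD; [|exact: sup|by apply: smoothZ; exact: sdown].
have ie : e^-1 ^+ i.+1 <= e^-1.
  rewrite exprS; apply: ler_piMr; first by rewrite invr_ge0 ltW.
  apply: exprn_ile1; first by rewrite invr_ge0 ltW.
  rewrite invf_le1//.
  by rewrite /e ler_pdivlMr// mul1r.
have ie0 : 0 <= e^-1 * C by rewrite mulr_ge0// invr_ge0 ltW.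
have b1 : `|derive1n i.+1 (up q) x| <= e^-1 * C.
  rewrite /up; case: eqP => _; first by rewrite derive1nSr_cst normr0.
  apply: (le_trans (derive1n_step_at_le sh _ hC e_gt0 x)); exact: ler_wpM2r.
have b2 : `|derive1n i.+1 (fun x => -1 * down q x) x| <= e^-1 * C.
  rewrite derive1nZ; last exact: sdown.
  rewrite mulN1r normrN /down; case: eqP => _; first by rewrite derive1nSr_cst normr0.
  apply: (le_trans (derive1n_step_at_le sh _ hC e_gt0 x)); exact: ler_wpM2r.
apply: (le_trans (ler_normD _ _)); apply: (le_trans (lerD b1 b2)).
rewrite /e invf_div le_eqVlt; apply/orP; left; apply/eqP.
by move: (ell^-1) => y; ring.
Qed.

Lemma theta_ind q x : theta q x * ind q x = ind q x.
Proof.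
have [->|/ind_cell[cl cr]] := eqVneq (ind q x) 0; first by rewrite mulr0.
suff -> : theta q x = 1 by rewrite mul1r.
rewrite /theta; case: eqP => q0; case: eqP => qM; rewrite ?mulr0 ?addr0//.
- rewrite (step_at0 sh)//; first by rewrite mulr0 addr0.
  by rewrite addrK; have := cr (introN eqP qM); rewrite addr0.
- rewrite (step_at1 sh)//.
  by rewrite subrK; have := cl; rewrite subr0; apply; apply/eqP => -[].
- rewrite (step_at1 sh)//; last first.
    by rewrite subrK; have := cl; rewrite subr0; apply; apply/eqP => -[].
  rewrite (step_at0 sh)//; first by rewrite mulr0 addr0.
  by rewrite addrK; have := cr (introN eqP qM); rewrite addr0.
Qed.

Lemma theta_cell q x : theta q x != 0 -> cell M ell (ell / 4) q.+1 x.
Proof.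
have lbS : lb ell q.+2 = lb ell q.+1 + ell by rewrite !lbE (pos_succ _ q.+1) addrAC.
have e2 : e + e = ell / 4 by rewrite /e; move: ell => y; field.
rewrite /theta => H; split => [q0|qM].
- rewrite leNgt; apply/negP => xl; case/eqP: H.
  rewrite ifN//; rewrite (step_at0 sh)//; last by move: xl e2; lra.
  case: eqP => _; first by rewrite mulr0 addr0.
  by rewrite (step_at0 sh) ?mulr0 ?addr0// addrK; move: xl e2 lbS ell4; lra.
- rewrite leNgt; apply/negP => xl; case/eqP: H.
  rewrite (ifN _ _ qM) (step_at1 sh e_gt0 (x := lb ell q.+2 + e) (y := x)); last by move: xl e2; lra.
  case: eqP => _; first by rewrite mulr1 subrr.
  by rewrite (step_at1 sh e_gt0 (y := x)) ?mulr1 ?subrr// subrK; move: xl lbS e2 ell4; lra.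
Qed.

(** Front, component, order, and side: [true] selects the right end state, [false] the left one. *)
Definition sidx : finType := ('I_M * J * 'I_k.+1 * bool)%type.

Definition end_jet (s : sidx) : R -> R := (if s.2 then Pp else Pm) s.1.1.1.+1 s.1.1.2 s.1.2.

Definition shifted_tail r (s : sidx) : R -> R :=
  fun x => cut_off r (end_jet s) (x - pos ell s.1.1.1.+1).

Lemma end_jet_L2 s : L2 (end_jet s).
Proof.
have hj := ord_front s.1.1.1; have qk : (s.1.2 <= k)%N by rewrite -ltnS.
rewrite /end_jet; case: s.2; [have := hPp hj|have := hPm hj];
  by move=> /(_ s.1.1.2)[+ _]; apply.
Qed.

Lemma shifted_tail_L2 r s : L2 (shifted_tail r s).
Proof. by apply: L2_shift; apply: cut_off_L2; exact: end_jet_L2. Qed.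

Lemma nn_shifted_tail r s : nn (shifted_tail r s) = tail r (end_jet s).
Proof.
rewrite -nn_cut_off; apply: nn_shift; apply: L2_measurable.
by apply: cut_off_L2; exact: end_jet_L2.
Qed.

Lemma sum_sidx (F : sidx -> R) : \sum_s F s =
  \sum_(t < M) \sum_l \sum_(q < k.+1) (F (t, l, q, true) + F (t, l, q, false)).
Proof.
rewrite pair_bigA/= pair_bigA/=.
rewrite [RHS](eq_bigr (fun p => \sum_(b : bool) F (p.1.1, p.1.2, p.2, b))); last first.
  by move=> p _; rewrite big_bool.
by rewrite pair_bigA/=; apply: eq_bigr => -[[[]]].
Qed.

Lemma tails_le d l p x : (p <= k)%N ->
  \sum_(q < p.+1) \sum_(t < M) tails ell (fun i => Pp i l) (fun i => Pm i l) d t.+1 q x <=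
  \sum_(s : sidx) `|shifted_tail (ell / 2 - 1 - d) s x|.
Proof.
move=> pk; rewrite sum_sidx exchange_big; apply: ler_sum => t _.
rewrite (bigD1 l)//=; apply: ler_wpDr; first by do 2![apply: sumr_ge0 => ? _]; exact: addr_ge0.
pose F q := tails ell (fun i => Pp i l) (fun i => Pm i l) d t.+1 q x.
apply: (@le_trans _ _ (\sum_(q < k.+1) F q)).
  rewrite -!(big_mkord xpredT F) (@big_cat_nat _ _ _ p.+1 0 k.+1)//=.
  by rewrite lerDl sumr_ge0// => *; exact: tails_ge0.
apply: ler_sum => q _; rewrite /F /tails /shifted_tail /cut_off /end_jet/= /far.
by rewrite !normrM mulrDr; case: (_ < _)%R; rewrite ?mul0r ?normr0 ?mul0r// normr1 !mul1r.
Qed.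

Definition close_const : R := M%:R * (2 ^+ k * K * 2).

Definition residual_const : R := (k%:R * (#|J|%:R * B) + Lam * #|J|%:R) * close_const.

(** Some cell contains [x], and its translated front is an exact solution. Subtracting the equation
    of that front leaves a difference, controlled by the coefficients, the Lipschitz constant of the
    nonlinearity and [close]. *)
Lemma residual_pointwise : aeR (fun x => forall l, `|Fop k a N ws l x| <=
  residual_const * \sum_(s : sidx) `|shifted_tail (ell / 2 - 1 - 0) s x|).
Proof.
have sol : aeR (fun x => forall j, (1 <= j <= M)%N -> forall l, Fop k a N (fr j) l x = 0).
  by apply: aeR_forall_nat => j; apply: aeR_imp; exact: fr_sol.
have l0 : 0 <= ell / 4 by rewrite divr_ge0// (le_trans _ (ltW ell4)).
have cl := close (lexx 0) l0.
apply: aeRS3 cl sol (aeRS2 (fun x p q => conj p q) ws_rho all_fr_rho) => x cl sol [wr fr_r] l.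
have [q hq] : exists q, ind q x != 0.
  apply/existsP; rewrite -negb_forall; apply/negP => /forallP H.
  have := sum_ind x; rewrite big1; first by move=> /eqP; rewrite eq_sym oner_eq0.
  by move=> q _; apply/eqP; exact: H.
have hj := ord_front q; have hc := ind_cell hq.
set G := \sum_s _.
have G0 : 0 <= G by exact: sumr_ge0.
have hd l' i : (i <= k)%N -> `|ws l' i x - fr q.+1 l' i x| <= close_const * G.
  move=> ik; apply: (le_trans (cl l' _ _ hj ik hc)).
  rewrite /close_const -!mulrA; do 4!(rewrite ler_wpM2l ?exprn_ge0//).
  exact: tails_le.
rewrite -[X in `|X|]subr0 -(sol _ hj l) /Fop opprD addrACA.
apply: (le_trans (ler_normD _ _)).
have -> : residual_const * G = k%:R * (#|J|%:R * (B * (close_const * G))) +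
    Lam * (#|J|%:R * (close_const * G)).
  by rewrite /residual_const -mulrA mulrDl -!mulrA.
apply: lerD.
  rewrite -AopB; apply: (le_trans (ler_norm_sum _ _ _)).
  have -> : k%:R * (#|J|%:R * (B * (close_const * G))) =
      \sum_(1 <= i < k.+1) #|J|%:R * (B * (close_const * G)).
    by rewrite sumr_const_nat subn1 mulr_natl.
  rewrite big_nat [leRHS]big_nat; apply: ler_sum => i ik.
  apply: (le_trans (ler_norm_sum _ _ _)); apply: ler_sum_card => l'.
  rewrite normrM; apply: ler_pM => //; first exact: ab.
  by apply: hd; case/andP: ik.
apply: (le_trans (Nlip _ _ wr (fr_r _ hj))); rewrite ler_wpM2l//.
by apply: ler_sum_card => l'; exact: hd.
Qed.

Lemma residual_measurable l : measurable_fun setT (Fop k a N ws l).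
Proof. by apply: measurable_Fop => // l'; exact: ws_jet. Qed.

Lemma residual_L2 : VL2 (Fop k a N ws).
Proof.
move=> l; apply: (L2_dom (residual_measurable l)
  (shifted_tail_L2 (ell / 2 - 1 - 0))).
by apply: aeRS residual_pointwise => x; apply.
Qed.

Definition Etail r : R := \sum_(s : sidx) tail r (end_jet s).

Lemma Etail_ge0 r : 0 <= Etail r.
Proof. by apply: sumr_ge0 => *; exact: tail_ge0. Qed.

Definition residual_bound : R :=
  #|J|%:R * (residual_const ^+ 2 * 2 ^+ size (index_enum sidx)).

Lemma residual_NN : NN (Fop k a N ws) <= residual_bound * Etail (ell / 2 - 1).
Proof.
rewrite -mulrA; apply: ler_sum_card => l.
have H : aeR (fun x => `|Fop k a N ws l x| <= residual_const *
    \sum_(s : sidx) `|shifted_tail (ell / 2 - 1 - 0) s x|).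
  by apply: aeRS residual_pointwise => x; apply.
apply: (le_trans (nn_dom (residual_measurable l) (shifted_tail_L2 (ell / 2 - 1 - 0)) H)).
apply: ler_wpM2l; first by rewrite mulr_ge0 ?sqr_ge0// exprn_ge0.
by rewrite /Etail subr0; apply: ler_sum => s _; rewrite nn_shifted_tail.
Qed.

(** The potentials must be close in the sup norm, not in L2; hence the pointwise decay hypothesis on
    the jets of order 0. Outside the support of [theta q] the left side is 0. *)
Lemma potential_close r eps : 0 <= eps -> r <= ell / 4 - 1 ->
  (forall s : sidx, s.1.2 = ord0 -> aeR (fun x => r <= `|x| -> `|end_jet s x| <= eps)) ->
  aeR (fun x => forall (q : 'I_M) j l,
    `|theta q x * (Vn q.+1 x j l - DN (fun l => ws l 0%N x) x j l)| <=
    Lam * (#|J|%:R * (M%:R * (2 ^+ k * K * (2 * (M%:R * (eps + eps))))))).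
Proof.
move=> eps0 rl hs.
have sm : aeR (fun x => forall s : sidx, s.1.2 = ord0 -> r <= `|x - pos ell s.1.1.1.+1| ->
    `|end_jet s (x - pos ell s.1.1.1.+1)| <= eps).
  apply: aeR_forall_fin => s; apply: aeR_imp => s0.
  exact: (negligible_shift (- pos ell s.1.1.1.+1) (hs s s0)).
have l0 : 0 <= ell / 4 by rewrite divr_ge0// (le_trans _ (ltW ell4)).
have cl := close l0 (lexx _).
apply: aeRS3 cl sm (aeRS2 (fun x p q => conj p q) ws_rho all_fr_rho) => x cl sm [wr fr_r] q j l.
have R0 : 0 <= Lam * (#|J|%:R * (M%:R * (2 ^+ k * K * (2 * (M%:R * (eps + eps)))))).
  by rewrite !mulr_ge0// ?exprn_ge0// addr_ge0.
have [->|hth] := eqVneq (theta q x) 0; first by rewrite mul0r normr0.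
have hj := ord_front q; have hc := theta_cell hth.
rewrite normrM; apply: (@le_trans _ _ `|Vn q.+1 x j l - DN (fun l => ws l 0%N x) x j l|).
  by rewrite ler_piMl// theta_le1.
apply: (le_trans (DNlip _ _ _ (fr_r _ hj) wr)); rewrite ler_wpM2l//.
apply: ler_sum_card => l'; rewrite distrC; apply: (le_trans (cl l' _ 0%N hj (leq0n _) hc)).
rewrite ler_wpM2l// ler_wpM2l ?mulr_ge0 ?exprn_ge0// ler_wpM2l// big_ord1.
have -> : (M%:R : R) = #|'I_M|%:R by rewrite card_ord.
apply: ler_sum_card => t; rewrite /tails /far.
have [lt1|_] := ltP; last by rewrite mul0r addr_ge0.
(* With the cell widened by [ell / 4], the tails start at distance
   [ell / 2 - 1 - ell / 4 = ell / 4 - 1] from the front. *)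
have rx : r <= `|x - pos ell t.+1|.
  by apply: le_trans (ltW lt1); move: rl; move: ell => y; lra.
rewrite mul1r; apply: lerD.
  exact: (sm (t, l', ord0, true)).
exact: (sm (t, l', ord0, false)).
Qed.

End Width.

Lemma Etail_small e : 0 < e -> exists2 r0 : R, 0 < r0 &
  forall r, r0 <= r -> Etail r <= e.
Proof.
move=> e0; pose c := #|sidx|%:R : R.
have c0 : 0 <= c by exact: ler0n.
have [r0 r00 H] := common_radius (fun s => tail_small (end_jet_L2 s) (divr_gt0 e0 (ltr_wpDl c0 ltr01))).
exists r0 => // r /H {}H; apply: (@le_trans _ _ (c * (e / (c + 1)))).
  by apply: ler_sum_card => s; exact: H.
by apply: mul_div_addr1_le => //; exact: ltW.
Qed.

Lemma end_jet_decay e : 0 < e -> exists2 r : R, 0 < r &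
  forall s : sidx, s.1.2 = ord0 -> aeR (fun x => r <= `|x| -> `|end_jet s x| <= e).
Proof.
move=> e0.
have [s|r0 r00 H] := @common_radius R sidx
  (fun s r => s.1.2 = ord0 -> aeR (fun x => r <= `|x| -> `|end_jet s x| <= e)).
  have hj := ord_front s.1.1.1.
  pose u i := (if s.2 then Pp else Pm) s.1.1.1.+1 s.1.1.2 i.
  have [lu wu] : is_hjet k u by rewrite /u; case: s.2; [exact: hPp|exact: hPm].
  have [r r0 hr] := sobolev_decay sh (wu 0%N k0) (lu 0%N isT) (lu 1%N k0) e0.
  exists r => // r' rr' s0; apply: aeRS hr => x hx r'x.
  by rewrite /end_jet s0; apply: hx; exact: le_trans r'x.
by exists r0 => // s; exact: H.
Qed.

(** [gluing] supplies its threshold before [n] is chosen; it remains to take the separation so large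
    that residual, cutoff derivatives and potential mismatch all fall below it. *)
Lemma multifront_correction : exists (C : R) (n0 : nat), 0 < C /\ forall n, (n0 <= n)%N ->
  (0 < n)%N /\ exists b, [/\ VHjet k b, HH k b <= C * Etail (n%:R * T / 2 - 1) &
    forall l, aeR (fun x => Fop k a N (fun l i y => ws n l i y + b l i y) l x = 0)].
Proof.
have [kap kap0 [C C0 glue]] := gluing (Q := 'I_M) sh k0 B0 Lam0 CS0 ma ab mN taylor.
pose c1 : R := Lam * (#|J|%:R * (M%:R * (2 ^+ k * K * (2 * M%:R)))).
have c10 : 0 <= c1 by rewrite !mulr_ge0// exprn_ge0.
(* [potential_close] gives the bound [c1 * (2 * eps)], which is then at most [kap]. *)
pose eps := kap / (2 * (c1 + 1)).
have c1p : 0 < c1 + 1 by rewrite ltr_wpDl.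
have eps0 : 0 < eps by rewrite divr_gt0// mulr_gt0.
have [r1 r10 decay] := end_jet_decay eps0.
have rb0 : 0 <= residual_bound.
  by rewrite mulr_ge0// mulr_ge0 ?sqr_ge0// exprn_ge0.
have rbp : 0 < residual_bound + 1 by rewrite ltr_wpDl.
have [r2 r20 small] := Etail_small (divr_gt0 kap0 rbp).
have hCb : exists2 Cb : R, 0 <= Cb & forall i y, (0 < i <= k)%N -> `|derive1n i h y| <= Cb.
  have hb i : exists C : R, 0 < C /\ forall y, `|derive1n i h y| <= C.
    by have [c c0 hc] := derive1n_step_bounded sh i; exists c.
  have [f hf] := choice hb; exists (\sum_(i < k.+1) f i).
    by apply: sumr_ge0 => i _; apply: ltW; exact: (proj1 (hf i)).
  move=> i y /andP[_ ik]; apply: (le_trans (proj2 (hf i) y)).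
  have ik' : (i < k.+1)%N by [].
  rewrite (bigD1 (Ordinal ik'))//= lerDl; apply: sumr_ge0 => t _; apply: ltW.
  exact: (proj1 (hf t)).
have [Cb Cb0 hCb'] := hCb.
(* The summands secure in turn [ell >= 8], cutoff derivatives below [kap], [r1 <= ell / 4 - 1] and
   [r2 <= ell / 2 - 1]. *)
pose L := 8 + 16 * Cb / kap + 4 * (r1 + 1) + 2 * (r2 + 1).
have L16 : 0 <= 16 * Cb / kap by rewrite divr_ge0 ?mulr_ge0// ltW.
pose n0 := (Num.truncn (L / T)).+1.
exists (C * (residual_bound + 1)), n0; split; first exact: mulr_gt0.
move=> n n0n; have np : (0 < n)%N by apply: leq_trans n0n.
have Ln : L <= n%:R * T.
  rewrite -ler_pdivrMr//; apply: le_trans (_ : n0%:R <= _); last by rewrite ler_nat.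
  by apply: ltW; exact: truncnS_gt.
have ell8 : 8 <= n%:R * T by apply: le_trans Ln; rewrite /L; move: L16 r10 r20; lra.
have ell4 : 4 < n%:R * T by apply: lt_le_trans ell8; rewrite ltr_nat.
split => //.
have hNN : NN (Fop k a N (ws n)) <= residual_bound * Etail (n%:R * T / 2 - 1).
  exact: residual_NN.
have hE : residual_bound * Etail (n%:R * T / 2 - 1) <= kap.
  apply: (@le_trans _ _ (residual_bound * (kap / (residual_bound + 1)))).
    rewrite ler_wpM2l//; apply: small.
    by move: Ln; rewrite /L; move: L16 r10 r20; lra.
  by apply: mul_div_addr1_le => //; exact: ltW.
have [||||||||||||||b [hb1 hb2 hb3]] := glue (fun q : 'I_M => Vn n q.+1) (ind n) (theta n) (ws n).
- by move=> q f lf; apply: Vn_solvable => //; exact: ord_front q.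
- by move=> q phi f hp lf e; apply: (Vn_stable (j := q.+1)) e => //; exact: ord_front q.
- by move=> q; apply: measurable_funB; exact: measurable_past.
- by move=> q x; exact: ind01.
- by move=> x; exact: sum_ind.
- by move=> q; exact: smooth_theta.
- by move=> q x; exact: theta_le1.
- move=> q [//|i] x ik; apply: (le_trans (theta_derive1n ell4 q x (fun y => hCb' _ y ik) Cb0 ell8)) => //.
  rewrite ler_pdivrMr; last exact: lt_trans ell4.
  rewrite [leRHS]mulrC -ler_pdivrMr//; apply: le_trans Ln.
  by rewrite /L; move: r10 r20; lra.
- by move=> q x; exact: theta_ind.
- by move=> l; exact: ws_jet.
- exact: ws_rho.
- exact: residual_L2.
- exact: le_trans hE.
- have rl : r1 <= n%:R * T / 4 - 1 by move: Ln; rewrite /L; move: L16 r10 r20; lra.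
  apply: aeRS (potential_close np ell4 (ltW eps0) rl decay) => x hx q j l.
  apply: (le_trans (hx q j l)).
  have -> : Lam * (#|J|%:R * (M%:R * (2 ^+ k * K * (2 * (M%:R * (eps + eps)))))) =
      c1 * (2 * eps).
    have E (y1 y2 y3 y4 : R) : Lam * (y2 * (y3 * (y1 * K * (2 * (y3 * (y4 + y4)))))) =
      Lam * (y2 * (y3 * (y1 * K * (2 * y3)))) * (2 * y4) by ring.
    exact: E.
  have -> : 2 * eps = kap / (c1 + 1).
    by rewrite /eps invfM !mulrA [2 * kap]mulrC mulfK.
  by apply: mul_div_addr1_le => //; exact: ltW.
exists b; split => //; apply: (le_trans hb2); rewrite -[leRHS]mulrA; apply: ler_wpM2l; first exact: ltW.
apply: (le_trans hNN); apply: ler_wpM2r; first exact: Etail_ge0.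
by rewrite lerDl.
Qed.

End Correction.

(** * Real coordinates *)

Lemma normc_ge_Im (R : rcfType) (x : R[i]) : (`|complex.Im x|%:C <= `|x|)%C.
Proof. by case: x => a b; simpc; rewrite -sqrtr_sqr ler_wsqrtr// lerDr sqr_ge0. Qed.

Lemma normc_real (R : rcfType) (a : R) : `|(a%:C)%C| = (`|a|%:C)%C.
Proof. by rewrite normc_def/= expr0n/= addr0 sqrtr_sqr. Qed.

(* Real scalars get a single real coordinate, not (re, im): the identically zero
   imaginary part would destroy ellipticity in coordinates. *)
Definition parts (s : field_kind) : finType :=
  match s with RealScalars => unit | ComplexScalars => bool end.

Section Scalars.
Context {R : realType}.

Definition scalar_coord (s : field_kind) : parts s -> scalar_field R s -> R :=
  match s return parts s -> scalar_field R s -> R with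
  | RealScalars => fun _ z => z
  | ComplexScalars => fun b z => if b then complex.Re z else complex.Im z
  end.

Definition scalar_base (s : field_kind) : parts s -> scalar_field R s :=
  match s return parts s -> scalar_field R s with
  | RealScalars => fun _ => 1
  | ComplexScalars => fun b => if b then 1 else 'i%C
  end.

Lemma scalar_coordD s (b : parts s) z w :
  scalar_coord b (z + w) = scalar_coord b z + scalar_coord b w.
Proof. by case: s b z w => //= -[] [a b] [c d]. Qed.

Lemma scalar_coord0 s (b : parts s) : scalar_coord b 0 = 0.
Proof. by case: s b => //= -[]. Qed.

Lemma scalar_coordZ s (b : parts s) (c : R) z :
  scalar_coord b (of_real s c * z) = c * scalar_coord b z.
Proof. by case: s b z => //= -[] [x y] /=; rewrite mul0r ?subr0 ?addr0. Qed.

Lemma scalar_coord_base s (b b' : parts s) : scalar_coord b (scalar_base b') = (b == b')%:R.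
Proof. by case: s b b' => [[] []|[] []]/=. Qed.

Lemma scalar_recon s (z : scalar_field R s) :
  z = \sum_(b : parts s) of_real s (scalar_coord b z) * scalar_base b.
Proof.
case: s z => [z|z] /=; first by rewrite big_const card_unit/= addr0 mulr1.
by rewrite big_bool/= mulr1 [LHS]complexE mulrC.
Qed.

Lemma of_realV s (a : R) : of_real s a^-1 = (of_real s a)^-1.
Proof. by case: s => //=; exact: fmorphV. Qed.

Lemma of_real0 s : of_real s (0 : R) = 0.
Proof. by case: s. Qed.

Lemma of_real_eq0 s (a : R) : (of_real s a == 0) = (a == 0).
Proof. by case: s => //=; rewrite eq_complex/= eqxx andbT. Qed.

Lemma continuous_of_real s : continuous (of_real s : R -> scalar_field R s).
Proof.
case: s => [x|x]; first exact: cvg_id.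
apply/cvgrPdist_lt => e e0.
have /andP[/eqP ie re] : (complex.Im e == 0) && (0 < complex.Re e).
  by move: e0; case: e => a b; rewrite ltcE/= eq_sym.
have : \forall y \near x, `|x - y| < complex.Re e.
  exact: (@cvgr_dist_lt _ _ _ _ _ _ _ (@cvg_id _ (nbhs x))).
apply: filterS => y; rewrite -[X in _ -> `|X| < _]/((x%:C)%C - (y%:C)%C) -rmorphB normc_real.
by move=> H; rewrite ltcE/= ie eqxx.
Qed.

Lemma continuous_dist_lt (K : numFieldType) (f : K -> R) :
  (forall z (e : R), 0 < e -> exists2 d : K, 0 < d &
    forall w, `|z - w| < d -> `|f z - f w| < e) -> continuous f.
Proof.
move=> H z; have FF : Filter (nbhs z) by exact: nbhs_filter.
have := (@cvgrPdist_lt R _ _ _ FF f (f z)).2.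
apply=> e e0; have [d d0 hd] := H z e e0.
have : \forall w \near z, `|z - w| < d by apply: nbhsx_ballx.
exact: filterS.
Qed.

Lemma continuous_scalar_coord s (b : parts s) : continuous (@scalar_coord s b).
Proof.
case: s b => [b z|b z]; first exact: cvg_id.
apply: continuous_dist_lt => {z} z e e0.
exists (e%:C)%C; first by rewrite ltcR.
move=> w H; rewrite -ltcR; apply: le_lt_trans H.
case: b => /=.
  have -> : complex.Re z - complex.Re w = complex.Re (z - w) by case: (z) (w) => ? ? [].
  exact: normc_ge_Re.
have -> : complex.Im z - complex.Im w = complex.Im (z - w) by case: (z) (w) => ? ? [].
exact: normc_ge_Im.
Qed.

Lemma sqr_scalar s (z : scalar_field R s) :
  re_part z ^+ 2 + im_part z ^+ 2 = \sum_(b : parts s) scalar_coord b z ^+ 2.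
Proof.
case: s z => [z|z] /=; last by rewrite big_bool.
by rewrite big_const card_unit/= addr0 expr0n addr0.
Qed.

(** The definitions speak of real and imaginary parts, the proof of coordinates. For real scalars
    the imaginary part is 0 and is no coordinate, whence the hypothesis on the zero functions. *)
Lemma re_im_coords s (P : (R -> R) -> (R -> R) -> Prop) (f g : R -> scalar_field R s) :
  P (fun=> 0) (fun=> 0) ->
  (P (fun x => re_part (f x)) (fun x => re_part (g x)) /\
   P (fun x => im_part (f x)) (fun x => im_part (g x))) <->
  forall b : parts s, P (fun x => scalar_coord b (f x)) (fun x => scalar_coord b (g x)).
Proof.
case: s f g => f g P0 /=; split.
- by case.
- by move=> /(_ tt).
- by move=> [h1 h2] [].
- by move=> h; split; [exact: (h true)|exact: (h false)].
Qed.

End Scalars.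

Section Coordinates.
Context {R : realType} (s : field_kind) (m : nat).
Local Notation F := (scalar_field R s).
Local Notation V := 'cV[F]_m.

Definition coords : finType := ('I_m * parts s)%type.
Local Notation J := coords.

Definition vc (z : V) (j : J) : R := scalar_coord j.2 (z j.1 0).

Definition vbase (j : J) : V := scalar_base j.2 *: delta_mx j.1 0.

Definition build (c : J -> R) : V := \sum_j of_real s (c j) *: vbase j.

Lemma vc0 j : vc 0 j = 0.
Proof. by rewrite /vc mxE scalar_coord0. Qed.

Lemma vcD z w j : vc (z + w) j = vc z j + vc w j.
Proof. by rewrite /vc mxE scalar_coordD. Qed.

Lemma vcZ (t : R) z j : vc (of_real s t *: z) j = t * vc z j.
Proof. by rewrite /vc mxE scalar_coordZ. Qed.

Lemma vcB z w j : vc (z - w) j = vc z j - vc w j.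
Proof. by apply/eqP; rewrite eq_sym subr_eq -vcD subrK. Qed.

Lemma vc_sum (I : Type) (r : seq I) (f : I -> V) j :
  vc (\sum_(i <- r) f i) j = \sum_(i <- r) vc (f i) j.
Proof.
by apply: (big_morph (fun z => vc z j)); [move=> z w; exact: vcD|exact: vc0].
Qed.

Lemma vc_base j l : vc (vbase j) l = (l == j)%:R.
Proof.
case: j l => [i b] [i' b']; rewrite /vc /vbase /= !mxE eqxx andbT xpair_eqE.
case: (i' == i) => /=; last by rewrite mulr0 scalar_coord0.
by rewrite mulr1 scalar_coord_base.
Qed.

Lemma vc_build c j : vc (build c) j = c j.
Proof.
rewrite /build vc_sum (bigD1 j)//= vcZ vc_base eqxx mulr1 big1 ?addr0// => l lj.
by rewrite vcZ vc_base eq_sym (negbTE lj) mulr0.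
Qed.

Lemma build_vc z : build (vc z) = z.
Proof.
apply/colP => i; rewrite summxE.
rewrite -(pair_bigA _ (fun l b => (of_real s (vc z (l, b)) *: vbase (l, b)) i 0))/=.
rewrite (bigD1 i)//= [X in _ + X]big1 ?addr0; last first.
  move=> l li; apply: big1 => b _; rewrite !mxE eqxx andbT /= eq_sym (negbTE li).
  by rewrite !mulr0.
rewrite [RHS](scalar_recon (z i 0)); apply: eq_bigr => b _.
by rewrite mxE /vbase mxE mxE !eqxx/= mulr1.
Qed.

Lemma vc_inj z w : (forall j, vc z j = vc w j) -> z = w.
Proof. by move=> h; rewrite -(build_vc z) -(build_vc w); congr build; apply/funext. Qed.

Lemma vc_linear (f : {linear V -> V}) z j :
  vc (f z) j = \sum_l vc (f (vbase l)) j * vc z l.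
Proof.
rewrite -[in LHS](build_vc z) /build linear_sum vc_sum; apply: eq_bigr => l _.
by rewrite linearZ vcZ mulrC.
Qed.

Lemma sqnormE z : sqnorm z = \sum_j vc z j ^+ 2.
Proof.
rewrite /sqnorm; under eq_bigr do rewrite sqr_scalar.
by rewrite pair_big.
Qed.

Lemma continuous_vc j : continuous (fun z : V => vc z j).
Proof.
by move=> z; apply: continuous_comp; [exact: coord_continuous|exact: continuous_scalar_coord].
Qed.

(** [build] read on row vectors, where continuity and the compactness of boxes are expressed. *)
Definition rebuild (v : 'rV[R]_#|J|) : V := build (fun j => v 0 (enum_rank j)).

Lemma continuous_rebuild : continuous rebuild.
Proof.
rewrite /rebuild /build => v; apply: continuous_big; first exact: add_continuous.
move=> j _ {}v; apply: (@continuous_comp _ _ _ (fun v : 'rV[R]_#|J| => v 0 (enum_rank j))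
  (fun t => of_real s t *: vbase j)).
  exact: coord_continuous.
apply: (@continuous_comp _ _ _ (of_real s) (fun z => z *: vbase j)).
  exact: continuous_of_real.
exact: scalel_continuous.
Qed.

Lemma continuous_rebuild_pair :
  continuous (fun p : 'rV[R]_#|J| * R => (rebuild p.1, p.2)).
Proof.
move=> p; have c1 : rebuild q.1 @[q --> p] --> rebuild p.1.
  by apply: (@cvg_comp _ _ _ fst rebuild _ (nbhs p.1)); [exact: cvg_fst|exact: continuous_rebuild].
have c2 : q.2 @[q --> p] --> p.2 by exact: cvg_snd.
exact: (cvg_pair c1 c2).
Qed.

Lemma buildE c : build c = rebuild (\row_i c (enum_val i)).
Proof. by congr build; apply/funext => j; rewrite mxE enum_rankK. Qed.

Lemma bounded_on_box (f : V * R -> R) rho T : continuous f ->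
  exists2 C : R, 0 <= C & forall c x, (forall j, `|c j| <= rho) -> 0 <= x <= T ->
    `|f (build c, x)| <= C.
Proof.
move=> cf.
pose g (p : 'rV[R]_#|J| * R) := f (rebuild p.1, p.2).
have cg : continuous g.
  move=> p; apply: (@continuous_comp _ _ _ (fun p : 'rV[R]_#|J| * R => (rebuild p.1, p.2)) f).
    exact: continuous_rebuild_pair.
  exact: cf.
pose K := [set v : 'rV[R]_#|J| | forall i, `[- rho, rho]%classic (v 0 i)] `*` `[0, T]%classic.
have cK : compact K.
  apply: compact_setX; last exact: segment_compact.
  have := @rV_compact _ _ (fun _ : 'I_#|J| => `[- rho, rho]%classic : set R)
    (fun=> @segment_compact _ _ _).
  exact.
have := compact_bounded (continuous_compact (continuous_subspaceT cg) cK).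
move=> [C [Cr HC]]; exists (`|C| + 1); first by rewrite addr_ge0.
move=> c x hc hx; apply: (HC (`|C| + 1)); first by rewrite ltr_pwDr// ler_norm.
exists (\row_i c (enum_val i), x); last by rewrite /g -buildE.
by split => /=; [move=> i; rewrite mxE/= in_itv/= -ler_norml|rewrite in_itv].
Qed.

(** A directional derivative over the scalar field restricts to real increments, because nonzero
    reals tending to 0 embed as nonzero scalars tending to 0. So complex differentiability yields
    real derivatives along segments. *)
Lemma derive_along (G : V -> V) (c h : J -> R) j (t : R) :
  (forall z, differentiable G z) ->
  is_derive t (1 : R) (fun t => vc (G (build (fun l => c l + t * h l))) j)
    (\sum_l vc ('d G (build (fun l => c l + t * h l)) (vbase l)) j * h l).
Proof.
move=> dG; pose H := build h; pose z := build (fun l => c l + t * h l).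
have zE r : build (fun l => c l + (r + t) * h l) = of_real s r *: H + z.
  apply: vc_inj => l; rewrite vcD vcZ /H /z !vc_build.
  by rewrite mulrDl addrCA.
have -> : \sum_l vc ('d G z (vbase l)) j * h l = vc ('D_H G z) j.
  rewrite deriveE// vc_linear; apply: eq_bigr => l _; by rewrite /H vc_build.
have cv : (fun r : R => (of_real s r)^-1 *: (G (of_real s r *: H + z) - G z)) @ 0^' --> 'D_H G z.
  have Hc := diff_derivable (v := H) (dG z).
  apply: (@cvg_comp _ _ _ (of_real s) (fun e => e^-1 *: (G (e *: H + z) - G z)) _ (0^' : set_system F)).
    have := @continuous_injective_withinNx _ _ (of_real s) 0 (@continuous_of_real R s 0).
    rewrite of_real0; apply => y /eqP; rewrite of_real_eq0 => /eqP.
    exact.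
  exact: Hc.
have cv' : (fun r : R => r^-1 *: ((fun t => vc (G (build (fun l => c l + t * h l))) j) (r *: 1 + t) - vc (G z) j)) @ 0^' --> vc ('D_H G z) j.
  have := @cvg_comp _ _ _ _ (fun z => vc z j) _ _ _ cv (@continuous_vc j ('D_H G z)).
  apply: cvg_trans.
  apply: near_eq_cvg; near=> r => /=.
  by rewrite -of_realV vcZ vcB [r *: 1]mulr1 zE.
apply: DeriveDef; first by apply/cvg_ex; exists (vc ('D_H G z) j).
exact: cvg_lim.
Unshelve. all: by end_near. Qed.

End Coordinates.

(** * The nonlinearity in real coordinates *)

Section TaylorBounds.
Context {R : realType} {J : finType}.
Context (N : (J -> R) -> R -> J -> R) (DN : (J -> R) -> R -> J -> J -> R)
  (D2N : (J -> R) -> R -> J -> J -> J -> R) (rho C : R).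
Hypothesis C0 : 0 <= C.
Hypothesis dN : forall c d x j (t : R),
  is_derive t (1 : R) (fun t => N (fun l => c l + t * d l) x j)
    (\sum_l DN (fun l => c l + t * d l) x j l * d l).
Hypothesis dDN : forall c d x j i (t : R),
  is_derive t (1 : R) (fun t => DN (fun l => c l + t * d l) x j i)
    (\sum_l D2N (fun l => c l + t * d l) x j i l * d l).
Hypothesis bDN : forall c x j l, (forall i, `|c i| <= rho + 1) -> `|DN c x j l| <= C.
Hypothesis bD2N : forall c x j i l, (forall i, `|c i| <= rho + 1) -> `|D2N c x j i l| <= C.

Lemma mean_value (f df : R -> R) : (forall t, is_derive t (1 : R) f (df t)) ->
  exists2 t : R, 0 <= t <= 1 & f 1 - f 0 = df t.
Proof.
move=> fd; have [|t] := @MVT R f df 0 1 ltr01 (fun t _ => fd t).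
  apply: derivable_within_continuous => t _.
  exact: (@ex_derive _ _ _ _ _ _ _ (fd t)).
rewrite in_itv/= => /andP[/ltW t0 /ltW t1]; rewrite subr0 mulr1 => e.
by exists t => //; rewrite t0.
Qed.

Lemma segment_bound (a b : J -> R) (t r : R) : 0 <= t <= 1 ->
  (forall l, `|a l| <= r) -> (forall l, `|b l| <= r) ->
  forall l, `|a l + t * (b l - a l)| <= r.
Proof.
move=> /andP[t0 t1] ha hb l; have := ha l; have := hb l.
rewrite !ler_norml => /andP[? ?] /andP[? ?]; apply/andP; split; nra.
Qed.

Lemma sum_mul_le (u d : J -> R) c : (forall l, `|u l| <= c) ->
  `|\sum_l u l * d l| <= c * \sum_l `|d l|.
Proof.
move=> h; apply: (le_trans (ler_norm_sum _ _ _)); rewrite mulr_sumr.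
by apply: ler_sum => l _; rewrite normrM ler_wpM2r.
Qed.

Lemma lipschitz_of_derive (f : (J -> R) -> R) (g : (J -> R) -> J -> R) :
  (forall c d (t : R), is_derive t (1 : R) (fun t => f (fun l => c l + t * d l))
    (\sum_l g (fun l => c l + t * d l) l * d l)) ->
  (forall c l, (forall i, `|c i| <= rho + 1) -> `|g c l| <= C) ->
  forall z z', (forall l, `|z l| <= rho + 1) -> (forall l, `|z' l| <= rho + 1) ->
  `|f z - f z'| <= C * \sum_l `|z l - z' l|.
Proof.
move=> df bg z z' hz hz'.
have [t t01] := mean_value (df z' (fun l => z l - z' l)).
have -> : (fun l => z' l + 1 * (z l - z' l)) = z.
  by apply/funext => l; rewrite mul1r addrC subrK.
have -> : (fun l => z' l + 0 * (z l - z' l)) = z'.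
  by apply/funext => l; rewrite mul0r addr0.
move=> ->; apply: sum_mul_le => l; apply: bg; exact: segment_bound.
Qed.

Lemma N_lipschitz z z' x j : (forall l, `|z l| <= rho) -> (forall l, `|z' l| <= rho) ->
  `|N z x j - N z' x j| <= C * \sum_l `|z l - z' l|.
Proof.
move=> hz hz'; have le1 y : y <= rho -> y <= rho + 1 by move=> h; rewrite ler_wpDr.
apply: (lipschitz_of_derive (f := fun c => N c x j) (g := fun c => DN c x j)) => //.
- by move=> *; exact: bDN.
- by move=> l; apply: le1.
- by move=> l; apply: le1.
Qed.

Lemma DN_lipschitz z z' x j i : (forall l, `|z l| <= rho + 1) -> (forall l, `|z' l| <= rho + 1) ->
  `|DN z x j i - DN z' x j i| <= C * \sum_l `|z l - z' l|.
Proof.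
move=> hz hz'.
apply: (lipschitz_of_derive (f := fun c => DN c x j i) (g := fun c => D2N c x j i)) => //.
by move=> *; exact: bD2N.
Qed.

(** Mean value theorem on the segment from [z + q] to [z + p], then the Lipschitz bound for [DN]
    between the intermediate point and [z], whose distance is a convex combination of [p] and
    [q]. *)
Lemma N_taylor z p q x j : (forall l, `|z l| <= rho) ->
  (forall l, `|p l| <= 1) -> (forall l, `|q l| <= 1) ->
  `|N (fun l => z l + p l) x j - N (fun l => z l + q l) x j
     - \sum_l DN z x j l * (p l - q l)| <=
  C * (\sum_l `|p l| + \sum_l `|q l|) * \sum_l `|p l - q l|.
Proof.
move=> hz hp hq; have le1 y : y <= rho -> y <= rho + 1 by move=> h; rewrite ler_wpDr.
have [t t01] := mean_value (dN (fun l => z l + q l) (fun l => p l - q l) x j).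
have -> : (fun l => z l + q l + 1 * (p l - q l)) = (fun l => z l + p l).
  by apply/funext => l; rewrite mul1r -addrA (addrC (q l)) subrK.
have -> : (fun l => z l + q l + 0 * (p l - q l)) = (fun l => z l + q l).
  by apply/funext => l; rewrite mul0r addr0.
move=> ->; rewrite -sumrB; under eq_bigr do rewrite -mulrBl.
apply: sum_mul_le => l.
have hs i : `|q i + t * (p i - q i)| <= 1 by exact: segment_bound.
apply: (le_trans (DN_lipschitz x j l _ _)) => [i|i|].
- rewrite -addrA; apply: (le_trans (ler_normD _ _)); exact: lerD.
- exact: le1.
rewrite ler_wpM2l// -big_split/=; apply: ler_sum => i _.
rewrite -(addrA (z i)) addrAC subrr add0r.
case/andP: t01 => t0 t1.
have -> : q i + t * (p i - q i) = t * p i + (1 - t) * q i by move: (p i) (q i) => y y'; ring.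
have t1' : 0 <= 1 - t by rewrite subr_ge0.
apply: (le_trans (ler_normD _ _)); rewrite !normrM (ger0_norm t0) (ger0_norm t1').
by apply: lerD; rewrite ler_piMl// lerBlDr lerDl.
Qed.

End TaylorBounds.

(** * Measurability of superpositions *)

Section Superposition.
Context {R : realType} {J : finType} (N : (J -> R) -> R -> R).
Hypothesis cN : continuous (fun p : 'rV[R]_#|J| * R => N (fun j => p.1 0 (enum_rank j)) p.2).

Let round (p : nat) (y : R) : R := (Num.floor (y * p.+1%:R))%:~R / p.+1%:R.

Let round_cvg y : (fun p => round p y) @ \oo --> y.
Proof.
apply/cvgrPdist_le => e e0; near=> p.
have p0 : 0 < (p.+1%:R : R) by rewrite ltr0n.
have hf := floor_le (y * p.+1%:R); have hf' := floorD1_gt (y * p.+1%:R).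
have -> : y - round p y = (y * p.+1%:R - (Num.floor (y * p.+1%:R))%:~R) / p.+1%:R.
  by rewrite /round mulrBl mulfK ?gt_eqF.
rewrite normrM ger0_norm ?subr_ge0// normrV ?unitfE ?gt_eqF// ger0_norm ?ler0n//.
apply: (@le_trans _ _ p.+1%:R^-1).
  rewrite ler_piMl ?invr_ge0 ?ler0n// lerBlDl; apply: ltW; move: hf'.
  by rewrite intrD.
by near: p; have := near_infty_natSinv_lt (PosNum e0); apply: filterS => n; exact: ltW.
Unshelve. all: by end_near. Qed.

Lemma measurable_floor_level (f : R -> R) (c : int) : measurable_fun setT f ->
  measurable [set x | Num.floor (f x) = c].
Proof.
move=> mf; have -> : [set x | Num.floor (f x) = c] = f @^-1` `[c%:~R, (c + 1)%:~R[%classic.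
  apply/seteqP; split => x /=; rewrite in_itv/=; last exact: floor_def.
  by move=> <-; exact: floor_itv.
rewrite -[X in measurable X]setTI; apply: mf => //; exact: measurable_itv.
Qed.

(** Rounding the arguments down to the grid of mesh [1 / p.+1] gives functions with countably many
    values. On each level set the superposition is continuous in [x] alone, and continuity of [N]
    passes to the limit in [p]. *)
Lemma measurable_superposition (U : J -> R -> R) : (forall j, measurable_fun setT (U j)) ->
  measurable_fun setT (fun x => N (fun j => U j x) x).
Proof.
move=> mU; apply: (measurable_fun_cvg (h := fun p x => N (fun j => round p (U j x)) x)).
- move=> p _ B mB; rewrite setTI.
  pose A (c : {ffun J -> int}) := [set x : R | forall j, Num.floor (U j x * p.+1%:R) = c j].
  pose G (c : {ffun J -> int}) (x : R) := N (fun j => (c j)%:~R / p.+1%:R) x.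
  have -> : (fun x => N (fun j => round p (U j x)) x) @^-1` B = \bigcup_c (A c `&` G c @^-1` B).
    apply/seteqP; split => x /=.
      move=> hx; exists [ffun j => Num.floor (U j x * p.+1%:R)] => //; split.
        by move=> j; rewrite ffunE.
      by rewrite /G /=; under eq_fun do rewrite ffunE.
    move=> [c _ [hA hG]]; move: hG; rewrite /G /=.
    suff -> : (fun j => (c j)%:~R / p.+1%:R) = (fun j => round p (U j x)) by [].
    by apply/funext => j; rewrite /round hA.
  apply: countable_bigcupT_measurable => [|c]; first exact: countableP.
  apply: measurableI.
    have -> : A c = \bigcap_(j in [set: J]) [set x | Num.floor (U j x * p.+1%:R) = c j].
      by apply/seteqP; split => x /= h j; [move=> _|]; exact: h.
    apply: fin_bigcap_measurable; first exact: finite_finset.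
    by move=> j _; apply: measurable_floor_level; apply: measurable_funM.
  have cG : continuous (G c).
    pose v : 'rV[R]_#|J| := \row_i ((c (enum_val i))%:~R / p.+1%:R).
    have -> : G c = (fun p : 'rV[R]_#|J| * R => N (fun j => p.1 0 (enum_rank j)) p.2) \o
        (fun x => (v, x)).
      by apply/funext => x; rewrite /G /=; congr N; apply/funext => j; rewrite mxE enum_rankK.
    move=> x; apply: continuous_comp; last exact: cN.
    have c1 : (fun _ : R => v) y @[y --> x] --> v by exact: cvg_cst.
    have c2 : y @[y --> x] --> x by exact: cvg_id.
    exact: (cvg_pair c1 c2).
  rewrite -[X in measurable X]setTI; exact: (continuous_measurable_fun cG).
- move=> x _; pose v (f : J -> R) : 'rV[R]_#|J| := \row_i f (enum_val i).
  have E f : N f x = (fun p : 'rV[R]_#|J| * R => N (fun j => p.1 0 (enum_rank j)) p.2) (v f, x).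
    by congr (N _ _); apply/funext => j; rewrite /= mxE enum_rankK.
  rewrite E; under eq_fun do rewrite E.
  have cv : (fun p => v (fun j => round p (U j x))) @ \oo --> v (fun j => U j x).
    move=> B [P hP PB]; have HP : \forall p \near \oo, forall i j,
        P i j (v (fun j => round p (U j x)) i j).
      apply: filter_forall => i; apply: filter_forall => j.
      have := hP i j; rewrite mxE => hij; have := round_cvg hij.
      have e p : v (fun j => round p (U j x)) i j = round p (U (enum_val j) x) by rewrite mxE.
      by move=> H; near=> p; rewrite e; near: p; exact: H.
    by apply: filterS HP => p hp; apply: PB.
  have cp : (v (fun j => round p (U j x)), x) @[p --> \oo] --> (v (fun j => U j x), x).
    have c2 : (fun _ : nat => x) p @[p --> \oo] --> x by exact: cvg_cst.
    exact: (cvg_pair cv c2).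
  exact: (@cvg_comp _ _ _ _ (fun p : 'rV[R]_#|J| * R => N (fun j => p.1 0 (enum_rank j)) p.2)
    _ _ _ cp (@cN (v (fun j => U j x), x))).
Unshelve. all: by end_near. Qed.

End Superposition.

(** * Bounds for continuous periodic functions *)

Section PeriodicBounds.
Context {R : realType} (T : R).
Hypothesis T0 : 0 < T.

(** Two cases, because [T *+ n] only takes natural multiples. *)
Lemma reduce_period (x : R) : exists2 y : R, 0 <= y <= T &
  exists n : nat, x = y + T *+ n \/ y = x + T *+ n.
Proof.
pose q := Num.floor (x / T).
have hq : 0 <= x - q%:~R * T <= T.
  have /andP[h1 h2] := floor_itv (x / T); rewrite -/q in h1 h2.
  rewrite subr_ge0 -ler_pdivlMr// h1/= lerBlDr -[X in X + _]mul1r -mulrDl addrC.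
  by rewrite -ler_pdivrMr// ltW// -[1]/(1%:~R) -intrD.
exists (x - q%:~R * T) => //; exists (`|q|)%N.
have [q0|q0] := leP 0 q.
  left; rewrite -[T *+ _]mulr_natl -[(`|q|%N)%:R]/((Posz `|q|%N)%:~R) gez0_abs//.
  by rewrite subrK.
right; rewrite -[T *+ _]mulr_natl -[(`|q|%N)%:R]/((Posz `|q|%N)%:~R) ltz0_abs//.
by rewrite mulrNz mulNr.
Qed.

Lemma periodic_reduce (W : Type) (f : R -> W) : (forall x, f (x + T) = f x) ->
  forall x, exists2 y, 0 <= y <= T & f x = f y.
Proof.
move=> pf x; have [y yT [n hn]] := reduce_period x; exists y => //.
by case: hn => ->; rewrite (per_shift pf).
Qed.

Lemma periodic_bounded (f : R -> R) : continuous f -> (forall x, f (x + T) = f x) ->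
  exists2 C : R, 0 <= C & forall x, `|f x| <= C.
Proof.
move=> cf pf; have [C [Cr HC]] := compact_bounded (continuous_compact
  (continuous_subspaceT cf) (@segment_compact _ 0 T)).
exists (`|C| + 1); first by rewrite addr_ge0.
move=> x; have [y yT ->] := periodic_reduce pf x.
apply: (HC (`|C| + 1)); first by rewrite ltr_pwDr// ler_norm.
by exists y => //=; rewrite in_itv.
Qed.

Lemma common_bound (I : finType) (P : I -> R -> Prop) :
  (forall i c c', c <= c' -> P i c -> P i c') ->
  (forall i, exists2 c : R, 0 <= c & P i c) -> exists2 c : R, 0 <= c & forall i, P i c.
Proof.
move=> mono /fin_all_exists2[c c0 H]; exists (\sum_i c i); first exact: sumr_ge0.
move=> i; apply: mono (H i); rewrite (bigD1 i)//= lerDl; exact: sumr_ge0.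
Qed.

End PeriodicBounds.

(** * Continuity of determinants and inverses *)

Section ContinuousMatrices.
Context {K : numFieldType} {X : topologicalType}.

Lemma continuous_det n (A : X -> 'M[K]_n) : (forall i j, continuous (fun x => A x i j)) ->
  continuous (fun x => \det (A x)).
Proof.
move=> cA; rewrite /determinant.
apply: continuous_big => [|p _]; first exact: add_continuous.
have H : continuous (fun x => \prod_i A x i (perm.fun_of_perm p i)).
  apply: continuous_big => [|i _]; last exact: cA.
  exact: mul_continuous.
by move=> x; exact: continuousM (@cst_continuous _ _ _ x) (H x).
Qed.

(** By the cofactor formula the entries of the inverse are quotients of determinants. *)
Lemma continuous_invmx n (A : X -> 'M[K]_n) : (forall i j, continuous (fun x => A x i j)) ->
  (forall x, A x \in unitmx) -> forall i j, continuous (fun x => invmx (A x) i j).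
Proof.
move=> cA uA i j.
have -> : (fun x => invmx (A x) i j) = (fun x => (\det (A x))^-1 * cofactor (A x) j i).
  by apply/funext => x; rewrite /invmx uA !mxE.
move=> x; apply: (@continuousM K X (fun x => (\det (A x))^-1) (fun x => cofactor (A x) j i)).
  apply: continuousV; last exact: continuous_det.
  by have := uA x; rewrite unitmxE unitfE.
rewrite /cofactor; apply: (@continuousM K X (fun=> (-1) ^+ (j + i))
  (fun x => \det (row' j (col' i (A x))))); first exact: cvg_cst.
apply: continuous_det => p q; have -> : (fun x => row' j (col' i (A x)) p q) =
    (fun x => A x (lift j p) (lift i q)) by apply/funext => y; rewrite !mxE.
exact: cA.
Qed.

End ContinuousMatrices.

(** * Coefficients and nonlinearity in real coordinates *)

Section RealForm.
Context {R : realType} (s : field_kind) (m k : nat) (T : R).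
Local Notation F := (scalar_field R s).
Local Notation J := (coords s m).
Context (alpha : nat -> R -> 'M[F]_m) (N : 'cV[F]_m -> R -> 'cV[F]_m).
Hypotheses (T0 : 0 < T) (k0 : (0 < k)%N).
Hypothesis alpha_cont : forall i, (1 <= i <= k)%N -> continuous (alpha i).
Hypothesis alpha_per : forall i, (1 <= i <= k)%N -> periodic (alpha i) T.
Hypothesis alpha_inv : forall x, alpha k x \in unitmx.
Hypothesis N_cont : continuous (fun p : 'cV[F]_m * R => N p.1 p.2).
Hypothesis N_C2 : C2_first_argument N.
Hypothesis N_per : forall u, periodic (N u) T.

(** Entry of the real matrix of multiplication by [A]; for complex scalars each entry of [A] becomes
    a 2 by 2 block. *)
Definition mat_coef (A : 'M[F]_m) (j l : J) : R := vc (A *m vbase l) j.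

Definition acoef i x (j l : J) : R := mat_coef (alpha i x) j l.

Definition Nr (c : J -> R) x (j : J) : R := vc (N (build c) x) j.

Definition DNr (c : J -> R) x (j l : J) : R := vc ('d (N^~ x) (build c) (vbase l)) j.

Definition D2Nr (c : J -> R) x (j i l : J) : R :=
  vc ('d (fun y => 'd (N^~ x) y (vbase i)) (build c) (vbase l)) j.

Lemma vc_mulmx (A : 'M[F]_m) z j : vc (A *m z) j = \sum_l mat_coef A j l * vc z l.
Proof. exact: (vc_linear (mulmx A)). Qed.

Lemma continuous_mat_coef (A : R -> 'M[F]_m) j l : (forall p q, continuous (fun x => A x p q)) ->
  continuous (fun x => mat_coef (A x) j l).
Proof.
move=> cA; rewrite /mat_coef /vc; under eq_fun do rewrite mxE.
move=> x; apply: (@continuous_comp _ _ _ (fun x => \sum_q A x j.1 q * vbase l q 0)).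
  apply: continuous_big => [|q _]; first exact: add_continuous.
  by move=> y; apply: continuousM; [exact: cA|exact: cvg_cst].
exact: continuous_scalar_coord.
Qed.

Lemma alpha_entry i p q : (1 <= i <= k)%N -> continuous (fun x => alpha i x p q).
Proof.
move=> ik x; apply: (@continuous_comp _ _ _ (alpha i) (fun A : 'M[F]_m => A p q)).
  exact: alpha_cont.
exact: coord_continuous.
Qed.

Lemma acoef_continuous i j l : (1 <= i <= k)%N -> continuous (fun x => acoef i x j l).
Proof. by move=> ik; apply: continuous_mat_coef => p q; exact: alpha_entry. Qed.

Lemma acoef_measurable i j l : (1 <= i <= k)%N -> measurable_fun setT (fun x => acoef i x j l).
Proof. by move=> ik; apply: continuous_measurable_fun; exact: acoef_continuous. Qed.

Lemma acoef_periodic i x : (1 <= i <= k)%N -> acoef i (x + T) = acoef i x.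
Proof. by move=> ik; rewrite /acoef alpha_per. Qed.

Lemma acoef_bounded : exists2 B : R, 0 <= B & coefs_bounded k acoef B.
Proof.
have [||B B0 H] := @common_bound R ('I_k * J * J)%type
  (fun t c => forall x, `|acoef t.1.1.+1 x t.1.2 t.2| <= c).
- by move=> t c c' cc' h x; apply: le_trans cc'.
- move=> t; have tk : (1 <= t.1.1.+1 <= k)%N by rewrite /= ltn_ord.
  apply: (periodic_bounded T0); first exact: acoef_continuous.
  by move=> x; rewrite acoef_periodic.
exists B => // -[//|i] x j l ik; exact: (H ((Ordinal (ik : (i < k)%N)), j, l)).
Qed.

(** The entries of the inverse leading matrix are continuous and periodic, hence bounded. *)
Lemma acoef_elliptic : exists2 B : R, 0 <= B & elliptic k acoef B.
Proof.
have kk : (1 <= k <= k)%N by rewrite k0 leqnn.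
have [||B B0 H] := @common_bound R (J * J)%type
  (fun t c => forall x, `|mat_coef (invmx (alpha k x)) t.1 t.2| <= c).
- by move=> t c c' cc' h x; apply: le_trans cc'.
- move=> t; apply: (periodic_bounded T0).
    apply: continuous_mat_coef => p q; apply: continuous_invmx => // p' q'.
    exact: alpha_entry.
  by move=> x; rewrite alpha_per.
exists B => // x z j.
have -> : z j = \sum_l mat_coef (invmx (alpha k x)) j l * \sum_l' acoef k x l l' * z l'.
  transitivity (vc (invmx (alpha k x) *m (alpha k x *m build z)) j).
    by rewrite mulmxA mulVmx// mul1mx vc_build.
  rewrite vc_mulmx; apply: eq_bigr => l _; congr (_ * _); rewrite vc_mulmx.
  by apply: eq_bigr => l' _; rewrite vc_build.
rewrite mulr_sumr; apply: (le_trans (ler_norm_sum _ _ _)); apply: ler_sum => l _.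
by rewrite normrM ler_wpM2r//; exact: (H (j, l)).
Qed.

Lemma coefficients : exists2 B : R, 0 <= B & coefs_bounded k acoef B /\ elliptic k acoef B.
Proof.
have [B B0 H] := acoef_bounded; have [B' B'0 H'] := acoef_elliptic.
exists (B + B'); first exact: addr_ge0.
split => [i x j l ik|x z j]; first by apply: (le_trans (H _ _ _ _ ik)); rewrite lerDl.
by apply: (le_trans (H' x z j)); rewrite ler_wpM2r ?lerDr// sumr_ge0.
Qed.

Lemma N_shift x : N^~ (x + T) = N^~ x.
Proof. by apply/funext => u; rewrite N_per. Qed.

Lemma Nr_periodic c x : Nr c (x + T) = Nr c x.
Proof. by rewrite /Nr N_per. Qed.

Lemma DNr_periodic c x : DNr c (x + T) = DNr c x.
Proof. by rewrite /DNr N_shift. Qed.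

Lemma D2Nr_periodic c x : D2Nr c (x + T) = D2Nr c x.
Proof. by rewrite /D2Nr N_shift. Qed.

Lemma Nr_derive c d x j (t : R) :
  is_derive t (1 : R) (fun t => Nr (fun l => c l + t * d l) x j)
    (\sum_l DNr (fun l => c l + t * d l) x j l * d l).
Proof. by apply: derive_along => z; case: N_C2. Qed.

Lemma DNr_derive c d x j i (t : R) :
  is_derive t (1 : R) (fun t => DNr (fun l => c l + t * d l) x j i)
    (\sum_l D2Nr (fun l => c l + t * d l) x j i l * d l).
Proof.
apply: (derive_along (G := fun y => 'd (N^~ x) y (vbase i))) => z.
by case: N_C2 => _ _ H _; exact: H.
Qed.

(** Periodicity reduces [x] to one period, and a box times [[0, T]] is compact. *)
Lemma bounded_periodic_box (f : (J -> R) -> R -> R) (g : 'cV[F]_m * R -> R) rho :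
  continuous g -> (forall c x, f c x = g (build c, x)) -> (forall c x, f c (x + T) = f c x) ->
  exists2 C : R, 0 <= C & forall c x, (forall i, `|c i| <= rho) -> `|f c x| <= C.
Proof.
move=> cg fg pf; have [C C0 HC] := bounded_on_box rho T cg.
exists C => // c x hc; have [y yT ->] := periodic_reduce T0 (pf c) x.
by rewrite fg; exact: HC.
Qed.

Lemma derivative_bounds rho : exists2 C : R, 0 <= C &
  (forall c x j l, (forall i, `|c i| <= rho) -> `|DNr c x j l| <= C) /\
  (forall c x j i l, (forall i, `|c i| <= rho) -> `|D2Nr c x j i l| <= C).
Proof.
case: N_C2 => _ cD _ cD2.
have [||C C0 H] := @common_bound R (J * J)%type
  (fun t C => forall c x, (forall i, `|c i| <= rho) -> `|DNr c x t.1 t.2| <= C).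
- by move=> t c c' cc' h u x hu; apply: le_trans cc'; exact: h.
- move=> t; pose g (p : 'cV[F]_m * R) := vc ('d (N^~ p.2) (p.1) (vbase t.2)) t.1.
  have cg : continuous g.
    move=> p; apply: (@continuous_comp _ _ _ (fun p : 'cV[F]_m * R => 'd (N^~ p.2) (p.1) (vbase t.2))
      (fun z => vc z t.1)); first exact: cD.
    exact: continuous_vc.
  apply: (bounded_periodic_box rho cg (f := fun c x => DNr c x t.1 t.2)).
    by move=> c x; rewrite /DNr /g.
  by move=> c x; rewrite DNr_periodic.
have [||C' C'0 H'] := @common_bound R (J * J * J)%type
  (fun t C => forall c x, (forall i, `|c i| <= rho) -> `|D2Nr c x t.1.1 t.1.2 t.2| <= C).
- by move=> t c c' cc' h u x hu; apply: le_trans cc'; exact: h.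
- move=> t; pose g (p : 'cV[F]_m * R) :=
    vc ('d (fun y => 'd (N^~ p.2) y (vbase t.1.2)) (p.1) (vbase t.2)) t.1.1.
  have cg : continuous g.
    move=> p; apply: (@continuous_comp _ _ _ (fun p : 'cV[F]_m * R =>
      'd (fun y => 'd (N^~ p.2) y (vbase t.1.2)) (p.1) (vbase t.2)) (fun z => vc z t.1.1)).
      exact: cD2.
    exact: continuous_vc.
  apply: (bounded_periodic_box rho cg (f := fun c x => D2Nr c x t.1.1 t.1.2 t.2)).
    by move=> c x; rewrite /D2Nr /g.
  by move=> c x; rewrite D2Nr_periodic.
exists (C + C'); first exact: addr_ge0.
split => [c x j l hc|c x j i l hc].
  by apply: (le_trans (H (j, l) c x hc)); rewrite lerDl.
by apply: (le_trans (H' (j, i, l) c x hc)); rewrite lerDr.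
Qed.

Lemma Nr_superposition (U : J -> R -> R) : (forall j, measurable_fun setT (U j)) ->
  forall j, measurable_fun setT (fun x => Nr (fun l => U l x) x j).
Proof.
move=> mU j; apply: (measurable_superposition (N := fun c x => Nr c x j)) => //.
move=> p; apply: (@continuous_comp _ _ _ (fun p : 'rV[R]_#|J| * R => N (rebuild p.1) p.2)
  (fun z => vc z j)); last exact: continuous_vc.
apply: (@continuous_comp _ _ _ (fun p : 'rV[R]_#|J| * R => (rebuild p.1, p.2))
  (fun p : 'cV[F]_m * R => N p.1 p.2)); last exact: N_cont.
exact: continuous_rebuild_pair.
Qed.

End RealForm.

(** * Function spaces in coordinates *)

Section ScalarSpaces.
Context {R : realType}.
Local Notation mu := (@lebesgue_measure R).
Implicit Types (f g : R -> R).

Lemma Lfun2P f : f \in Lfun mu 2%:E <-> L2 f.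
Proof.
have E : n2 f = ('N[mu]_2%:E[EFin \o f] `^ 2)%E.
  rewrite poweR_Lnorm//; apply: eq_integral => x _ /=.
  by rewrite powR_mulrn ?normr_ge0// real_normK ?num_real.
split.
  move=> /andP[/set_mem mf /set_mem fin]; split; first exact: mf.
  by rewrite E; apply: poweR_lty.
move=> [mf fin]; apply/andP; split; apply: mem_set; first exact: mf.
rewrite /finite_norm/= ltNge leye_eq; apply/negP => /eqP N.
by move: fin; rewrite E N poweRyr ?ltxx.
Qed.

Lemma Lfun_oo_bounded f : f \in Lfun mu +oo%E ->
  measurable_fun setT f /\ exists2 r : R, 0 <= r & aeR (fun x => `|f x| <= r).
Proof.
move=> /andP[/set_mem mf /set_mem fin]; split; first exact: mf.
have m0 : (0 < mu [set: R])%E.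
  apply: (@lt_le_trans _ _ (mu `[0, 1]%classic)).
    by rewrite lebesgue_measure_itv/= lte_fin ltr01 sube0 lte_fin ltr01.
  by apply: le_measure; rewrite ?inE//; exact: measurable_itv.
move: fin; rewrite /finite_norm unlock /= m0.
have := ess_sup_inf.ess_sup_ge mu (abse \o (EFin \o f)).
case: (ess_sup_inf.ess_sup _ _) => [r| |]// H _.
- exists `|r|; first exact: normr_ge0.
  by apply: aeRS H => x /=; rewrite lee_fin => /le_trans; apply; exact: ler_norm.
- by exists 0 => //; apply: aeRS H => x /=; rewrite leeNy_eq.
Qed.

(** Turns local square integrability into membership of the truncations in [L2], so that the results
    on [L2] apply. *)
Definition clip (r : R) f : R -> R := fun x => (`|x| <= r)%R%:R * f x.

Lemma clipE r f : clip r f = f \_ `[- r, r]%classic.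
Proof.
apply/funext => x; rewrite /clip patchE; case: ifPn.
  by rewrite inE /= in_itv/= -ler_norml => ->; rewrite mul1r.
by rewrite notin_setE /= in_itv/= -ler_norml => /negP/negbTE ->; rewrite mul0r.
Qed.

Lemma measurable_clip r f : measurable_fun setT f -> measurable_fun setT (clip r f).
Proof.
move=> mf; rewrite clipE; apply/(measurable_restrictT _ _).1; first exact: measurable_itv.
exact: measurable_funTS.
Qed.

Lemma square_integrable_locP f : square_integrable_loc f <->
  measurable_fun setT f /\ forall r : R, L2 (clip r f).
Proof.
have E r : n2 (clip r f) = (\int[mu]_(x in `[(- r)%R, r]%classic) (f x ^+ 2)%:E)%E.
  rewrite /n2 [RHS]integral_mkcond clipE; apply: eq_integral => x _.
  by rewrite !patchE; case: ifP => // _; rewrite expr0n.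
split => -[mf H]; split => //.
  move=> r; split; first exact: measurable_clip.
  by rewrite E; apply: H; exact: segment_compact.
move=> K cK; have [C [_ HC]] := compact_bounded cK.
have [_ fin] := H (`|C| + 1).
apply: le_lt_trans fin; rewrite E; apply: ge0_subset_integral.
- exact: closed_measurable (compact_closed (@norm_hausdorff _ _) cK).
- exact: measurable_itv.
- by apply: measurable_funTS; exact: measurable_sqr.
- by move=> x _; rewrite lee_fin sqr_ge0.
- move=> x Kx; rewrite /= in_itv/= -ler_norml; apply: (HC (`|C| + 1)) => //.
  by rewrite ltr_pwDr// ler_norm.
Qed.

Lemma L2_square_integrable_loc f : L2 f -> square_integrable_loc f.
Proof.
move=> lf; apply/square_integrable_locP; split; first exact: L2_measurable.
move=> r; apply: (L2_dom1 (g := f) (c := 1)) => //.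
  by apply: measurable_clip; exact: L2_measurable.
apply: aeR_all => x; rewrite /clip normrM ler_wpM2r// ger0_norm//.
by case: (`|x| <= r).
Qed.

Lemma square_integrable_locD f g : square_integrable_loc f -> square_integrable_loc g ->
  square_integrable_loc (fun x => f x + g x).
Proof.
move=> /square_integrable_locP[mf hf] /square_integrable_locP[mg hg].
apply/square_integrable_locP; split; first exact: measurable_funD.
by move=> r; have := L2D (hf r) (hg r); rewrite /clip; under eq_fun do rewrite -mulrDr.
Qed.

Lemma square_integrable_loc0 : square_integrable_loc (fun _ : R => 0).
Proof. by apply: L2_square_integrable_loc; exact: L2_cst0. Qed.

Lemma square_integrable_loc_sum (I : Type) (s : seq I) (f : I -> R -> R) :
  (forall i, square_integrable_loc (f i)) ->
  square_integrable_loc (fun x => \sum_(i <- s) f i x).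
Proof.
move=> hf; elim: s => [|i s IH].
  by under eq_fun do rewrite big_nil; exact: square_integrable_loc0.
by under eq_fun do rewrite big_cons; exact: square_integrable_locD.
Qed.

Lemma square_integrable_locM (chi f : R -> R) : continuous chi -> square_integrable_loc f ->
  square_integrable_loc (fun x => chi x * f x).
Proof.
move=> cc /square_integrable_locP[mf hf]; apply/square_integrable_locP; split.
  by apply: measurable_funM => //; exact: continuous_measurable_fun.
move=> r; have [C C0 hC] := continuous_bounded_ball r cc.
apply: (L2_dom1 (g := clip r f) (c := C)) => //.
  apply: measurable_clip; apply: measurable_funM => //; exact: continuous_measurable_fun.
apply: aeR_all => x; rewrite /clip; case: (leP `|x| r) => [xr|_]; last by rewrite !mul0r normr0 mulr0.
by rewrite !mul1r normrM ler_wpM2r// hC.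
Qed.

Lemma square_integrable_loc_shift c f : square_integrable_loc f ->
  square_integrable_loc (fun x => f (x + c)).
Proof.
move=> /square_integrable_locP[mf hf]; apply/square_integrable_locP; split.
  exact: measurable_fun_shift.
move=> r; apply: (L2_dom1 (g := fun x => clip (r + `|c|) f (x + c)) (c := 1)).
- by apply: measurable_clip; exact: measurable_fun_shift.
- exact: L2_shift.
apply: aeR_all => x; rewrite /clip mul1r; case: (leP `|x| r) => [xr|_]; last by rewrite mul0r normr0.
by rewrite (le_trans (ler_normD _ _))// lerD2r.
Qed.

Lemma jet_mul_square_integrable_loc k chi (u : nat -> R -> R) i : smooth chi ->
  (forall p, (p <= k)%N -> square_integrable_loc (u p)) -> (i <= k)%N ->
  square_integrable_loc (jet_mul chi u i).
Proof.
elim: i k chi u => [|i IH] k chi u sc hu ik /=.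
  by apply: square_integrable_locM; [exact: smooth_continuous|exact: hu].
case: k hu ik => // k hu ik; apply: square_integrable_locD.
  by apply: (IH k _ _ (smooth_derive1 sc) _ ik) => p pk; apply: hu; exact: leqW.
by apply: (IH k _ _ sc _ ik) => p pk; exact: hu.
Qed.

End ScalarSpaces.

Lemma Rintegral_sum (R : realType) (I : Type) (s : seq I) (D : set R) (f : I -> R -> R) :
  measurable (D : set (measurableTypeR R)) ->
  (forall i, (@lebesgue_measure R).-integrable D (EFin \o f i)) ->
  \int[@lebesgue_measure R]_(x in D) (\sum_(i <- s) f i x) =
  \sum_(i <- s) \int[@lebesgue_measure R]_(x in D) f i x.
Proof.
move=> mD hf; have := @integral_sum _ _ _ (@lebesgue_measure R) D mD I (fun i => EFin \o f i) hf s xpredT.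
rewrite /Rintegral => E.
rewrite (_ : \int[lebesgue_measure]_(x in D) (\sum_(i <- s) f i x)%:E =
   \int[lebesgue_measure]_(x in D) (\sum_(i <- s) (EFin \o f i) x))%E; last first.
  by apply: eq_integral => x _; rewrite -sumEFin.
rewrite E (eq_bigr (fun i => (fine (\int[lebesgue_measure]_(x in D) (f i x)%:E))%:E)).
  by rewrite sumEFin.
by move=> i _; rewrite fineK//; exact: (integrable_fin_num mD (hf i)).
Qed.

(** * Vector-valued function spaces in coordinates *)

Section VectorSpaces.
Context {R : realType} (s : field_kind) (m : nat) (h : R -> R) (sh : step_function h).
Local Notation F := (scalar_field R s).
Local Notation V := 'cV[F]_m.
Local Notation J := (coords s m).
Local Notation mu := (@lebesgue_measure R).
Implicit Types (u g : R -> V) (k : nat).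

Definition cu u (j : J) : R -> R := fun x => vc (u x) j.

Lemma coordsP (P : (R -> R) -> (R -> R) -> Prop) u g : P (fun=> 0) (fun=> 0) ->
  (forall l, P (re_coord u l) (re_coord g l) /\ P (im_coord u l) (im_coord g l)) <->
  forall j, P (cu u j) (cu g j).
Proof.
move=> P0; split => H.
  by move=> [l b]; have := (re_im_coords (fun x => u x l 0) (fun x => g x l 0) P0).1 (H l) b.
by move=> l; apply/(re_im_coords (fun x => u x l 0) (fun x => g x l 0) P0) => b; exact: (H (l, b)).
Qed.

Lemma in_L2P u : in_Lp 2%:E u <-> VL2 (cu u).
Proof.
have L0 : (fun=> 0 : R) \in Lfun mu 2%:E by apply/Lfun2P; exact: L2_cst0.
split => [H j|H].
  apply/Lfun2P; exact: (coordsP (P := fun f _ => f \in Lfun mu 2%:E) u u L0).1.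
by apply/(coordsP (P := fun f _ => f \in Lfun mu 2%:E) u u L0) => j; apply/Lfun2P.
Qed.

Lemma in_Loo_bounded u : in_Lp +oo%E u ->
  (forall j, measurable_fun setT (cu u j)) /\
  exists2 r : R, 0 <= r & aeR (fun x => forall j, `|cu u j x| <= r).
Proof.
move=> H; pose P (f g : R -> R) :=
  measurable_fun setT f /\ exists2 r : R, 0 <= r & aeR (fun x => `|f x| <= r).
have P0 : P (fun=> 0) (fun=> 0).
  by split; [exact: measurable_cst|exists 0 => //; apply: aeR_all => x; rewrite normr0].
have Hj j : P (cu u j) (cu u j).
  by apply: (coordsP u u P0).1 => l; have [h1 h2] := H l; split; exact: Lfun_oo_bounded.
split => [j|]; first by have [] := Hj j.
have [||r r0 hr] := @common_bound R J (fun j c => aeR (fun x => `|cu u j x| <= c)).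
- by move=> j c c' cc'; apply: aeRS => x hx; exact: le_trans cc'.
- by move=> j; have [] := Hj j.
by exists r => //; apply: aeR_forall_fin.
Qed.

Lemma in_L2_locP u : in_L2_loc u <-> forall j, square_integrable_loc (cu u j).
Proof.
exact: (coordsP (P := fun f _ => square_integrable_loc f) u u (square_integrable_loc0 (R := R))).
Qed.

Lemma weak_derivativeP i u g : weak_derivative i u g <->
  forall j, weak_derivative_real i (cu u j) (cu g j).
Proof. exact: (coordsP u g (weak_derivative_real_cst0 i)). Qed.

(* Level 0 is [u] itself and not [wderiv 0 u], which is only almost everywhere equal to
   [u]; with this choice [A_op] is given by the jet at every point. *)
Definition jetof u (j : J) (i : nat) : R -> R := if i is 0%N then cu u j else cu (wderiv i u) j.

Definition synth (f : J -> R -> R) : R -> V := fun x => build (fun j => f j x).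

Lemma cu_synth f j : cu (synth f) j = f j.
Proof. by apply/funext => x; rewrite /cu /synth vc_build. Qed.

Lemma wderivP i u g : weak_derivative i u g -> weak_derivative i u (wderiv i u).
Proof. by move=> H; rewrite /wderiv; case: xgetP => [y _ //|/(_ _ H)]. Qed.

Lemma jetofP k u : (0 < k)%N -> (forall i, (i <= k)%N -> exists g, weak_derivative i u g) ->
  forall j, is_jet k (jetof u j).
Proof.
move=> k0 H j.
have wd i : (i <= k)%N -> weak_derivative_real i (cu u j) (cu (wderiv i u) j).
  by move=> /H[g /wderivP/weak_derivativeP]; exact.
have li : locally_integrable setT (cu u j) by have [] := wd 0%N (leq0n _).
split => [[|i] ik //|[|i] ik /=]; first by have [] := wd i.+1 ik.
  exact: wd.
by apply: wd_unchain (wd i.+1 (ltnW ik)) (wd i.+2 ik).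
Qed.

(** [wderiv] picks some weak derivative, so an explicit jet over [u] agrees with [jetof u] only
    almost everywhere. This lemma passes between the two. *)
Lemma jetof_uniq k u (phi : J -> nat -> R -> R) : (0 < k)%N ->
  (forall j, is_jet k (phi j)) -> (forall j, aeR (fun x => phi j 0%N x = cu u j x)) ->
  (forall j, locally_integrable setT (cu u j)) ->
  (forall j, is_jet k (jetof u j)) /\
  forall j i, (i <= k)%N -> aeR (fun x => jetof u j i x = phi j i x).
Proof.
move=> k0 jphi e li.
have wd i : (i <= k)%N -> weak_derivative i u (synth (fun j => phi j i)).
  move=> ik; apply/weak_derivativeP => j; rewrite cu_synth.
  apply: weak_derivative_real_ae (is_jet_weak_derivative (jphi j) ik) _ _ _ _ => //.
    by case: (jphi j) => + _; exact.
  exact: aeR_all.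
have ju : forall j, is_jet k (jetof u j).
  by apply: jetofP => // i ik; exists (synth (fun j => phi j i)); exact: wd.
split => // j; apply: (is_jet_uniq sh) => //.
by apply: aeRS (e j) => x.
Qed.

(** The square-integrable derivative given by [in_Hk] equals the picked [wderiv] almost everywhere,
    which transfers its integrability. *)
Lemma in_Hk_jet k u : (0 < k)%N -> in_Hk k u -> VHjet k (jetof u).
Proof.
move=> k0 H j; have ju : is_jet k (jetof u j).
  by apply: jetofP => // i /H[g]; exists g.
split; last by case: ju.
move=> i ik; have [g wg /in_L2P lg] := H i ik.
apply: (L2_ae (f := cu g j)).
- exact: lg.
- exact: is_jet_measurable ju ik.
- have wu := is_jet_weak_derivative ju ik.
  exact: (weak_derivative_real_uniq sh ((weak_derivativeP i u g).1 wg j) wu).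
Qed.

Lemma jet_in_Hk k (phi : J -> nat -> R -> R) : VHjet k phi -> in_Hk k (synth (fun j => phi j 0%N)).
Proof.
move=> hp i ik; exists (synth (fun j => phi j i)).
  apply/weak_derivativeP => j; rewrite !cu_synth.
  exact: is_jet_weak_derivative (is_hjet_jet (hp j)) ik.
by apply/in_L2P => j; rewrite cu_synth; apply: (proj1 (hp j)).
Qed.

Lemma jetof_synth k (phi : J -> nat -> R -> R) : (0 < k)%N -> (forall j, is_jet k (phi j)) ->
  (forall j, is_jet k (jetof (synth (fun j => phi j 0%N)) j)) /\
  forall j i, (i <= k)%N -> aeR (fun x => jetof (synth (fun j => phi j 0%N)) j i x = phi j i x).
Proof.
move=> k0 jp; apply: jetof_uniq => // j; rewrite cu_synth; first exact: aeR_all.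
by case: (jp j) => + _; exact.
Qed.

Lemma in_Hk_loc_jet k u : (0 < k)%N -> in_Hk_loc k u ->
  (forall j, is_jet k (jetof u j)) /\
  forall j i, (i <= k)%N -> square_integrable_loc (jetof u j i).
Proof.
move=> k0 H; have ju : forall j, is_jet k (jetof u j).
  by apply: jetofP => // i /H[g]; exists g.
split => // j i ik; have [g wg /in_L2_locP lg] := H i ik.
have wu := is_jet_weak_derivative (ju j) ik.
have e := weak_derivative_real_uniq sh ((weak_derivativeP i u g).1 wg j) wu.
have mj := is_jet_measurable (ju j) ik.
have /square_integrable_locP[mg hg] := lg j.
apply/square_integrable_locP; split => // r.
apply: (L2_ae (hg r)); first exact: measurable_clip.
by apply: aeRS e => x ex; rewrite /clip ex.
Qed.

Lemma jet_in_Hk_loc k (phi : J -> nat -> R -> R) u :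
  (forall j, is_jet k (phi j)) -> (forall j i, (i <= k)%N -> square_integrable_loc (phi j i)) ->
  (forall j, cu u j = phi j 0%N) -> in_Hk_loc k u.
Proof.
move=> jp lp e i ik; exists (synth (fun j => phi j i)).
  apply/weak_derivativeP => j; rewrite cu_synth e; exact: is_jet_weak_derivative.
by apply/in_L2_locP => j; rewrite cu_synth; exact: lp.
Qed.

Lemma L2_norm_sqr Omega u (f : J -> R -> R) : measurable (Omega : set (measurableTypeR R)) ->
  VL2 f -> (forall j, measurable_fun setT (cu u j)) ->
  (forall j, aeR (fun x => cu u j x = f j x)) ->
  L2_norm Omega u ^+ 2 = \sum_j \int[mu]_(x in Omega) (f j x ^+ 2).
Proof.
move=> mO lf mu_ e; rewrite /L2_norm sqr_sqrtr; last first.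
  apply: Rintegral_ge0 => x _; rewrite sqnormE; apply: sumr_ge0 => *; exact: sqr_ge0.
have int j : mu.-integrable Omega (EFin \o (fun x => f j x ^+ 2)).
  apply: (@integrableS _ _ _ mu setT) => //.
  exact: Lfun2_integrable_sqr ((Lfun2P _).2 (lf j)).
transitivity (\int[mu]_(x in Omega) \sum_j f j x ^+ 2).
  rewrite /Rintegral; congr fine; apply: ae_eq_integral => //.
  - apply/measurable_EFinP; under eq_fun do rewrite sqnormE.
    apply: measurable_sum => j; apply: measurable_funTS; exact: (measurable_funX 2 (mu_ j)).
  - apply/measurable_EFinP; apply: measurable_sum => j; apply: measurable_funTS.
    by apply: measurable_funX; exact: L2_measurable.
  - have H := aeR_forall_fin e.
    apply: aeRS H => x hx _ /=; rewrite sqnormE; congr EFin; apply: eq_bigr => j _.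
    by rewrite -[vc _ _]/(cu u j x) hx.
exact: Rintegral_sum.
Qed.

Definition jets_sqr k Omega u : R :=
  \sum_j \sum_(i < k.+1) \int[mu]_(x in Omega) (jetof u j i x ^+ 2).

Lemma Hk_norm_sqr k Omega u : (0 < k)%N -> measurable (Omega : set (measurableTypeR R)) ->
  in_Hk k u -> Hk_norm k Omega u ^+ 2 = jets_sqr k Omega u.
Proof.
move=> k0 mO hu; rewrite /Hk_norm sqr_sqrtr; last by apply: sumr_ge0 => *; exact: sqr_ge0.
have hj := in_Hk_jet k0 hu; rewrite /jets_sqr exchange_big; apply: eq_bigr => i _.
have ik : (i <= k)%N by rewrite -ltnS.
have ww : weak_derivative i u (wderiv i u).
  by have [g wg _] := hu i ik; exact: wderivP wg.
apply: (L2_norm_sqr (f := fun j => jetof u j i)) => // j.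
- by apply: (proj1 (hj j)).
- by apply: locint_measurable; have [] := (weak_derivativeP i u _).1 ww j.
- have wj := is_jet_weak_derivative (is_hjet_jet (hj j)) ik.
  exact: (weak_derivative_real_uniq sh ((weak_derivativeP i u _).1 ww j) wj).
Qed.

Lemma Hk_norm_ge0 k Omega u : 0 <= Hk_norm k Omega u.
Proof. exact: sqrtr_ge0. Qed.

Lemma Hk_norm_setT k (phi : J -> nat -> R -> R) : (0 < k)%N -> VHjet k phi ->
  Hk_norm k setT (synth (fun j => phi j 0%N)) ^+ 2 = HH k phi.
Proof.
move=> k0 hp; rewrite Hk_norm_sqr//; last exact: jet_in_Hk.
have [jp e] := jetof_synth k0 (fun j => is_hjet_jet (hp j)).
apply: eq_bigr => j _; apply: eq_bigr => i _.
have ik : (i <= k)%N by rewrite -ltnS.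
rewrite -[LHS]/(nn (jetof (synth (fun j => phi j 0%N)) j i)); apply: nn_ae (e j i ik).
  exact: is_jet_measurable (jp j) ik.
by apply: L2_measurable; apply: (proj1 (hp j)).
Qed.

End VectorSpaces.

(** * The linearization at a front *)

Section Linearization.
Context {R : realType} (s : field_kind) (m k : nat) (T : R) (h : R -> R).
Hypotheses (sh : step_function h) (T0 : 0 < T) (k0 : (0 < k)%N).
Local Notation F := (scalar_field R s).
Local Notation J := (coords s m).
Local Notation mu := (@lebesgue_measure R).
Context (alpha : nat -> R -> 'M[F]_m) (N : 'cV[F]_m -> R -> 'cV[F]_m).
Hypothesis alpha_cont : forall i, (1 <= i <= k)%N -> continuous (alpha i).
Hypothesis alpha_per : forall i, (1 <= i <= k)%N -> periodic (alpha i) T.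
Hypothesis alpha_inv : forall x, alpha k x \in unitmx.
Hypothesis N_C2 : C2_first_argument N.
Hypothesis N_per : forall u, periodic (N u) T.

Lemma vc_A_op (u : R -> 'cV[F]_m) x j :
  vc (A_op k alpha u x) j = Aop k (acoef alpha) (jetof u) j x.
Proof.
rewrite /A_op vc_sum /Aop; apply: eq_big_nat => -[//|i] ik.
by rewrite vc_mulmx.
Qed.

Lemma vc_equation (u : R -> 'cV[F]_m) x j :
  vc (A_op k alpha u x + N (u x) x) j = Fop k (acoef alpha) (Nr N) (jetof u) j x.
Proof. by rewrite vcD vc_A_op /Fop /Nr /jetof /cu build_vc. Qed.

Variable u : R -> 'cV[F]_m.

Definition potential (x : R) (j l : J) : R := DNr N (fun l => jetof u l 0%N x) x j l.

Lemma vc_L_op phi x j :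
  vc (L_op k alpha N u phi x) j = Lop k (acoef alpha) potential (jetof phi) j x.
Proof.
rewrite vcD vc_A_op /Lop; congr (_ + _); rewrite vc_linear; apply: eq_bigr => l _.
by rewrite /potential /DNr /jetof /cu build_vc.
Qed.

Hypotheses (bu : in_Lp +oo%E u) (nu : nondegenerate_at k alpha N u).

Lemma potential_measurable j l : measurable_fun setT (fun x => potential x j l).
Proof.
have [mu_ _] := in_Loo_bounded bu.
apply: (measurable_superposition (N := fun c x => DNr N c x j l)) => //.
have [_ cD _ _] := N_C2.
move=> p; apply: (@continuous_comp _ _ _
  (fun p : 'rV[R]_#|J| * R => 'd (N^~ p.2) (rebuild p.1) (vbase l)) (fun z => vc z j));
  last exact: continuous_vc.
apply: (@continuous_comp _ _ _ (fun p : 'rV[R]_#|J| * R => (rebuild p.1, p.2))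
  (fun p : 'cV[F]_m * R => 'd (N^~ p.2) (p.1) (vbase l))); last exact: cD.
exact: continuous_rebuild_pair.
Qed.

Lemma potential_bounded : exists2 C : R, 0 <= C & aeR (fun x => forall j l, `|potential x j l| <= C).
Proof.
have [_ [r r0 hr]] := in_Loo_bounded bu.
have [C C0 [HC _]] := derivative_bounds T0 N_C2 N_per r.
by exists C => //; apply: aeRS hr => x hx j l; exact: HC.
Qed.

Lemma nondegenerate_solvable f : VL2 f -> exists2 phi, VHjet k phi &
  forall l, aeR (fun x => Lop k (acoef alpha) potential phi l x = f l x).
Proof.
move=> lf; have [hs _ _] := nu.
have [|phi hp /aeRT e] := hs (synth f); first by apply/in_L2P => j; rewrite cu_synth.
exists (jetof phi); first exact: (in_Hk_jet sh).
by move=> l; apply: aeRS e => x ex; rewrite -vc_L_op ex /synth vc_build.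
Qed.

Lemma Lop_measurable phi : VHjet k phi -> forall j,
  measurable_fun setT (Lop k (acoef alpha) potential phi j).
Proof.
move=> hp j; apply: measurable_funD.
  apply: measurable_Aop => [i j' l ik|l]; first exact: (acoef_measurable alpha_cont).
  exact: is_hjet_jet.
apply: measurable_sum => l; apply: measurable_funM; first exact: potential_measurable.
exact: L2_measurable (proj1 (hp l) 0%N (leq0n _)).
Qed.

(** Nondegeneracy bounds only the L2 norm of the solution. The potential is bounded because [u] is,
    so [a_priori] treats it as a term of order zero and lifts the bound to all orders. *)
Lemma nondegenerate_stable : exists2 CS : R, 0 <= CS & forall phi f, VHjet k phi -> VL2 f ->
  (forall l, aeR (fun x => Lop k (acoef alpha) potential phi l x = f l x)) ->
  HH k phi <= CS * NN f.
Proof.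
have [_ _ [C HC]] := nu.
have [B B0 [cb ce]] := coefficients T0 k0 alpha_cont alpha_per alpha_inv.
have [D D0 hD] := potential_bounded.
(* One constant serves as coefficient bound, as ellipticity constant and as bound for the
   potential. *)
have BD0 : 0 <= B + D by exact: addr_ge0.
have [C' C'0 ap] := a_priori (J := J) sh k0 BD0.
exists (C' * (1 + C ^+ 2)).
  by rewrite mulr_ge0 ?(ltW C'0)// addr_ge0// sqr_ge0.
move=> phi f hp lf e; rewrite -mulrA.
have ab : coefs_bounded k (acoef alpha) (B + D).
  by move=> i x j l ik; apply: (le_trans (cb _ _ _ _ ik)); rewrite lerDl.
have ae : elliptic k (acoef alpha) (B + D).
  move=> x z j; apply: (le_trans (ce x z j)).
  by rewrite ler_wpM2r ?lerDl// sumr_ge0.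
have est : aeR (fun x => forall j, `|Aop k (acoef alpha) phi j x - f j x| <=
    (B + D) * \sum_l `|phi l 0%N x|).
  have e' := aeR_forall_fin e.
  apply: aeRS2 e' hD => x ex hx j; rewrite -(ex j) /Lop opprD addrA subrr add0r normrN.
  apply: (le_trans (ler_norm_sum _ _ _)); rewrite mulr_sumr; apply: ler_sum => l _.
  by rewrite normrM ler_wpM2r// (le_trans (hx j l))// lerDr.
apply: (le_trans (ap _ ab ae phi f hp lf est)); rewrite ler_wpM2l ?(ltW C'0)//.
rewrite mulrDl mul1r lerD2l.
pose ph := synth (fun j => phi j 0%N).
have hph : in_Hk k ph by exact: jet_in_Hk.
have [jp ej] := jetof_synth sh k0 (fun j => is_hjet_jet (hp j)).
have eL j : aeR (fun x => cu (L_op k alpha N u ph) j x = f j x).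
  have H : aeR (fun x => forall j i, (i <= k)%N -> jetof ph j i x = phi j i x).
    by apply: aeR_forall_fin => l; apply: aeR_forall_nat => i; apply: aeR_imp; exact: ej.
  apply: aeRS2 H (e j) => x hx <-; rewrite /cu vc_L_op /Lop; congr (_ + _).
    by apply: eq_big_nat => i ik; apply: eq_bigr => l _; rewrite hx//; case/andP: ik.
  by apply: eq_bigr => l _; rewrite hx.
have n1 : L2_norm setT ph ^+ 2 = NN (fun j => phi j 0%N).
  apply: (L2_norm_sqr (f := fun j => phi j 0%N)) => //.
  - by move=> j; apply: (proj1 (hp j)).
  - by move=> j; rewrite cu_synth; exact: L2_measurable (proj1 (hp j) 0%N (leq0n _)).
  - by move=> j; rewrite cu_synth; exact: aeR_all.
have n2 : L2_norm setT (L_op k alpha N u ph) ^+ 2 = NN f.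
  apply: L2_norm_sqr => // j.
  have -> : cu (L_op k alpha N u ph) j = Lop k (acoef alpha) potential (jetof ph) j.
    by apply/funext => x; exact: vc_L_op.
  by apply: Lop_measurable; exact: (in_Hk_jet sh).
rewrite -n1 -n2 -exprMn.
have p1 : 0 <= L2_norm setT ph by exact: sqrtr_ge0.
(* [C] comes without a sign; the right side is nonnegative because it dominates a norm. *)
by rewrite ler_pXn2r ?nnegrE//; [exact: HC|exact: le_trans (HC _ hph)].
Qed.

End Linearization.

(** * The theorem *)

Lemma sum_sqr_le (R : realDomainType) (I : Type) (s : seq I) (f : I -> R) : (forall i, 0 <= f i) ->
  \sum_(i <- s) f i ^+ 2 <= (\sum_(i <- s) f i) ^+ 2.
Proof.
move=> f0; elim: s => [|i s IH]; first by rewrite !big_nil expr0n.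
rewrite !big_cons sqrrD -addrA lerD2l (le_trans IH)// lerDr mulrn_wge0// mulr_ge0//.
exact: sumr_ge0.
Qed.

(** Passes from the squared tails of [Etail] to the sum of norms in the theorem. The two summands
    are swapped because the former lists the right end state first and the latter the left one. *)
Lemma sum_add_le_sqr (R : realDomainType) (I : Type) (s : seq I) (f g f2 g2 : I -> R) :
  (forall i, 0 <= f i) -> (forall i, 0 <= g i) ->
  (forall i, f i ^+ 2 = f2 i) -> (forall i, g i ^+ 2 = g2 i) ->
  \sum_(i <- s) (g2 i + f2 i) <= (\sum_(i <- s) (f i + g i)) ^+ 2.
Proof.
move=> f0 g0 ef eg; apply: (@le_trans _ _ (\sum_(i <- s) (f i + g i) ^+ 2)); last first.
  by apply: sum_sqr_le => i; exact: addr_ge0.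
apply: ler_sum => i _; rewrite -ef -eg sqrrD [leLHS]addrC -addrA lerD2l lerDr.
by rewrite mulrn_wge0// mulr_ge0.
Qed.

Lemma Etail_pairs (R : realType) (J : finType) (k M : nat) (Pp Pm : nat -> J -> nat -> R -> R) r :
  Etail k M Pp Pm r = \sum_(j < M) (\sum_l \sum_(i < k.+1) tail r (Pp j.+1 l i) +
    \sum_l \sum_(i < k.+1) tail r (Pm j.+1 l i)).
Proof.
rewrite /Etail sum_sidx; apply: eq_bigr => j _; rewrite -big_split; apply: eq_bigr => l _.
by rewrite -big_split.
Qed.

Lemma far_regionE (R : realType) (T : R) n : far_region T n = outside (n%:R * T / 2 - 1).
Proof.
rewrite /far_region /outside; have -> : n%:R / 2 * T = n%:R * T / 2 by rewrite mulrAC.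
by rewrite opprB [- _ + 1]addrC.
Qed.

Section Interface.
Context {R : realType} (chip chim : R -> R).
Hypothesis hpm : partition_pm chip chim.

(** To the right of 1 the other member of the partition vanishes, so [chip] equals 1 there. *)
Lemma partition_pm_step : step_function chip.
Proof.
have [[sp p01] _ pm1 sup sum] := hpm; split => // x hx.
  apply/eqP/negPn/negP => /sup; rewrite /= in_itv/= andbT => hx'.
  by move: (lt_le_trans hx' hx); rewrite ltxx.
have m0 : chim x = 0.
  apply/eqP/negPn/negP => /sum; rewrite /= in_itv/= => hx'.
  by move: (le_lt_trans hx hx'); rewrite ltxx.
by have := pm1 x; rewrite m0 addr0.
Qed.

Lemma partition_pm_left x : x <= -1 -> chim x = 1.
Proof.
move=> hx; have [_ c0 _ _] := partition_pm_step; have [_ _ pm1 _ _] := hpm.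
by have := pm1 x; rewrite c0// add0r.
Qed.

End Interface.

Lemma front_window_lb (R : realType) (T : R) (M n j : nat) (x : R) : (2 <= M)%N ->
  (1 <= j <= M)%N -> front_window T M n j x ->
  ((j != 1)%N -> lb (n%:R * T) j - 1 < x) /\ (j != M -> x < lb (n%:R * T) j.+1 + 1).
Proof.
move=> M2 hj; rewrite /front_window /lb /=.
have e (c : R) : c * n%:R * T = c * (n%:R * T) by rewrite mulrA.
have e1 : (j.+1%:R - 1 / 2 : R) = j%:R + 1 / 2 by rewrite -natr1; field.
have [->|j1] := eqVneq j 1%N.
  rewrite in_itv/= e => hx; split => // _.
  by have -> : (2%:R - 1 / 2 : R) = 3 / 2 by field.
have [->|jM] := eqVneq j M; first by rewrite in_itv/= andbT e; split.
by rewrite in_itv/= !e e1 => /andP[].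
Qed.

Theorem theorem3p1 (R : realType) (s : field_kind) (k m : nat) (T : R)
  (alpha : nat -> R -> 'M[scalar_field R s]_m)
  (N : 'cV[scalar_field R s]_m -> R -> 'cV[scalar_field R s]_m)
  (chip chim : R -> R) (M : nat) (K : R) (chi : nat -> nat -> R -> R)
  (Z vp vm : nat -> R -> 'cV[scalar_field R s]_m)
  (hk : (0 < k)%N) (hm : (0 < m)%N) (hT : 0 < T) (hM : (2 <= M)%N)
  (halpha_cont : forall i, (1 <= i <= k)%N -> continuous (alpha i))
  (halpha_per : forall i, (1 <= i <= k)%N -> periodic (alpha i) T)
  (halpha_inv : forall x, alpha k x \in unitmx)
  (hN_cont : continuous (fun p : 'cV[scalar_field R s]_m * R => N p.1 p.2))
  (hN_C2 : C2_first_argument N)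
  (hN_per : forall u, periodic (N u) T)
  (hchi_pm : partition_pm chip chim)
  (hchi : forall n, (0 < n)%N ->
     partition_fronts k M n T K (fun j => chi j n))
  (hfront : forall j, (1 <= j <= M)%N ->
     is_front k T chip chim (Z j) (vp j) (vm j))
  (hmatch : forall j, (1 <= j < M)%N ->
     vp j = vm j.+1 %[ae (@lebesgue_measure R)])
  (hsol : forall j, (1 <= j <= M)%N -> is_solution k alpha N (Z j))
  (hnondeg : forall j, (1 <= j <= M)%N -> nondegenerate_at k alpha N (Z j)) :
  exists (C : R) (n0 : nat) (u a : nat -> R -> 'cV[scalar_field R s]_m),
    [/\ 0 < C,
        forall n, (n0 <= n)%N ->
          [/\ is_solution k alpha N (u n),
              u n = a n \+ multi_front M n T (fun j => chi j n) Z,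
              in_Hk k (a n) &
              Hk_norm k setT (a n) <=
                C * \sum_(1 <= j < M.+1)
                  (Hk_norm k (far_region T n) (cutoff_mul chim (Z j \- vm j)) +
                   Hk_norm k (far_region T n) (cutoff_mul chip (Z j \- vp j)))] &
        Hk_norm k setT (a n) @[n --> \oo] --> 0].
Proof.
have sh := partition_pm_step hchi_pm.
pose J := coords s m.
pose Zj j (l : J) := jetof (Z j) l.
pose Pp j (l : J) := jetof (cutoff_mul chip (Z j \- vp j)) l.
pose Pm j (l : J) := jetof (cutoff_mul chim (Z j \- vm j)) l.
pose vpj j (l : J) := cu (vp j) l.
pose vmj j (l : J) := cu (vm j) l.
have hPp j : (1 <= j <= M)%N -> VHjet k (Pp j).
  by move=> /hfront[_ _ _ H _]; exact: in_Hk_jet sh _ _ hk H.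
have hPm j : (1 <= j <= M)%N -> VHjet k (Pm j).
  by move=> /hfront[_ _ _ _ H]; exact: in_Hk_jet sh _ _ hk H.
have jZ j : (1 <= j <= M)%N -> (forall l, is_jet k (Zj j l)) /\
    forall l i, (i <= k)%N -> square_integrable_loc (Zj j l i).
  by move=> /hsol[H _]; exact: in_Hk_loc_jet sh _ _ hk H.
(* The fronts are finitely many, so a single sup bound, and below a single stability constant, serve
   all of them. *)
have [||rho rho0 Zrho] := @common_bound R 'I_M
  (fun t c => aeR (fun x => forall l, `|Zj t.+1 l 0%N x| <= c)).
- by move=> t c c' cc'; apply: aeRS => x hx l; exact: le_trans cc'.
- by move=> t; have [H _ _ _ _] := hfront _ (ord_front t); have [] := in_Loo_bounded H.
have [||CS CS0 hCS] := @common_bound R 'I_M (fun t c => forall phi f, VHjet k phi -> VL2 f ->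
  (forall l, aeR (fun x => Lop k (acoef alpha) (potential N (Z t.+1)) phi l x = f l x)) ->
  HH k phi <= c * NN f).
- move=> t c c' cc' H phi f hp lf e; apply: (le_trans (H phi f hp lf e)).
  by rewrite ler_wpM2r// NN_ge0.
- move=> t; have [H _ _ _ _] := hfront _ (ord_front t).
  exact: (nondegenerate_stable sh hT hk halpha_cont halpha_per halpha_inv hN_C2 hN_per H
    (hnondeg _ (ord_front t))).
have [B B0 [cb _]] := coefficients hT hk halpha_cont halpha_per halpha_inv.
(* Radius [rho + 1], because the expansion evaluates derivatives at points [z + p] with [z] bounded
   by [rho] and [p] by 1. *)
have [Lam Lam0 [bD bD2]] := derivative_bounds hT hN_C2 hN_per (rho + 1).
have hM0 : (0 < M)%N by exact: ltnW.
have K0 : 0 <= K.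
  have [_ _ _ H] := hchi 1%N isT; exact: le_trans (normr_ge0 _) (H 1%N 0%N 0 hM0 (leq0n _)).
have le1 (z : J -> R) : (forall j, `|z j| <= rho) -> forall j, `|z j| <= rho + 1.
  by move=> H j; apply: (le_trans (H j)); rewrite lerDl.
have cok n j : (0 < n)%N -> (1 <= j <= M)%N -> cutoff (chi j n).
  by move=> /hchi[H _ _ _]; exact: H.
have ordP j : (1 <= j <= M)%N -> exists t : 'I_M, t.+1 = j.
  by case: j => // j /= jM; exists (Ordinal jM).
have [|||||||||||||||||||||||||||C [n0 [C0 hcore]]] := @multifront_correction R J chip sh chim k M T K (acoef alpha) B Lam rho CS
  (Nr N) (DNr N) Zj Pp Pm vpj vmj (fun n j => chi j n) hk B0 Lam0 CS0 hT K0 hM0.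
- by case: hchi_pm => _ [].
- exact: partition_pm_left hchi_pm.
- by move=> i j l ik; exact: (acoef_measurable halpha_cont).
- exact: cb.
- exact: Nr_superposition.
- by move=> z p q x j hz hp hq;
    exact: (N_taylor Lam0 (Nr_derive hN_C2) (DNr_derive hN_C2) bD2 x j hz hp hq).
- by move=> z z' x j hz hz'; exact: (N_lipschitz (Nr_derive hN_C2) bD x j hz hz').
- move=> z z' x i j hz hz'.
  exact: (DN_lipschitz (DNr_derive hN_C2) bD2 x i j (le1 _ hz) (le1 _ hz')).
- by move=> i x ik; exact: (acoef_periodic halpha_per).
- by move=> z x; exact: (Nr_periodic hN_per).
- by move=> z x; exact: (DNr_periodic hN_per).
- by move=> n j n0 hj; have [] := cok n j n0 hj.
- by move=> n j x n0 hj; have [_ H] := cok n j n0 hj; case/andP: (H x).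
- by move=> n x n0; have [_ H _ _] := hchi n n0; have := H x; rewrite big_add1 big_mkord.
- by move=> n j i x n0 hj ik; have [_ _ _ H] := hchi n n0; exact: H.
- move=> n j x n0 hj hx; have [_ _ H _] := hchi n n0.
  exact: front_window_lb hM hj (H j hj x hx).
- by move=> j /jZ[].
- by move=> j /ordP[t <-]; exact: Zrho.
- move=> j hj; have [_ /aeRT e] := hsol j hj; apply: aeRS e => x ex l.
  by rewrite -[LHS]vc_equation ex vc0.
- exact: hPp.
- exact: hPm.
- by move=> j hj l; apply: aeR_all => x; rewrite /Pp /jetof /cu /cutoff_mul vcZ vcB.
- by move=> j hj l; apply: aeR_all => x; rewrite /Pm /jetof /cu /cutoff_mul vcZ vcB.
- by move=> j /hmatch /aeRT e l; apply: aeRS e => x; rewrite /vpj /vmj /cu => ->.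
- move=> j /hfront[_ _ [_ /aeRT e] _ _] l.
  by apply: aeRS e => x; rewrite /vmj /cu => ->.
- move=> j f hj lf; exact: (nondegenerate_solvable sh hk (hnondeg j hj) lf).
- by move=> j phi f /ordP[t <-]; exact: hCS.
(* [choice] wants a correction for every [n]; below [n0] the value 0 is a placeholder. *)
have hb : forall n, exists b : J -> nat -> R -> R, (n0 <= n)%N ->
    [/\ VHjet k b, HH k b <= C * Etail k M Pp Pm (n%:R * T / 2 - 1) &
    forall l, aeR (fun x => Fop k (acoef alpha) (Nr N)
      (fun l i y => ws M T Zj (fun n j => chi j n) n l i y + b l i y) l x = 0)].
  move=> n; have [n0n|n0n] := leqP n0 n; last by exists (fun _ _ _ => 0).
  by have [_ [b H]] := hcore n n0n; exists b.
have [b {}hb] := choice hb.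
pose a n := synth (fun j => b n j 0%N) : R -> 'cV[scalar_field R s]_m.
pose u n := a n \+ multi_front M n T (fun j => chi j n) Z.
have HkE n : (n0 <= n)%N -> Hk_norm k setT (a n) ^+ 2 <=
    C * Etail k M Pp Pm (n%:R * T / 2 - 1).
  by move=> /hb[hbn hle _]; rewrite (Hk_norm_setT sh hk hbn).
(* The core estimate bounds the squared norm, whence the square root; [n >= 1] is the range in which
   the cutoffs are given. *)
exists (Num.sqrt C), (maxn n0 1), u, a; split.
- by rewrite sqrtr_gt0.
- move=> n; rewrite geq_max => /andP[n0n n1]; have [hbn _ sol] := hb n n0n.
  have hz l : cu (multi_front M n T (fun j => chi j n) Z) l =
      ws M T Zj (fun n j => chi j n) n l 0%N.
    apply/funext => x; rewrite /cu /multi_front vc_sum big_add1 big_mkord.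
    apply: eq_bigr => j _; rewrite /cutoff_mul vcZ /=; congr (_ * vc (Z _ _) _).
    by rewrite /pos mulrA.
  pose phi l i x := ws M T Zj (fun n j => chi j n) n l i x + b n l i x.
  have e l : cu (u n) l = phi l 0%N.
    apply/funext => x; rewrite /u /phi -hz /cu /= vcD addrC; congr (_ + _).
    exact: vc_build.
  have sch j : (1 <= j <= M)%N -> smooth (chi j n) by move=> hj; have [] := cok n j n1 hj.
  have jw l : is_jet k (ws M T Zj (fun n j => chi j n) n l).
    by apply: fronts_jet => // j /jZ[].
  have jphi l : is_jet k (phi l) by apply: is_jetD => //; exact: is_hjet_jet.
  have lphi l i : (i <= k)%N -> square_integrable_loc (phi l i).
    move=> ik; apply: square_integrable_locD; last first.
      by apply: L2_square_integrable_loc; apply: (proj1 (hbn l)).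
    apply: square_integrable_loc_sum => j.
    apply: (jet_mul_square_integrable_loc (k := k)) => //; first exact: sch (ord_front j).
    move=> p pk; apply: square_integrable_loc_shift.
    by apply: (proj2 (jZ _ (ord_front j))).
  split.
  + split; first exact: (jet_in_Hk_loc jphi lphi e).
    have li l : locally_integrable setT (cu (u n) l) by rewrite e; have [+ _] := jphi l; exact.
    (* The equation is known for the explicit jet [phi], whereas [is_solution] speaks of [wderiv];
       the two agree almost everywhere. *)
    have [_ ej] := jetof_uniq sh hk jphi (fun l => aeR_all (fun x => esym (congr1 (@^~ x) (e l)))) li.
    have H : aeR (fun x => forall l i, (i <= k)%N -> jetof (u n) l i x = phi l i x).
      by apply: aeR_forall_fin => l; apply: aeR_forall_nat => i; apply: aeR_imp; exact: ej.
    apply/aeRT; apply: aeRS2 H (aeR_forall_fin sol) => x hx sx; apply: vc_inj => l.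
    rewrite vc0 vc_equation -(sx l) /Fop; congr (_ + _).
      by apply: eq_big_nat => i ik; apply: eq_bigr => l' _; rewrite hx//; case/andP: ik.
    by rewrite /Nr; congr (vc (N (build _) _) _); apply/funext => l'; rewrite hx.
  + by [].
  + exact: jet_in_Hk.
  + rewrite -ler_sqr ?nnegrE ?Hk_norm_ge0//; last first.
      by rewrite mulr_ge0 ?sqrtr_ge0// sumr_ge0// => *; rewrite addr_ge0 ?Hk_norm_ge0.
    apply: (le_trans (HkE n n0n)); rewrite exprMn sqr_sqrtr ?(ltW C0)// ler_wpM2l ?(ltW C0)//.
    rewrite big_add1 big_mkord far_regionE Etail_pairs.
    apply: sum_add_le_sqr => [j|j|j|j]; rewrite ?Hk_norm_ge0//.
      have [_ _ _ _ H] := hfront _ (ord_front j).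
      by rewrite (Hk_norm_sqr sh hk (measurable_outside _) H).
    have [_ _ _ H _] := hfront _ (ord_front j).
    by rewrite (Hk_norm_sqr sh hk (measurable_outside _) H).
- apply/cvgrPdist_le => e e0.
  have [r0 r00 small] := Etail_small hPp hPm (divr_gt0 (exprn_gt0 2 e0) C0).
  (* From this index on, [n T / 2 - 1] is at least [r0]. *)
  exists (maxn n0 (Num.truncn (2 * (r0 + 1) / T)).+1) => // n /=.
  rewrite geq_max => /andP[n0n hn].
  rewrite sub0r normrN ger0_norm ?Hk_norm_ge0// -ler_sqr ?nnegrE ?Hk_norm_ge0 ?(ltW e0)//.
  apply: (le_trans (HkE n n0n)); rewrite mulrC -ler_pdivlMr//; apply: small.
  rewrite lerBrDr ler_pdivlMr// mulrC -ler_pdivrMr//.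
  apply: le_trans (_ : (Num.truncn (2 * (r0 + 1) / T)).+1%:R <= _); last by rewrite ler_nat.
  by apply: ltW; exact: truncnS_gt.
Qed.
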